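(* Let $\beta>1$, $\gamma>0$, $\alpha>\beta-2$, let $g\in H(\mathbb D)$ and let $\phi$ be an analytic self-map of $\mathbb D$ such that $S_g^\phi:\mathcal B_\beta\to\mathcal B_\gamma$ is bounded. Then the following statements are equivalent. (a) $S_g^\phi:\mathcal B^0_\beta\to\mathcal B_\gamma$ is nuclear. (b) $S_g^\phi:\mathcal B_\beta\to\mathcal B_\gamma$ is nuclear. (c) $$\int_{\mathbb D}\left[\sup_{z\in\mathbb D}\frac{(1-|z|^2)^\gamma|g(z)|}{|1-\bar\zeta\phi(z)|^{\alpha+3}}\right](1-|\zeta|^2)^{\alpha-\beta+1}\,dA(\zeta)<\infty.$$
   Context: $\mathbb D$ is the open unit disk in $\mathbb C$, $H(\mathbb D)$ the space of analytic functions on $\mathbb D$, and $dA$ normalized Lebesgue measure on $\mathbb D$. For $g\in H(\mathbb D)$ and an analytic map $\phi:\mathbb D\to\mathbb D$, $(S_g^\phi f)(z)=\int_0^z f'(\phi(\zeta))g(\zeta)\,d\zeta$ for $f\in H(\mathbb D)$, $z\in\mathbb D$. For $\beta>0$, the Bloch space of order $\beta$ is $\mathcal B_\beta=\{f\in H(\mathbb D):\sup_{z\in\mathbb D}(1-|z|^2)^\beta|f'(z)|<\infty\}$ with norm $|f(0)|+\sup_{z\in\mathbb D}(1-|z|^2)^\beta|f'(z)|$, and $\mathcal B^0_\beta=\{f\in H(\mathbb D):\lim_{|z|\to1^-}(1-|z|^2)^\beta|f'(z)|=0\}$ with the same norm. A linear operator $T:X\to Y$ between Banach spaces is nuclear if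 there are sequences $(x_k')\subset X'$ (the dual of $X$) and $(y_k)\subset Y$ with $\sum_k\|x_k'\|\|y_k\|<\infty$ and $Tx=\sum_k x_k'(x)y_k$ for all $x\in X$. *)

(* Defs.v *)
From HB Require Import structures.
From mathcomp Require Import all_boot all_order all_algebra.
From mathcomp Require Import complex.
From mathcomp Require Import all_classical all_reals all_analysis.
Set Implicit Arguments.
Unset Strict Implicit.
Unset Printing Implicit Defensive.
Import Order.TTheory GRing.Theory Num.Theory.
Import numFieldNormedType.Exports.
Local Open Scope classical_set_scope.
Local Open Scope complex_scope.
Local Open Scope ring_scope.

(* The library norm on [R[i]] is itself [R[i]]-valued; [normc] is its real
   counterpart. *)
Notation normc := (@ComplexField.Normc.normc _).

(* [R[i]] gets the topology and the normed space structure that the library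
   gives to every field with a norm, so that [derivable f z 1] is complex
   differentiability at [z] and [derive1 f z] is the complex derivative. *)
#[warnings="-redundant-canonical-projection"]
HB.instance Definition _ (R : rcfType) := NormedModule.copy R[i] R[i]^o.

Section NormedOperators.
Context {R : realType} {V W : lmodType R[i]}.
(* The normed spaces are subspaces E of V and F of W, normed by the restrictions
   to E and F of N and M; nothing is asked of N and M elsewhere. *)
Variables (E : set V) (N : V -> R) (F : set W) (M : W -> R).

Definition linear_on (T : V -> W) : Prop :=
  forall (a : R[i]) (x y : V), E x -> E y -> T (a *: x + y) = a *: T x + T y.

Definition linear_operator (T : V -> W) : Prop :=
  (forall x, E x -> F (T x)) /\ linear_on T.

Definition bounded_operator (T : V -> W) : Prop :=
  linear_operator T /\ exists C : R, forall x, E x -> M (T x) <= C * N x.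

End NormedOperators.

Section Nuclear.
Context {R : realType} {V W : lmodType R[i]}.
Variables (E : set V) (N : V -> R) (F : set W) (M : W -> R).

Definition continuous_dual : set (V -> R[i]) :=
  [set l | bounded_operator E N setT normc l].

Definition dual_norm (l : V -> R[i]) : R :=
  sup [set normc (l x) | x in [set x | E x /\ N x <= 1]].

Definition nuclear (T : V -> W) : Prop :=
  linear_operator E F T /\
  exists (l : nat -> V -> R[i]) (y : nat -> W),
    [/\ forall k, continuous_dual (l k),
        forall k, F (y k),
        cvgn (series (fun k => dual_norm (l k) * M (y k))) &
        forall x, E x ->
          M (T x - \sum_(0 <= k < n) l k x *: y k) @[n --> \oo] --> (0 : R)].

End Nuclear.

Section BlochSpaces.
Context {R : realType}.
Implicit Types (f g phi : R[i] -> R[i]) (z : R[i]).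

Definition unit_disk : set R[i] := [set z | normc z < 1].

(* An analytic function on the disk is represented by its extension by zero to
   the whole plane, so that [holomorphic_disk] is in bijection with H(D) and the
   Bloch norms below are genuine norms. *)
Definition holomorphic_disk : set (R[i] -> R[i]) :=
  [set f | (forall z, unit_disk z -> derivable f z 1) /\
           (forall z, ~ unit_disk z -> f z = 0)].

Definition bloch_weight (beta : R) f z : R :=
  (1 - normc z ^+ 2) `^ beta * normc (derive1 f z).

Definition bloch (beta : R) : set (R[i] -> R[i]) :=
  [set f | holomorphic_disk f /\
           has_ubound [set bloch_weight beta f z | z in unit_disk]].

Definition little_bloch (beta : R) : set (R[i] -> R[i]) :=
  [set f | holomorphic_disk f /\
           forall e : R, 0 < e -> \forall r \near (1 : R)^'-,
             forall z, normc z = r -> bloch_weight beta f z < e].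

(* [sup] is real-valued, and is 0 on unbounded sets. The set below is bounded for
   f in [bloch beta] by definition, and for f in [little_bloch beta] because the
   weight is continuous on the disk. *)
Definition bloch_norm (beta : R) f : R :=
  normc (f 0) + sup [set bloch_weight beta f z | z in unit_disk].

Definition integral01 (h : R -> R[i]) : R[i] :=
  (\int[lebesgue_measure]_(t in `[0%R, 1%R]) complex.Re (h t))%R +i*
  (\int[lebesgue_measure]_(t in `[0%R, 1%R]) complex.Im (h t))%R.

(* The path integral from 0 to z is taken along the segment t |-> t z; the
   integrand is analytic on the disk, so any other path gives the same value. *)
Definition volterra g phi f : R[i] -> R[i] :=
  patch (fun=> 0) unit_disk
    (fun z => integral01
       (fun t => derive1 f (phi (t%:C * z)) * g (t%:C * z) * z)).

(* Integral over the disk against the area measure normalized to give the disk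
   mass 1. *)
Definition disk_integral (h : R[i] -> \bar R) : \bar R :=
  ((pi^-1)%:E *
   \int[lebesgue_measure \x lebesgue_measure]_(p in
      [set p : R * R | unit_disk (p.1 +i* p.2)%C]) h (p.1 +i* p.2)%C)%E.

Definition kernel_sup (alpha gamma : R) g phi (zeta : R[i]) : \bar R :=
  ereal_sup [set ((1 - normc z ^+ 2) `^ gamma * normc (g z) /
                  normc (1 - zeta^* * phi z) `^ (alpha + 3))%:E | z in unit_disk].

End BlochSpaces.

(* Main.v *)
(* Put W(z) = (1 - |z|^2)^gamma |g(z)|, d_m = 2^-m, and let
   zeta_{m,j} = (1 - d_m) exp(2 pi i j / 2^m), j < 2^m, be the dyadic lattice of
   the disk. Each of the three statements is equivalent to the convergence of
   the double series of d_m^-beta W_{m,j}, where W_{m,j} is the supremum of W(z)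
   over the z such that |phi(z) - zeta_{m,j}| is at most a constant times d_m.

   For (c) this holds because |1 - conj(zeta) w| is essentially constant when w
   moves in a lattice cell, and because the means of |1 - conj(zeta) w|^-s over
   circles or over roots of unity have the expected size.

   If T = sum l_k (x) y_k is nuclear, test T on F_{m,j} with
   F_{m,j}'(w) = d_m^(M - beta) (1 - conj(zeta_{m,j}) w)^-M. The norm of
   T F_{m,j} is at least a constant times d_m^-beta W_{m,j}, and the sums of
   u_{m,j} F_{m,j} with |u_{m,j}| <= 1 are uniformly bounded in norm, so that
   sum_{m,j} |l(F_{m,j})| <= C ||l|| for every functional l.

   Conversely, let tau_x h(w) = sum_i q_i h(x^i w), where the q_i are the
   coefficients of prod_{j < M} (1 - x^-j s). On the Cauchy kernel 1 / (1 - v)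
   the operator tau_x gives
   prod_{i <= M} (1 - x^i) v^M / prod_{j <= M} (1 - x^j v), which is
   O((1 - x)^M / |1 - v|^(M + 1)). With x_m = (1 - d_m)^2 and tau_0 replaced by
   the identity, f' is the sum of the (tau_{x_m} - tau_{x_{m+1}}) f', and Cauchy's
   formula writes each term as a mean over the circle |zeta| = 1 - d_{m+1} of f'
   against a kernel of size d_m^M / |1 - conj(zeta) w|^(M + 1). Replacing these
   means by averages over roots of unity, refined dyadically so that the
   corrections are summable, exhibits f' as a series of rank-one terms; the
   convergence of the double series bounds the sum of their nuclear norms. *)
Require Import Defs.
From mathcomp Require Import all_boot all_order all_algebra.
From mathcomp Require Import complex.
From mathcomp Require Import all_classical all_reals all_analysis.
From mathcomp Require Import measurable_realfun ring lra.
Import Order.TTheory GRing.Theory Num.Theory.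
Import numFieldNormedType.Exports.
Set Implicit Arguments.
Unset Strict Implicit.
Unset Printing Implicit Defensive.
Local Open Scope classical_set_scope.
Local Open Scope complex_scope.
Local Open Scope ring_scope.


(** * The real-valued norm of complex numbers *)

(** The double series involves neither alpha nor the domain of the operator: the test functions have
    bounded derivatives, hence lie in both Bloch spaces, and the converse is built from values of f'
    at points of the disk, which are functionals on both. The obstacle in the converse is that f' is
    in general not the limit of its dilates in the Bloch norm, so that a decomposition of f' on the
    whole space converges only pointwise. This is enough: once bounds for the nuclear norms of the
    terms are summable, their tail dominates the remainder at every point, hence in norm. A nuclear
    representation also demands a series of rank-one terms and not an integral of them. Passing from
    n to 2n roots of unity in a circle mean costs O(1/n), with an uncontrolled constant on each
    circle, which is absorbed by starting from enough nodes. That many nodes do no harm, because the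
    lattice estimates are uniform in the number N >= 2^m of roots of unity on the circle of radius 1
    - 2^-m. The exponent M exceeds beta so that sums over the levels are geometric on both sides of
    the scale 1 - |w|. *)

Section ComplexModulus.
Context {R : realType}.
Implicit Types (x y z : R[i]) (r : R).

Lemma normc_ge0 z : 0 <= normc z.
Proof. by case: z => a b; exact: sqrtr_ge0. Qed.

Lemma normc_eq0 z : (normc z == 0) = (z == 0).
Proof.
apply/eqP/eqP => [/ComplexField.Normc.eq0_normc//|->].
exact: ComplexField.Normc.normc0.
Qed.

Lemma normc_gt0 z : (0 < normc z) = (z != 0).
Proof. by rewrite lt_neqAle normc_ge0 eq_sym normc_eq0 andbT. Qed.

Lemma normc0 : normc (0 : R[i]) = 0.
Proof. exact: ComplexField.Normc.normc0. Qed.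

Lemma normc1 : normc (1 : R[i]) = 1.
Proof. exact: ComplexField.Normc.normc1. Qed.

Lemma normcM x y : normc (x * y) = normc x * normc y.
Proof. exact: ComplexField.Normc.normcM. Qed.

Lemma normcV x : normc x^-1 = (normc x)^-1.
Proof. exact: ComplexField.Normc.normcV. Qed.

Lemma normcX x n : normc (x ^+ n) = normc x ^+ n.
Proof.
by elim: n => [|n IH]; rewrite ?expr0 ?normc1// !exprS normcM IH.
Qed.

Lemma normcD x y : normc (x + y) <= normc x + normc y.
Proof. exact: (le_normcD x y). Qed.

Lemma normcN x : normc (- x) = normc x.
Proof. exact: (complex.normcN x). Qed.

Lemma normcB x y : normc (x - y) <= normc x + normc y.
Proof. by rewrite (le_trans (normcD _ _))// normcN. Qed.

Lemma normc_distC x y : normc (x - y) = normc (y - x).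
Proof. by rewrite -normcN opprB. Qed.

Lemma normc_dist_trans y x z : normc (x - z) <= normc (x - y) + normc (y - z).
Proof. by rewrite (le_trans _ (normcD _ _))// addrA subrK. Qed.

Lemma lerB_normc x y : normc x - normc y <= normc (x - y).
Proof. by rewrite lerBlDr (le_trans _ (normcD _ _))// subrK. Qed.

Lemma normc_sum I (s : seq I) (P : pred I) (F : I -> R[i]) :
  normc (\sum_(i <- s | P i) F i) <= \sum_(i <- s | P i) normc (F i).
Proof.
elim/big_ind2 : _ => //; first by rewrite normc0.
by move=> a b c d ab cd; rewrite (le_trans (normcD _ _))// lerD.
Qed.

Lemma normc_real r : normc r%:C = `|r|.
Proof. by rewrite /= expr0n addr0 sqrtr_sqr. Qed.

Lemma normc_realM r z : normc (r%:C * z) = `|r| * normc z.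
Proof. by rewrite normcM normc_real. Qed.

Lemma normcJ z : normc z^*%C = normc z.
Proof. by case: z => a b /=; rewrite sqrrN. Qed.

Lemma normc_Re z : `|complex.Re z| <= normc z.
Proof. by case: z => a b /=; rewrite -sqrtr_sqr ler_wsqrtr// lerDl sqr_ge0. Qed.

Lemma normc_Im z : `|complex.Im z| <= normc z.
Proof. by case: z => a b /=; rewrite -sqrtr_sqr ler_wsqrtr// lerDr sqr_ge0. Qed.

Lemma normc_le_ReIm z : normc z <= `|complex.Re z| + `|complex.Im z|.
Proof.
case: z => a b /=; rewrite -[leRHS]ger0_norm ?addr_ge0// -sqrtr_sqr.
by apply: ler_wsqrtr; rewrite sqrrD !real_normK ?num_real// lerD2r lerDl
  mulrn_wge0// mulr_ge0.
Qed.

Lemma normc_sqr z : (normc z ^+ 2)%:C = z * z^*%C.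
Proof.
case: z => a b; rewrite /= sqr_sqrtr ?addr_ge0 ?sqr_ge0//.
by apply/eqP; rewrite eq_complex /=; apply/andP; split; apply/eqP; ring.
Qed.

(** The form in which identities between integrals are obtained below: an error e C with C fixed,
    for every e. *)
Lemma normc_le_forall_eps z (C : R) : (forall e, 0 < e -> normc z <= e * C) -> z = 0.
Proof.
move=> H; apply/eqP; rewrite -normc_eq0; apply/negPn/negP => z0.
have z1 : 0 < normc z by rewrite lt_neqAle eq_sym z0 normc_ge0.
have C1 : 0 < `|C| + 1 by rewrite ltr_pwDr.
have e0 : 0 < normc z / 2 / (`|C| + 1) by rewrite !divr_gt0.
have := H _ e0.
suff : normc z / 2 / (`|C| + 1) * C < normc z by move=> /lt_le_trans h /h; rewrite ltxx.
apply: (@le_lt_trans _ _ (normc z / 2)); last by lra.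
rewrite -mulrA ler_piMr ?divr_ge0 ?normc_ge0// mulrC ler_pdivrMr// mul1r.
by rewrite (le_trans (ler_norm _))// lerDl.
Qed.

End ComplexModulus.

(** * Complex differentiation *)

Section ComplexDifferentiability.
Context {R : realType}.
Implicit Types (f g : R[i] -> R[i]) (z w l : R[i]).

(** Complex differentiability without quotients and with real tolerances, which suits products,
    compositions and integral estimates; [cdiffP] identifies it with [derivable] and [derive1]. *)
Definition cdiff f z l := forall e : R, 0 < e -> exists2 d : R, 0 < d &
  forall w, normc (w - z) < d ->
    normc (f w - f z - l * (w - z)) <= e * normc (w - z).

Lemma cdiff_continuous f z l : cdiff f z l ->
  exists C : R, exists2 d : R, 0 < d &
   forall w, normc (w - z) < d -> normc (f w - f z) <= C * normc (w - z).
Proof.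
move=> /(_ 1 ltr01) [d d0 H]; exists (1 + normc l), d => // w /H {}H.
rewrite mulrDl -normcM.
by rewrite (le_trans _ (lerD H (lexx _)))// (le_trans _ (normcD _ _))// subrK.
Qed.

Lemma cdiff_ext f g z l (r : R) : 0 < r ->
  (forall w, normc (w - z) < r -> f w = g w) -> cdiff f z l -> cdiff g z l.
Proof.
move=> r0 fg fl e e0; have [d d0 H] := fl e e0.
exists (Num.min d r); first by rewrite lt_min d0.
move=> w; rewrite lt_min => /andP[wd wr].
by rewrite -!fg ?subrr ?normc0// H.
Qed.

Lemma cdiff_cst (c : R[i]) z : cdiff (fun=> c) z 0.
Proof.
by move=> e e0; exists 1 => // w _; rewrite subrr mul0r subr0 normc0 mulr_ge0 ?normc_ge0// ltW.
Qed.

Lemma cdiff_id z : cdiff id z 1.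
Proof.
by move=> e e0; exists 1 => // w _; rewrite mul1r subrr normc0 mulr_ge0 ?normc_ge0// ltW.
Qed.

Lemma cdiffD f g z l m : cdiff f z l -> cdiff g z m ->
  cdiff (fun w => f w + g w) z (l + m).
Proof.
move=> fl gm e e0; have e2 : 0 < e / 2 by rewrite divr_gt0.
have [d d0 H] := fl _ e2; have [d' d'0 H'] := gm _ e2.
exists (Num.min d d'); first by rewrite lt_min d0.
move=> w; rewrite lt_min => /andP[/H{}H /H'{}H'].
rewrite (_ : _ - _ = (f w - f z - l * (w - z)) + (g w - g z - m * (w - z))); last by ring.
by rewrite (le_trans (normcD _ _))// (le_trans (lerD H H'))// -mulrDl -splitr.
Qed.

Lemma cdiff_comp f g z l m : cdiff f z l -> cdiff g (f z) m ->
  cdiff (fun w => g (f w)) z (m * l).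
Proof.
move=> fl gm e e0.
have [C [d1 d10 fC]] := cdiff_continuous fl.
have [d2 d20 H2] := gm (e / 2 / (`|C| + 1)) ltac:(by rewrite !divr_gt0// ltr_pwDr).
have [d3 d30 H3] := fl (e / 2 / (normc m + 1))
   ltac:(by rewrite !divr_gt0// ltr_pwDr// normc_ge0).
exists (Num.min d3 (Num.min d1 (d2 / (`|C| + 1)))).
  by rewrite !lt_min d10 d30 divr_gt0// ltr_pwDr.
move=> w; rewrite !lt_min => /andP[/H3{}H3 /andP[/fC{}fC wd]].
rewrite (_ : _ - _ = (g (f w) - g (f z) - m * (f w - f z))
    + m * (f w - f z - l * (w - z))); last by ring.
have fC' : normc (f w - f z) <= (`|C| + 1) * normc (w - z).
  rewrite (le_trans fC)// ler_wpM2r ?normc_ge0// (le_trans (ler_norm _))//.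
  by rewrite lerDl.
have C1 : 0 < `|C| + 1 by rewrite ltr_pwDr.
have m1 : 0 < normc m + 1 by rewrite ltr_pwDr// normc_ge0.
have e20 : 0 <= e / 2 by rewrite divr_ge0// ltW.
have {}H2 := H2 (f w) ltac:(by rewrite (le_lt_trans fC')// -ltr_pdivlMl// mulrC).
rewrite (le_trans (normcD _ _))// normcM (splitr e) mulrDl lerD//.
  rewrite (le_trans H2)//.
  by rewrite -mulrA ler_wpM2l// mulrC ler_pdivrMr// mulrC.
rewrite (le_trans (ler_wpM2l (normc_ge0 _) H3))// mulrA ler_wpM2r ?normc_ge0//.
by rewrite mulrCA ler_piMr// ler_pdivrMr// mul1r lerDl.
Qed.

Lemma cdiffM f g z l m : cdiff f z l -> cdiff g z m ->
  cdiff (fun w => f w * g w) z (l * g z + f z * m).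
Proof.
move=> fl gm e e0.
have [C [d1 d10 fC]] := cdiff_continuous fl.
have [C' [d2 d20 gC]] := cdiff_continuous gm.
pose A := `|C| * `|C'| + 1 + normc (g z) + normc (f z).
have A0 : 0 < A.
  by rewrite /A -!addrA ltr_wpDl// ?mulr_ge0// ltr_pwDl// addr_ge0// normc_ge0.
have eA : 0 < e / A by rewrite divr_gt0.
have [d3 d30 fl'] := fl _ eA; have [d4 d40 gm'] := gm _ eA.
exists (Num.min (Num.min d1 d2) (Num.min (Num.min d3 d4) (e / A))).
  by rewrite !lt_min d10 d20 d30 d40 eA.
move=> w; rewrite !lt_min => /andP[/andP[/fC{}fC /gC{}gC] /andP[/andP[/fl'{}fl' /gm'{}gm'] we]].
set n := normc (w - z) in fC gC fl' gm' we *.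
have n0 : 0 <= n by exact: normc_ge0.
rewrite (_ : _ - _ = (f w - f z) * (g w - g z) + (f w - f z - l * (w - z)) * g z
   + f z * (g w - g z - m * (w - z))); last by ring.
rewrite (le_trans (normcD _ _))// (le_trans (lerD (normcD _ _) (lexx _)))// !normcM.
have e1 : normc (f w - f z) * normc (g w - g z) <= e / A * n * (`|C| * `|C'|).
  have h1 : normc (f w - f z) <= `|C| * n.
    by rewrite (le_trans fC)// ler_wpM2r// ler_norm.
  have h2 : normc (g w - g z) <= `|C'| * n.
    by rewrite (le_trans gC)// ler_wpM2r// ler_norm.
  rewrite (le_trans (ler_pM (normc_ge0 _) (normc_ge0 _) h1 h2))//.
  rewrite (_ : _ * _ = n * (n * (`|C| * `|C'|))); last by ring.
  rewrite mulrA ler_wpM2r ?mulr_ge0// ler_wpM2r// ltW//.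
have e2 := ler_wpM2r (normc_ge0 (g z)) fl'.
have e3 := ler_wpM2l (normc_ge0 (f z)) gm'.
rewrite (le_trans (lerD (lerD e1 e2) e3))//.
rewrite (_ : _ + _ = e / A * (A - 1) * n); last by rewrite /A; ring.
rewrite ler_wpM2r// -mulrA ler_piMr 1?ltW// mulrC ltr_pdivrMr// mul1r ltrBlDr ltrDl//.
Qed.

Lemma cdiff_inv z : z != 0 -> cdiff (fun w => w^-1) z (- z^-2).
Proof.
move=> z0 e e0; have nz : 0 < normc z by rewrite normc_gt0.
exists (Num.min (normc z / 2) (e * normc z ^+ 3 / 2)).
  by rewrite lt_min !divr_gt0// mulr_gt0// exprn_gt0.
move=> w; rewrite lt_min => /andP[w1 w2].
have wz : normc z / 2 < normc w.
  have := lerB_normc z (z - w); rewrite opprB addrCA subrr addr0 => h.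
  rewrite (lt_le_trans _ h)// normc_distC; lra.
have w0 : w != 0 by rewrite -normc_gt0 (lt_trans _ wz)// divr_gt0.
rewrite (_ : _ - _ = (w - z) ^+ 2 / (w * z ^+ 2)); last first.
  by field; rewrite z0 w0.
rewrite normcM normcX normcV normcM normcX expr2 -mulrA mulrC.
rewrite ler_wpM2r ?normc_ge0// ler_pdivrMr ?mulr_gt0 ?exprn_gt0 ?normc_gt0//.
rewrite (le_trans (ltW w2))// -mulrA ler_wpM2l 1?ltW//.
rewrite exprSr -mulrA mulrC ltr_pM2r ?exprn_gt0//.
Qed.

Lemma cdiff_eq f z l m : cdiff f z l -> l = m -> cdiff f z m.
Proof. by move=> h <-. Qed.

Lemma cdiffZ f z l (c : R[i]) : cdiff f z l -> cdiff (fun w => c * f w) z (c * l).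
Proof.
by move=> fl; apply: cdiff_eq (cdiffM (cdiff_cst c z) fl) _; rewrite mul0r add0r.
Qed.

Lemma cdiffB f g z l m : cdiff f z l -> cdiff g z m ->
  cdiff (fun w => f w - g w) z (l - m).
Proof.
move=> fl gm; have := cdiffD fl (cdiffZ (-1) gm); rewrite mulN1r.
by apply: cdiff_ext ltr01 _ => w _; rewrite mulN1r.
Qed.

Lemma cdiff_sum I (s : seq I) (F : I -> R[i] -> R[i]) (L : I -> R[i]) z :
  (forall i, cdiff (F i) z (L i)) ->
  cdiff (fun w => \sum_(i <- s) F i w) z (\sum_(i <- s) L i).
Proof.
move=> H; elim: s => [|i s IH].
  rewrite big_nil; apply: cdiff_ext ltr01 _ (cdiff_cst 0 z) => w _.
  by rewrite big_nil.
rewrite big_cons; apply: cdiff_ext ltr01 _ (cdiffD (H i) IH) => w _.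
by rewrite big_cons.
Qed.

Lemma cdiffP f z l : cdiff f z l <-> derivable f z 1 /\ derive1 f z = l.
Proof.
have key m : (h^-1 *: (f (h *: 1 + z) - f z) @[h --> (0 : R[i])^'] --> (m : R[i]))
    <-> cdiff f z m.
  split.
    move=> /cvgrPdist_le H e e0.
    have eC : 0 < e%:C by rewrite ltcR.
    have /nbhs_ballP[d /= d0 {}H] := H _ eC.
    (* The radius of the ball lives in R[i]; being positive there, it is real. *)
    have dR : d = (normc d)%:C.
      by rewrite -[LHS]ger0_norm ?ltW.
    exists (normc d); first by rewrite normc_gt0 gt_eqF.
    move=> w wd; have [->|wz] := eqVneq w z.
      by rewrite !subrr mulr0 subr0 normc0 mulr0.
    have := H (w - z); rewrite /= => {}H.
    have {}H : `|m - (w - z)^-1 *: (f ((w - z) *: 1 + z) - f z)| <= e%:C.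
      apply: H; last by rewrite subr_eq0.
      by rewrite -ball_normE /= sub0r normrN dR; change ((normc (w - z))%:C < (normc d)%:C); rewrite ltcR.
    move: H; change ((normc (m - (w - z)^-1 *: (f ((w - z) *: 1 + z) - f z)))%:C <= e%:C -> normc (f w - f z - m * (w - z)) <= e * normc (w - z)).
    rewrite lecR.
    rewrite (_ : (w - z) *: 1 + z = w); last first.
      by rewrite -[(w - z) *: 1]/((w - z) * 1) mulr1 subrK.
    rewrite -[X in m - X]/((w - z)^-1 * (f w - f z)) => H.
    have wz0 : w - z != 0 by rewrite subr_eq0.
    rewrite (_ : _ - _ = - ((m - (w - z)^-1 * (f w - f z)) * (w - z))); last by field.
    by rewrite normcN normcM ler_wpM2r ?normc_ge0.
  move=> H; apply/cvgrPdist_le => e e0.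
  have eR : e = (normc e)%:C by rewrite -[LHS]ger0_norm ?ltW.
  have e1 : 0 < normc e by rewrite normc_gt0 gt_eqF.
  have [d d0 {}H] := H _ e1.
  apply/nbhs_ballP; exists d%:C => /=; first by rewrite ltcR.
  move=> h; rewrite -ball_normE /= sub0r normrN; change ((normc h)%:C < d%:C -> h != 0 -> (normc (m - h^-1 *: (f (h *: 1 + z) - f z)))%:C <= e).
  rewrite ltcR eR lecR => hd h0.
  have := H (z + h); rewrite addrAC subrr add0r => /(_ hd).
  rewrite (_ : h *: 1 + z = z + h); last first.
    by rewrite -[h *: 1]/(h * 1) mulr1 addrC.
  rewrite -[X in m - X]/(h^-1 * (f (z + h) - f z)) => {}H.
  rewrite (_ : _ - _ = - ((f (z + h) - f z - m * h) / h)); last by field.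
  rewrite normcN normcM normcV ler_pdivrMr ?normc_gt0//.
have d1 : derive1 f z = lim (h^-1 *: (f (h *: 1 + z) - f z) @[h --> (0 : R[i])^']).
  rewrite /derive1; congr (lim (_ @ 0^')); apply/funext => h.
  by congr (_ *: (f (_ + _) - _)); rewrite -[RHS]/(h * 1) mulr1.
split.
  move=> /key H; split; first by apply/cvg_ex; exists l.
  by rewrite d1; exact/cvg_lim.
move=> [/cvg_ex[/= m H] <-].
by rewrite d1 (cvg_lim _ H)//; exact/key.
Qed.

End ComplexDifferentiability.

(** * Complex-valued integrals over an interval *)

Section ComplexIntegral.
Context {R : realType}.
Implicit Types (F G : R -> R[i]) (a b c t s : R).
Local Notation mu := (@lebesgue_measure R).

Definition ccont F t := forall e : R, 0 < e -> exists2 d : R, 0 < d &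
  forall s, `|s - t| < d -> normc (F s - F t) < e.

(** Continuity at every point of [a, b] as a function on the whole line, hence two-sided also at the
    endpoints. *)
Definition cont_on a b F := forall t, a <= t <= b -> ccont F t.

(** Over [0, 1] this is [integral01] up to conversion, which is why [volterraE] below is
    immediate. *)
Definition cint a b F : R[i] :=
  (\int[mu]_(t in `[a, b]) complex.Re (F t)) +i*
  (\int[mu]_(t in `[a, b]) complex.Im (F t)).

Lemma ccont_Re F t : ccont F t -> {for t, continuous (fun s => complex.Re (F s))}.
Proof.
move=> H; apply/cvgrPdist_lt => e e0; have [d d0 {}H] := H e e0.
near=> s; rewrite distrC -raddfB (le_lt_trans (normc_Re _))//; apply: H.
by near: s; exists d => //= s /=; rewrite distrC.
Unshelve. all: by end_near. Qed.

Lemma ccont_Im F t : ccont F t -> {for t, continuous (fun s => complex.Im (F s))}.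
Proof.
move=> H; apply/cvgrPdist_lt => e e0; have [d d0 {}H] := H e e0.
near=> s; rewrite distrC -raddfB (le_lt_trans (normc_Im _))//; apply: H.
by near: s; exists d => //= s /=; rewrite distrC.
Unshelve. all: by end_near. Qed.

Lemma cont_within_Re a b F : cont_on a b F ->
  {within `[a, b], continuous (fun s => complex.Re (F s))}.
Proof.
move=> H; apply: continuous_in_subspaceT => t; rewrite inE/= in_itv/= => tab.
exact/ccont_Re/H.
Qed.

Lemma cont_within_Im a b F : cont_on a b F ->
  {within `[a, b], continuous (fun s => complex.Im (F s))}.
Proof.
move=> H; apply: continuous_in_subspaceT => t; rewrite inE/= in_itv/= => tab.
exact/ccont_Im/H.
Qed.

Lemma cont_integrable_Re a b F : cont_on a b F ->
  mu.-integrable `[a, b] (EFin \o (fun s => complex.Re (F s))).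
Proof.
move=> /cont_within_Re H.
exact: (continuous_compact_integrable (@segment_compact R a b) H).
Qed.

Lemma cont_integrable_Im a b F : cont_on a b F ->
  mu.-integrable `[a, b] (EFin \o (fun s => complex.Im (F s))).
Proof.
move=> /cont_within_Im H.
exact: (continuous_compact_integrable (@segment_compact R a b) H).
Qed.

Lemma eq_cint a b F G : (forall t, a <= t <= b -> F t = G t) ->
  cint a b F = cint a b G.
Proof.
by move=> FG; congr (_ +i* _); apply: eq_Rintegral => t;
  rewrite inE/= in_itv/= => /FG ->.
Qed.

Lemma cintD a b F G : cont_on a b F -> cont_on a b G ->
  cint a b (fun t => F t + G t) = cint a b F + cint a b G.
Proof.
move=> cF cG; rewrite /cint; apply/eqP; rewrite eq_complex /=; apply/andP; split; apply/eqP.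
  rewrite -RintegralD//; [|exact: cont_integrable_Re..].
  by apply: eq_Rintegral => t _; rewrite raddfD.
rewrite -RintegralD//; [|exact: cont_integrable_Im..].
by apply: eq_Rintegral => t _; rewrite raddfD.
Qed.

Lemma cintZ a b F (k : R[i]) : cont_on a b F ->
  cint a b (fun t => k * F t) = k * cint a b F.
Proof.
move=> cF; have iR := cont_integrable_Re cF; have iI := cont_integrable_Im cF.
have iZ (r : R) f : mu.-integrable `[a, b] (EFin \o f) ->
    mu.-integrable `[a, b] (EFin \o (fun t => r * f t)).
  move=> fi; rewrite (_ : _ \o _ = (fun x => r%:E * (EFin \o f) x)%E).
    exact: integrableZl.
  by apply/funext => x /=; rewrite EFinM.
case: k => p q; rewrite /cint; apply/eqP; rewrite eq_complex /=; apply/andP; split; apply/eqP.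
  rewrite -!RintegralZl//; try exact: iZ.
  rewrite -RintegralB//; try exact: iZ.
  by apply: eq_Rintegral => t _; case: (F t).
rewrite -!RintegralZl//; try exact: iZ.
rewrite -RintegralD//; try exact: iZ.
by apply: eq_Rintegral => t _; case: (F t).
Qed.

Lemma cint_cst a b (k : R[i]) : a <= b -> cint a b (fun=> k) = (b - a)%:C * k.
Proof.
move=> ab; rewrite /cint !Rintegral_cst//= lebesgue_measure_itv/= lte_fin.
have -> : fine (if a < b then (b%:E - a%:E)%E else 0%E) = b - a.
  by case: ltP => [_|ba]//=; apply/eqP; rewrite eq_sym subr_eq0 eq_le ba.
by case: k => p q; apply/eqP; rewrite eq_complex /=; apply/andP; split; apply/eqP; ring.
Qed.

Lemma Rint_bound a b (f : R -> R) (C : R) : a <= b ->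
  mu.-integrable `[a, b] (EFin \o f) -> (forall t, a <= t <= b -> `|f t| <= C) ->
  `|\int[mu]_(t in `[a, b]) f t| <= C * (b - a).
Proof.
move=> ab fi fC; rewrite (le_trans (le_normr_Rintegral _ _))//.
have -> : C * (b - a) = \int[mu]_(t in `[a, b]) C.
  rewrite Rintegral_cst//= lebesgue_measure_itv/= lte_fin; congr (_ * _).
  by case: ltP => [_|ba]//=; apply/eqP; rewrite subr_eq0 eq_le ba.
apply: le_Rintegral => //.
- exact: (integrable_abse fi).
- apply: continuous_compact_integrable; first exact: segment_compact.
  by apply: continuous_subspaceT => x; exact: cvg_cst.
Qed.

(** The factor 2 comes from bounding the real and the imaginary part separately. *)
Lemma cint_bound a b F (C : R) : a <= b -> cont_on a b F ->
  (forall t, a <= t <= b -> normc (F t) <= C) ->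
  normc (cint a b F) <= 2 * C * (b - a).
Proof.
move=> ab cF FC; rewrite (le_trans (normc_le_ReIm _))//= -mulrA mulr_natl mulr2n lerD//.
- apply: Rint_bound => //; first exact: cont_integrable_Re.
  by move=> t /FC; apply: le_trans; exact: normc_Re.
- apply: Rint_bound => //; first exact: cont_integrable_Im.
  by move=> t /FC; apply: le_trans; exact: normc_Im.
Qed.

Lemma Rint_chasles a b c (f : R -> R) : a <= b -> b <= c ->
  mu.-integrable `[a, c] (EFin \o f) ->
  \int[mu]_(t in `[a, c]) f t =
  \int[mu]_(t in `[a, b]) f t + \int[mu]_(t in `[b, c]) f t.
Proof.
move=> ab bc fi.
have ib : mu.-integrable `]b, c] (EFin \o f).
  by apply: integrableS fi => //; apply: subset_itvr; rewrite bnd_simp.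
have := @Rintegral_itvB R f (BLeft a) (BRight c) b fi.
rewrite !bnd_simp => /(_ ab bc) /eqP; rewrite subr_eq addrC => /eqP ->.
by congr (_ + _); rewrite -Rintegral_itv_obnd_cbnd.
Qed.

Lemma cint_chasles a b c F : a <= b -> b <= c -> cont_on a c F ->
  cint a c F = cint a b F + cint b c F.
Proof.
move=> ab bc cF; rewrite /cint (Rint_chasles ab bc (cont_integrable_Re cF)).
by rewrite (Rint_chasles ab bc (cont_integrable_Im cF)).
Qed.

Lemma cont_onD a b F G : cont_on a b F -> cont_on a b G ->
  cont_on a b (fun t => F t + G t).
Proof.
move=> cF cG t tab e e0; have e2 : 0 < e / 2 by rewrite divr_gt0.
have [d d0 H] := cF t tab _ e2; have [d' d'0 H'] := cG t tab _ e2.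
exists (Num.min d d'); first by rewrite lt_min d0.
move=> s; rewrite lt_min => /andP[/H{}H /H'{}H']; rewrite [ltRHS]splitr.
by rewrite opprD addrACA (le_lt_trans (normcD _ _))// ltrD.
Qed.

Lemma ccontZ F (k : R[i]) t : ccont F t -> ccont (fun t => k * F t) t.
Proof.
move=> cF e e0; have k1 : 0 < normc k + 1 by rewrite ltr_pwDr// normc_ge0.
have [d d0 H] := cF (e / (normc k + 1)) ltac:(by rewrite divr_gt0).
exists d => // s /H{}H; rewrite -mulrBr normcM.
have [->|k0] := eqVneq k 0; first by rewrite normc0 mul0r.
rewrite mulrC; apply: (@le_lt_trans _ _ (normc (F s - F t) * (normc k + 1))).
  by rewrite ler_wpM2l ?normc_ge0// lerDl.
by rewrite -ltr_pdivlMr.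
Qed.

Lemma cont_onZ a b F (k : R[i]) : cont_on a b F -> cont_on a b (fun t => k * F t).
Proof. by move=> H t /H; exact: ccontZ. Qed.

Lemma cont_on_cst a b (k : R[i]) : cont_on a b (fun=> k).
Proof. by move=> t _ e e0; exists 1 => // s _; rewrite subrr normc0. Qed.

Lemma cont_on_ext a b F G : F =1 G -> cont_on a b F -> cont_on a b G.
Proof. by move=> /funext ->. Qed.

Lemma cont_onB a b F G : cont_on a b F -> cont_on a b G ->
  cont_on a b (fun t => F t - G t).
Proof.
move=> cF cG; apply: cont_onD => //.
by apply: cont_on_ext (cont_onZ (-1) cG) => x; rewrite mulN1r.
Qed.

Lemma cintB a b F G : cont_on a b F -> cont_on a b G ->
  cint a b (fun t => F t - G t) = cint a b F - cint a b G.
Proof.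
move=> cF cG; rewrite -(mulN1r (cint a b G)) -cintZ// -cintD//; last exact: cont_onZ.
by apply: eq_cint => t _; rewrite mulN1r.
Qed.

Lemma lipschitz_ccont F t (L : R) :
  (forall s, normc (F s - F t) <= L * `|s - t|) -> ccont F t.
Proof.
move=> H e e0; have L1 : 0 < `|L| + 1 by rewrite ltr_pwDr.
exists (e / (`|L| + 1)); first by rewrite divr_gt0.
move=> s; rewrite ltr_pdivlMr// => sd; rewrite (le_lt_trans (H s))// (le_lt_trans _ sd)//.
by rewrite mulrC ler_wpM2l// (le_trans (ler_norm _))// lerDl.
Qed.

Definition rdiff F t (l : R[i]) := forall e : R, 0 < e -> exists2 d : R, 0 < d &
  forall s, `|s - t| < d -> normc (F s - F t - l * (s - t)%:C) <= e * `|s - t|.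

Lemma rdiff_comp F G (f : R[i] -> R[i]) t l m : cdiff f (F t) l -> rdiff F t m ->
  (forall s, G s = f (F s)) -> rdiff G t (l * m).
Proof.
move=> fl Fm GE e e0.
have k1 : 0 < normc m + 1 by rewrite ltr_pwDr// normc_ge0.
have l1 : 0 < normc l + 1 by rewrite ltr_pwDr// normc_ge0.
have [d1 d10 H1] := fl (e / 2 / (normc m + 1)) ltac:(by rewrite !divr_gt0).
have [d2 d20 H2] := Fm 1 ltr01.
have [d3 d30 H3] := Fm (e / 2 / (normc l + 1)) ltac:(by rewrite !divr_gt0).
exists (Num.min (Num.min d2 d3) (d1 / (normc m + 1))).
  by rewrite !lt_min d20 d30 divr_gt0.
move=> s; rewrite !lt_min => /andP[/andP[/H2{}H2 /H3{}H3]]; rewrite ltr_pdivlMr// => sd.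
have FF : normc (F s - F t) <= (normc m + 1) * `|s - t|.
  rewrite -(subrK (m * (s - t)%:C) (F s - F t)) (le_trans (normcD _ _))//.
  by rewrite addrC mulrDl lerD// normcM normc_real.
have {}H1 : _ := H1 (F s) (le_lt_trans FF _); rewrite mulrC in sd; have {}H1 := H1 sd.
rewrite !GE (_ : _ - _ = (f (F s) - f (F t) - l * (F s - F t)) +
   l * (F s - F t - m * (s - t)%:C)); last by ring.
rewrite (le_trans (normcD _ _))// normcM (splitr e) mulrDl lerD//.
  rewrite (le_trans H1)// -mulrA ler_wpM2l ?divr_ge0 ?(ltW e0)//.
  by rewrite mulrC ler_pdivrMr// mulrC.
rewrite (le_trans (ler_wpM2l (normc_ge0 _) H3))// mulrA ler_wpM2r//.
by rewrite mulrCA ler_piMr ?divr_ge0 ?(ltW e0)// ler_pdivrMr// mul1r lerDl.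
Qed.

Lemma rdiff_ccont F t l : rdiff F t l -> ccont F t.
Proof.
move=> /(_ 1 ltr01)[d d0 H] e e0.
have l1 : 0 < normc l + 1 by rewrite ltr_pwDr// normc_ge0.
exists (Num.min d (e / (normc l + 1))); first by rewrite lt_min d0 divr_gt0.
move=> s; rewrite lt_min ltr_pdivlMr// => /andP[/H{}H sd].
rewrite -(subrK (l * (s - t)%:C) (F s - F t)) (le_lt_trans (normcD _ _))//.
rewrite (le_lt_trans _ sd)// mulrDr addrC lerD//.
  by rewrite normcM normc_real mulrC.
by rewrite mulr1 -[leRHS]mul1r.
Qed.

Lemma rdiff_is_derive (f : R -> R) t l :
  (forall e : R, 0 < e -> exists2 d : R, 0 < d &
   forall s, `|s - t| < d -> `|f s - f t - l * (s - t)| <= e * `|s - t|) ->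
  is_derive t 1 f l.
Proof.
move=> H.
have K : h^-1 *: (f (h *: 1 + t) - f t) @[h --> (0 : R)^'] --> (l : R).
  apply/cvgrPdist_le => e e0; have [d d0 {}H] := H _ e0.
  apply/nbhs_ballP; exists d => // h; rewrite -ball_normE/= sub0r normrN => hd h0.
  have -> : h *: 1 + t = h + t by rewrite -[h *: 1]/(h * 1) mulr1.
  rewrite -[X in l - X]/(h^-1 * (f (h + t) - f t)).
  have := H (h + t); rewrite addrK => /(_ hd) {}H.
  have -> : l - h^-1 * (f (h + t) - f t) = - ((f (h + t) - f t - l * h) / h) by field.
  by rewrite normrN normrM normfV ler_pdivrMr ?normr_gt0.
split; first by apply/cvg_ex; exists l.
exact/cvg_lim.
Qed.

Lemma rdiff_Re F t l : rdiff F t l ->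
  is_derive t 1 (fun s => complex.Re (F s)) (complex.Re l).
Proof.
move=> H; apply: rdiff_is_derive => e e0; have [d d0 {}H] := H e e0.
exists d => // s /H; apply: le_trans; rewrite -[X in `|X| <= _]/(_ : R).
rewrite (le_trans _ (normc_Re _))//.
by case: (F s) (F t) l {H} => [a b] [a' b'] [p q] /=; rewrite mulr0 subr0.
Qed.

Lemma rdiff_Im F t l : rdiff F t l ->
  is_derive t 1 (fun s => complex.Im (F s)) (complex.Im l).
Proof.
move=> H; apply: rdiff_is_derive => e e0; have [d d0 {}H] := H e e0.
exists d => // s /H; apply: le_trans.
rewrite (le_trans _ (normc_Im _))//.
by case: (F s) (F t) l {H} => [a b] [a' b'] [p q] /=; rewrite mulr0 add0r.
Qed.

Lemma real_FTC a b (f F : R -> R) : a <= b ->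
  {within `[a, b], continuous f} -> (forall t, a <= t <= b -> is_derive t 1 F (f t)) ->
  \int[mu]_(t in `[a, b]) f t = F b - F a.
Proof.
move=> ab cf dF; move: ab; rewrite le_eqVlt => /predU1P[<-|ab].
  by rewrite set_itv1 Rintegral_set1 subrr.
have cF t : a <= t <= b -> {for t, continuous F}.
  move=> /dF[dt _]; apply: differentiable_continuous; exact/derivable1_diffP.
rewrite /Rintegral (continuous_FTC2 (F := F) ab cf) //; last first.
  move=> t; rewrite in_itv/= => /andP[a_t tb].
  by rewrite derive1E; apply: derive_val; apply: dF; rewrite !ltW.
split.
- by move=> t; rewrite in_itv/= => /andP[a_t tb]; have [] := dF t; rewrite // !ltW.
- by apply: cvg_at_right_filter; apply: cF; rewrite lexx ltW.
- by apply: cvg_at_left_filter; apply: cF; rewrite lexx ltW.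
Qed.

Lemma cint_FTC a b F F' : a <= b -> cont_on a b F' ->
  (forall t, a <= t <= b -> rdiff F t (F' t)) -> cint a b F' = F b - F a.
Proof.
move=> ab cF' H; rewrite /cint.
have hR t (h : a <= t <= b) := rdiff_Re (H t h).
have hI t (h : a <= t <= b) := rdiff_Im (H t h).
have eR := real_FTC ab (cont_within_Re cF') hR.
have eI := real_FTC ab (cont_within_Im cF') hI.
rewrite eR eI.
by case: (F b) (F a) => [p q] [r s].
Qed.

(** On each of the N steps the integrand differs from its value at the left end by at most L d, so
    that [cint_bound] gives an error 2 L d^2 per step. *)
Lemma riemann_sum_lipschitz (G : R -> R[i]) (L : R) (d : R) N a : 0 <= d ->
  (forall s t, normc (G s - G t) <= L * `|s - t|) ->
  normc (cint a (a + N%:R * d) G - d%:C * \sum_(j < N) G (a + j%:R * d))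
    <= 2 * L * d * d * N%:R.
Proof.
move=> d0 HG; have cG x y : cont_on x y G by move=> t _; apply: lipschitz_ccont => s; exact: HG.
elim: N => [|N IH].
  by rewrite big_ord0 mul0r addr0 mulr0 subr0 mulr0 /cint set_itv1 !Rintegral_set1 normc0.
have h1 : a <= a + N%:R * d by rewrite lerDl mulr_ge0.
have h2 : a + N%:R * d <= a + N.+1%:R * d by rewrite lerD2l ler_wpM2r// ler_nat.
rewrite (cint_chasles h1 h2)// big_ord_recr/=.
have h3 : a + N.+1%:R * d - (a + N%:R * d) = d by rewrite -natr1; ring.
have -> : 2 * L * d * d * N.+1%:R = 2 * L * d * d * N%:R + 2 * L * d * d.
  by rewrite -natr1; ring.
rewrite mulrDr opprD addrACA (le_trans (normcD _ _))// lerD//.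
have h4 : d%:C * G (a + N%:R * d) = cint (a + N%:R * d) (a + N.+1%:R * d) (fun=> G (a + N%:R * d)).
  by rewrite cint_cst// h3.
rewrite h4 -cintB//; last exact: cont_on_cst.
rewrite (le_trans (cint_bound (C := L * d) _ _ _))//.
- by apply: cont_onD => //; exact: (@cont_on_cst _ _ (- _)).
- have L0 : 0 <= L by have := HG 1 0; rewrite subr0 normr1 mulr1; apply: le_trans; exact: normc_ge0.
  move=> t /andP[t1 t2]; rewrite (le_trans (HG _ _))// ler_wpM2l// ger0_norm ?subr_ge0//.
  by rewrite -[leRHS]h3 lerB.
- by rewrite h3; rewrite le_eqVlt; apply/orP; left; apply/eqP; ring.
Qed.

Lemma riemann_sum01 (G : R -> R[i]) (L : R) N : (0 < N)%N ->
  (forall s t, normc (G s - G t) <= L * `|s - t|) ->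
  normc (cint 0 1 G - (N%:R^-1)%:C * \sum_(j < N) G (j%:R / N%:R)) <= 2 * L / N%:R.
Proof.
move=> N0 HG; have N1 : N%:R != 0 :> R by rewrite pnatr_eq0 -lt0n.
have := @riemann_sum_lipschitz G L N%:R^-1 N 0; rewrite invr_ge0 ler0n => /(_ isT HG).
rewrite add0r mulfV//; under eq_bigr do rewrite add0r.
by move=> /le_trans; apply; rewrite le_eqVlt; apply/orP; left; apply/eqP; field.
Qed.

End ComplexIntegral.

(** * The unit circle and its roots of unity *)

Section UnitCircle.
Context {R : realType}.
Implicit Types (s t x : R).

Lemma is_derive_rdiff (f : R -> R) t l : is_derive t 1 f l ->
  (forall e : R, 0 < e -> exists2 d : R, 0 < d &
   forall s, `|s - t| < d -> `|f s - f t - l * (s - t)| <= e * `|s - t|).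
Proof.
move=> [dt dl] e e0.
have K : h^-1 *: (f (h *: 1 + t) - f t) @[h --> (0 : R)^'] --> (l : R).
  by move: dt; rewrite -dl => /cvg_ex[/= m H]; rewrite /derive (cvg_lim _ H).
move/cvgrPdist_le : K => /(_ e e0) /nbhs_ballP[d /= d0 H]; exists d => // s sd.
have [->|st] := eqVneq s t; first by rewrite !subrr mulr0 subr0 normr0 mulr0.
have st0 : s - t != 0 by rewrite subr_eq0.
have := H (s - t); rewrite -ball_normE/= sub0r normrN => /(_ sd st0).
have -> : (s - t) *: 1 + t = s by rewrite -[_ *: 1]/(_ * 1) mulr1 subrK.
rewrite -[X in l - X]/((s - t)^-1 * (f s - f t)).
have -> : l - (s - t)^-1 * (f s - f t) = - ((f s - f t - l * (s - t)) / (s - t)) by field.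
by rewrite normrN normrM normfV ler_pdivrMr ?normr_gt0.
Qed.

(** The exponential normalized to period 1, so that the N-th roots of unity are the values at j /
    N. *)
Definition cexp t : R[i] := cos (2 * pi * t) +i* sin (2 * pi * t).

Lemma normc_cexp t : normc (cexp t) = 1.
Proof. by rewrite /= cos2Dsin2 sqrtr1. Qed.

Lemma cexp_neq0 t : cexp t != 0.
Proof. by rewrite -normc_gt0 normc_cexp. Qed.

Lemma cexpD s t : cexp (s + t) = cexp s * cexp t.
Proof.
rewrite /cexp mulrDr cosD sinD; apply/eqP; rewrite eq_complex /=.
by apply/andP; split; apply/eqP => //; ring.
Qed.

Lemma cexp0 : cexp 0 = 1.
Proof. by rewrite /cexp mulr0 cos0 sin0. Qed.

Lemma cexp1 : cexp 1 = 1.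
Proof. by rewrite /cexp mulr1 mulr_natl cos2pi sin2pi. Qed.

Lemma cexpMn t n : cexp (n%:R * t) = cexp t ^+ n.
Proof.
by elim: n => [|n IH]; rewrite ?mul0r ?cexp0// -natr1 mulrDl mul1r cexpD IH exprSr.
Qed.

Lemma cexp_nat n : cexp n%:R = 1.
Proof. by rewrite -(mulr1 n%:R) cexpMn cexp1 expr1n. Qed.

Lemma cexpNM t : cexp (- t) * cexp t = 1.
Proof. by rewrite -cexpD addNr cexp0. Qed.

Lemma cexpN t : cexp (- t) = (cexp t)^-1.
Proof. by apply: (mulIf (cexp_neq0 t)); rewrite cexpNM mulVf ?cexp_neq0. Qed.

Lemma conjcX (z : R[i]) n : (z ^+ n)^*%C = z^*%C ^+ n.
Proof. exact: (rmorphXn (@conjc R)). Qed.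

Lemma conjcM (z w : R[i]) : (z * w)^*%C = z^*%C * w^*%C.
Proof. exact: (rmorphM (@conjc R)). Qed.

Lemma conjcB (z w : R[i]) : (z - w)^*%C = z^*%C - w^*%C.
Proof. exact: (rmorphB (@conjc R)). Qed.

Lemma conjc_sum I (s : seq I) (P : pred I) (F : I -> R[i]) :
  (\sum_(i <- s | P i) F i)^*%C = \sum_(i <- s | P i) (F i)^*%C.
Proof. exact: (raddf_sum (@conjc R)). Qed.

Lemma conjc1 : (1 : R[i])^*%C = 1.
Proof. exact: (rmorph1 (@conjc R)). Qed.

Lemma cexp_conj t : (cexp t)^*%C = cexp (- t).
Proof. by rewrite /cexp mulrN cosN sinN. Qed.

Lemma rdiff_cexp t : rdiff cexp t ((2 * pi)%:C * 'i%C * cexp t).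
Proof.
move=> e e0; have p0 : 0 < 2 * pi :> R by rewrite mulr_gt0// pi_gt0.
have pn0 : (pi : R) != 0 by rewrite gt_eqF// pi_gt0.
have e2 : 0 < e / (2 * pi) / 2 by rewrite !divr_gt0.
have [d d0 H] := is_derive_rdiff (is_derive_cos (2 * pi * t)) e2.
have [d' d'0 H'] := is_derive_rdiff (is_derive_sin (2 * pi * t)) e2.
exists (Num.min (d / (2 * pi)) (d' / (2 * pi))).
  by rewrite lt_min !divr_gt0.
move=> s; rewrite lt_min !ltr_pdivlMr// => /andP[sd sd'].
have ab : `|2 * pi * s - 2 * pi * t| = `|s - t| * (2 * pi).
  by rewrite -mulrBr normrM gtr0_norm// mulrC.
have {}H := H (2 * pi * s); have {}H' := H' (2 * pi * s).
move: H H'; rewrite ab => /(_ sd) H /(_ sd') H'.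
rewrite (le_trans (normc_le_ReIm _))//.
have -> : e * `|s - t| = e / (2 * pi) / 2 * (`|s - t| * (2 * pi)) + e / (2 * pi) / 2 * (`|s - t| * (2 * pi)).
  by rewrite -mulrDl -splitr [_ * (2 * pi)]mulrC mulrA divfK// gt_eqF.
rewrite lerD//.
  apply: le_trans H; rewrite le_eqVlt; apply/orP; left; apply/eqP; congr `|_|.
  by rewrite /cexp/=; ring.
apply: le_trans H'; rewrite le_eqVlt; apply/orP; left; apply/eqP; congr `|_|.
by rewrite /cexp/=; ring.
Qed.

(** The derivative has modulus 2 pi; the second factor 2 is that of [cint_bound]. *)
Lemma cexp_lipschitz s t : normc (cexp s - cexp t) <= 4 * pi * `|s - t|.
Proof.
wlog st : s t / t <= s.
  by move=> W; have [/W//|/ltW/W] := leP t s; rewrite normc_distC distrC.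
have cc x : ccont cexp x by apply: rdiff_ccont; exact: rdiff_cexp.
have cc2 : cont_on t s (fun x => (2 * pi)%:C * 'i%C * cexp x).
  by apply: cont_onZ => x _; exact: cc.
rewrite -(cint_FTC st cc2); last by move=> x _; exact: rdiff_cexp.
rewrite (le_trans (cint_bound (C := 2 * pi) _ _ _))//.
  move=> x _; rewrite !normcM normc_cexp normc_real /= expr0n add0r expr1n sqrtr1 !mulr1.
  by rewrite gtr0_norm// mulr_gt0// pi_gt0.
by rewrite ger0_norm ?subr_ge0// le_eqVlt; apply/orP; left; apply/eqP; ring.
Qed.

(** Since cos (2 pi x) = 1 - 2 sin (pi x)^2, the value 1 would force sin (pi x) = 0. *)
Lemma cexp_neq1 x : 0 < `|x| < 1 -> cexp x != 1.
Proof.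
wlog x0 : x / 0 <= x.
  move=> W; have [/W//|/ltW x0] := leP 0 x; rewrite -normrN => h.
  have : cexp (- x) != 1 by apply: W; rewrite ?oppr_ge0.
  by rewrite cexpN; apply: contra_neq => ->; rewrite invr1.
rewrite ger0_norm// => /andP[x0' x1].
apply/eqP => /(congr1 (fun z => complex.Re z)) /=.
rewrite -mulrA mulr_natl mulr2n cosD -!expr2 cos2sin2 => h.
have : 0 < sin (pi * x).
  by apply: sin_gt0_pi; rewrite mulr_gt0 ?pi_gt0//= gtr_pMr ?pi_gt0.
have : sin (pi * x) ^+ 2 + sin (pi * x) ^+ 2 = 0 by lra.
by move=> /eqP; rewrite paddr_eq0 ?sqr_ge0// andbb sqrf_eq0 => /eqP ->; rewrite ltxx.
Qed.

Lemma polar z : exists2 t, 0 <= t < 1 & z = (normc z)%:C * cexp t.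
Proof.
have [->|z0] := eqVneq z 0; first by exists 0; rewrite ?lexx ?ltr01// normc0 mul0r.
have n0 : normc z != 0 by rewrite normc_eq0.
have np : 0 < normc z by rewrite normc_gt0.
have [u uE] : exists u, u = z / (normc z)%:C by eexists.
have zu : z = (normc z)%:C * u.
  by rewrite uE mulrC divfK// -normc_eq0 normc_real normr_eq0.
suff [t t01 ut] : exists2 t, 0 <= t < 1 & u = cexp t by exists t; rewrite -?ut.
have : normc u = 1 by rewrite uE normcM normcV normc_real ger0_norm ?normc_ge0// divff.
case: u {uE zu} => a b /= ab1.
have {}ab1 : a ^+ 2 + b ^+ 2 = 1.
  by rewrite -(sqr_sqrtr (addr_ge0 (sqr_ge0 a) (sqr_ge0 b))) ab1 expr1n.
have a1 : -1 <= a <= 1.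
  by rewrite -ler_norml -(@expr_le1 _ 2)// real_normK ?num_real// -ab1 lerDl sqr_ge0.
have p0 : 0 < 2 * pi :> R by rewrite mulr_gt0// pi_gt0.
have [ac0 acp] : 0 <= acos a /\ acos a <= pi by rewrite acos_ge0// acos_lepi.
have ca : cos (acos a) = a by rewrite acosK.
have sa : sin (acos a) = `|b|.
  by rewrite sin_acos// -ab1 addrAC subrr add0r sqrtr_sqr.
have [b0|b0] := leP 0 b.
  exists (acos a / (2 * pi)).
    rewrite divr_ge0 ?(ltW p0)//= ltr_pdivrMr// mul1r (le_lt_trans acp)//.
    by rewrite mulr_natl mulr2n ltrDr pi_gt0.
  by rewrite /cexp mulrC divfK ?gt_eqF// ca sa ger0_norm.
have ac0' : acos a != 0 by apply/eqP => h; move: sa; rewrite h sin0 => /esym/eqP; rewrite normr_eq0 lt_eqF.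
exists (1 - acos a / (2 * pi)).
  rewrite subr_ge0 ler_pdivrMr// mul1r (le_trans acp)//=; last first.
    by rewrite mulr_natl mulr2n lerDr pi_ge0.
  by rewrite ltrBlDr ltrDl divr_gt0// lt_neqAle eq_sym ac0'.
rewrite cexpD cexp1 mul1r -cexp_conj /cexp mulrC divfK ?gt_eqF// ca sa /=.
by rewrite ltr0_norm// opprK.
Qed.

Lemma cexp_frac_pow (k : R) N : (0 < N)%N -> cexp (k / N%:R) ^+ N = cexp k.
Proof. by move=> N0; rewrite -cexpMn mulrC divfK// pnatr_eq0 -lt0n. Qed.

Lemma sum_pow_root (r : R[i]) N : r ^+ N = 1 -> r != 1 -> \sum_(j < N) r ^+ j = 0.
Proof.
move=> rN r1; have := subrX1 r N; rewrite rN subrr => /esym/eqP.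
by rewrite mulf_eq0 subr_eq0 (negPf r1) => /eqP.
Qed.

Lemma sum_natM_pow (r : R[i]) n :
  (r - 1) * \sum_(m < n) m%:R * r ^+ m = n%:R * r ^+ n - r * \sum_(m < n) r ^+ m.
Proof.
elim: n => [|n IH]; first by rewrite !big_ord0 mulr0 mul0r mulr0 subrr.
by rewrite !big_ord_recr/= mulrDr IH -natr1 exprS; ring.
Qed.

(** The powers r^m, m < N, add up to 0, so [sum_natM_pow] reads (r - 1) * sum m r^m = N, while the
    sum of the m r^m has modulus at most N^2. This avoids lower bounds for the sine. *)
Lemma root_of_unity_dist (r : R[i]) N : (0 < N)%N -> normc r = 1 ->
  r ^+ N = 1 -> r != 1 -> N%:R^-1 <= normc (r - 1).
Proof.
move=> N0 nr rN r1; have N1 : 0 < N%:R :> R by rewrite ltr0n.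
have := sum_natM_pow r N; rewrite sum_pow_root// mulr0 subr0 rN mulr1.
move=> /(congr1 (fun z => normc z)); rewrite normcM.
have -> : normc (N%:R : R[i]) = N%:R.
  by rewrite -(rmorph_nat (real_complex R)) normc_real ger0_norm.
move=> h; rewrite -[leLHS]mul1r ler_pdivrMr//.
rewrite -(ler_pM2r N1) mul1r -{1}h -mulrA ler_wpM2l ?normc_ge0//.
rewrite (le_trans (normc_sum _ _ _))//.
have -> : N%:R * N%:R = \sum_(m < N) N%:R :> R by rewrite sumr_const card_ord mulr_natl.
apply: ler_sum => j _; rewrite normcM normcX nr expr1n mulr1.
by rewrite -(rmorph_nat (real_complex R)) normc_real ger0_norm ?ler_nat// ltnW.
Qed.

Lemma frac_neq1 N (m n : nat) : (m < N)%N -> (n < N)%N -> m != n ->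
  cexp (m%:R / N%:R) != cexp (n%:R / N%:R).
Proof.
move=> mN nN mn; have N1 : 0 < N%:R :> R by rewrite ltr0n (leq_ltn_trans _ mN).
have : cexp ((m%:R - n%:R) / N%:R) != 1.
  apply: cexp_neq1; rewrite normrM normfV (gtr0_norm N1) divr_gt0 ?normr_gt0 ?subr_eq0 ?eqr_nat//=.
  rewrite ltr_pdivrMr// mul1r ltr_norml.
  have m1 : m%:R < N%:R :> R by rewrite ltr_nat.
  have n1 : n%:R < N%:R :> R by rewrite ltr_nat.
  have m0 : 0 <= m%:R :> R by [].
  have n0 : 0 <= n%:R :> R by [].
  by apply/andP; split; lra.
apply: contra_neq => h; rewrite mulrBl cexpD h -cexpD subrr cexp0//.
Qed.

Lemma roots_dist N (m n : nat) : (m < N)%N -> (n < N)%N -> m != n ->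
  N%:R^-1 <= normc (cexp (m%:R / N%:R) - cexp (n%:R / N%:R)).
Proof.
move=> mN nN mn; have N0 : (0 < N)%N by exact: leq_ltn_trans mN.
set a := cexp _; set b := cexp _.
have b0 : b != 0 by exact: cexp_neq0.
have -> : a - b = (a / b - 1) * b by rewrite mulrBl divfK// mul1r.
rewrite normcM normc_cexp mulr1; apply: root_of_unity_dist => //.
- by rewrite normcM normcV !normc_cexp invr1 mulr1.
- by rewrite exprMn exprVn !cexp_frac_pow// !cexp_nat invr1 mulr1.
- have := frac_neq1 mN nN mn; apply: contra_neq => h.
  by rewrite -/a -/b -[a](divfK b0) h mul1r.
Qed.

Lemma roots_orthogonal N (m n : nat) : (m < N)%N -> (n < N)%N ->
  \sum_(j < N) cexp (- (j%:R / N%:R)) ^+ m * (cexp (- (j%:R / N%:R)) ^+ n)^*%C =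
  if m == n then N%:R else 0.
Proof.
move=> mN nN; have N0 : (0 < N)%N by exact: leq_ltn_trans mN.
pose r := cexp (n%:R / N%:R) / cexp (m%:R / N%:R).
rewrite (eq_bigr (fun j : 'I_N => r ^+ j)); last first.
  move=> j _; rewrite conjcX cexp_conj opprK /r -cexpN -!cexpD -!cexpMn -cexpD; congr cexp.
  by field; rewrite pnatr_eq0 -lt0n.
case: (eqVneq m n) => mn.
  by rewrite /r mn divff ?cexp_neq0//; under eq_bigr do rewrite expr1n; rewrite sumr_const card_ord.
apply: sum_pow_root.
  by rewrite /r exprMn exprVn !cexp_frac_pow// !cexp_nat invr1 mulr1.
have := frac_neq1 nN mN; rewrite eq_sym => /(_ mn); apply: contra_neq => h.
by rewrite -[LHS](divfK (cexp_neq0 (m%:R / N%:R))) -/r h mul1r.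
Qed.

(** At an N-th root of unity w the Cauchy kernel is a polynomial in u up to the common factor 1 / (1
    - u^N), so that its averages over roots of unity can be computed exactly. *)
Lemma geometric_root (w u : R[i]) N : w ^+ N = 1 -> w * u != 1 ->
  (1 - w * u)^-1 * (1 - u ^+ N) = \sum_(n < N) w ^+ n * u ^+ n.
Proof.
move=> wN wu; have := subrX1 (w * u) N; rewrite exprMn wN mul1r.
rewrite (eq_bigr (fun n : 'I_N => w ^+ n * u ^+ n)) => [h|i _]; last by rewrite exprMn.
have w1 : 1 - w * u != 0 by rewrite subr_eq0 eq_sym.
apply: (mulfI w1); rewrite mulrA divff// mul1r -[LHS]opprB h; ring.
Qed.

(** After [geometric_root], orthogonality leaves only the term n = 0. *)
Lemma circle_avg_cauchy (u : R[i]) N : (0 < N)%N -> normc u < 1 ->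
  (N%:R^-1)%:C * \sum_(j < N) (1 - cexp (- (j%:R / N%:R)) * u)^-1 = (1 - u ^+ N)^-1.
Proof.
move=> N0 u1; have N1 : (N%:R : R[i]) != 0 by rewrite pnatr_eq0 -lt0n.
have uN : 1 - u ^+ N != 0.
  rewrite subr_eq0; apply/eqP => /(congr1 (fun z => normc z)).
  rewrite normc1 normcX => /eqP; rewrite eq_sym => /eqP h.
  have : normc u ^+ N < 1 by rewrite exprn_ilt1 ?normc_ge0// -lt0n.
  by rewrite h ltxx.
apply: (mulIf uN); rewrite mulVf// -mulrA mulr_suml.
rewrite (eq_bigr (fun j : 'I_N => \sum_(n < N) cexp (- (j%:R / N%:R)) ^+ n * u ^+ n)).
  rewrite exchange_big /= (bigD1 (Ordinal N0)) //= [X in _ + X]big1 ?addr0.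
    under eq_bigr do rewrite !expr0 mulr1.
    rewrite sumr_const card_ord fmorphV /= rmorph_nat mulVf//.
  move=> n n0; rewrite -mulr_suml.
  have := @roots_orthogonal N n 0 (ltn_ord n) N0.
  under eq_bigr do rewrite expr0 conjc1 mulr1.
  by rewrite (_ : (nat_of_ord n == 0)%N = false) ?mul0r ?mulr0; [move=> -> ; rewrite mul0r|apply/negbTE; apply: contra n0 => /eqP h; apply/eqP/val_inj].
move=> j _; apply: geometric_root.
  by rewrite cexpN exprVn cexp_frac_pow// cexp_nat invr1.
apply/eqP => /(congr1 (fun z => normc z)); rewrite normcM normc_cexp mul1r normc1 => h.
by rewrite h ltxx in u1.
Qed.

(** A discrete Parseval identity: the average of |sum_n w^n u^n|^2 over the N-th roots w is sum_n
    |u|^(2n), which is at most 1 / (1 - |u|). *)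
Lemma circle_avg_sqr (u : R[i]) N : (0 < N)%N -> normc u < 1 ->
  N%:R^-1 * \sum_(j < N) (normc (1 - cexp (- (j%:R / N%:R)) * u) ^+ 2)^-1 <=
  ((1 - normc u) * (1 - normc u ^+ N) ^+ 2)^-1.
Proof.
move=> N0 u1; have N1 : 0 < N%:R :> R by rewrite ltr0n.
have uN1 : normc u ^+ N < 1 by rewrite exprn_ilt1 ?normc_ge0// -lt0n.
have uN0 : 0 < 1 - normc u ^+ N by rewrite subr_gt0.
have uN : 1 - normc u ^+ N <= normc (1 - u ^+ N).
  by rewrite -normcX -[X in X - _](@normc1 R) lerB_normc.
have key : N%:R^-1 * (\sum_(j < N) (normc (1 - cexp (- (j%:R / N%:R)) * u) ^+ 2)^-1) *
   normc (1 - u ^+ N) ^+ 2 = \sum_(n < N) normc u ^+ n * normc u ^+ n.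
  rewrite -mulrA mulr_suml.
  rewrite (eq_bigr (fun j : 'I_N => normc (\sum_(n < N) cexp (- (j%:R / N%:R)) ^+ n * u ^+ n) ^+ 2)); last first.
    move=> j _; rewrite -geometric_root ?normcM ?normcV ?exprMn ?exprVn//.
      by rewrite cexpN exprVn cexp_frac_pow// cexp_nat invr1.
    apply/eqP => /(congr1 (fun z => normc z)); rewrite normcM normc_cexp mul1r normc1 => h.
    by rewrite h ltxx in u1.
  have inj : injective (real_complex R) by exact: fmorph_inj.
  apply: inj; rewrite /= rmorphM /= !rmorph_sum /=.
  rewrite (eq_bigr (fun j : 'I_N => \sum_(m < N) \sum_(n < N) (u ^+ m * (u ^+ n)^*%C) *
     (cexp (- (j%:R / N%:R)) ^+ m * (cexp (- (j%:R / N%:R)) ^+ n)^*%C))); last first.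
    move=> j _; rewrite normc_sqr conjc_sum mulr_suml; apply: eq_bigr => m _.
    rewrite mulr_sumr; apply: eq_bigr => n _; rewrite conjcM; ring.
  rewrite exchange_big /= fmorphV /= rmorph_nat mulr_sumr; apply: eq_bigr => m _.
  rewrite exchange_big /= (bigD1 m)//= [X in _ + X]big1 ?addr0; last first.
    move=> n nm; rewrite -mulr_sumr roots_orthogonal// ifF ?mulr0//.
    by apply/negbTE; rewrite eq_sym; apply: contra nm => /eqP h; apply/eqP/val_inj.
  rewrite -mulr_sumr roots_orthogonal// eqxx mulrCA mulVf ?pnatr_eq0 -?lt0n// mulr1.
  by rewrite -normc_sqr normcX expr2.
have geo : (\sum_(n < N) normc u ^+ n * normc u ^+ n) * (1 - normc u) <= 1.
  apply: (@le_trans _ _ ((\sum_(n < N) normc u ^+ n) * (1 - normc u))).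
    rewrite ler_wpM2r ?subr_ge0 ?(ltW u1)//; apply: ler_sum => n _.
    by rewrite ler_piMr ?exprn_ge0 ?normc_ge0// exprn_ile1 ?normc_ge0 ?(ltW u1).
  have h := subrX1 (normc u) N.
  have h0 : 0 <= normc u ^+ N by rewrite exprn_ge0 ?normc_ge0.
  by rewrite mulrC -opprB mulNr -h; lra.
rewrite -[leRHS]mul1r ler_pdivlMr ?mulr_gt0 ?subr_gt0 ?exprn_gt0//.
apply: le_trans geo; rewrite -key.
set S := _ * \sum_(j < N) _.
have S0 : 0 <= S.
  by rewrite mulr_ge0 ?invr_ge0 ?ler0n// sumr_ge0// => j _; rewrite invr_ge0 exprn_ge0 ?normc_ge0.
rewrite mulrCA [leRHS]mulrC ler_wpM2l ?subr_ge0 ?(ltW u1)// ler_wpM2l//.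
by rewrite lerXn2r ?nnegrE ?normc_ge0 ?(ltW uN0).
Qed.

End UnitCircle.

(** * Goursat's theorem and Cauchy's formula *)

Arguments ComplexField.Normc.normc : simpl never.

Section Goursat.
Context {R : realType}.

Lemma ccontM (F G : R -> R[i]) t : ccont F t -> ccont G t ->
  ccont (fun t => F t * G t) t.
Proof.
move=> cF cG e e0.
pose A := normc (F t) + normc (G t) + 1.
have A0 : 0 < A by rewrite ltr_wpDl// addr_ge0 ?normc_ge0.
have [d d0 H] := cF (Num.min 1 (e / 2 / A)) ltac:(by rewrite lt_min ltr01 !divr_gt0).
have [d' d'0 H'] := cG (e / 2 / A) ltac:(by rewrite !divr_gt0).
exists (Num.min d d'); first by rewrite lt_min d0.
move=> s; rewrite lt_min => /andP[/H{}H /H'{}H'].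
move: H; rewrite lt_min => /andP[H1 H].
rewrite (_ : _ - _ = (F s - F t) * G t + F s * (G s - G t)); last by ring.
rewrite (le_lt_trans (normcD _ _))// !normcM [e]splitr.
have Fs : normc (F s) <= A - normc (G t).
  by rewrite -(subrK (F t) (F s)) (le_trans (normcD _ _))// /A; lra.
have e1 : normc (F s - F t) * normc (G t) <= e / 2 / A * normc (G t).
  by rewrite ler_wpM2r ?normc_ge0// ltW.
have e2 : normc (F s) * normc (G s - G t) <= (A - normc (G t)) * normc (G s - G t).
  by rewrite ler_wpM2r ?normc_ge0.
have GA : 0 < A - normc (G t).
  by rewrite (_ : _ - _ = normc (F t) + 1) ?ltr_wpDl ?normc_ge0// /A; ring.
have e3 : (A - normc (G t)) * normc (G s - G t) < (A - normc (G t)) * (e / 2 / A).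
  by rewrite ltr_pM2l.
have E : e / 2 / A * normc (G t) + (A - normc (G t)) * (e / 2 / A) = e / 2.
  by rewrite mulrC -mulrDl addrCA subrr addr0 mulrC divfK// gt_eqF.
have e20 : 0 < e / 2 by rewrite divr_gt0.
lra.
Qed.

Lemma ccont_comp (f : R[i] -> R[i]) l (F : R -> R[i]) t : cdiff f (F t) l ->
  ccont F t -> ccont (fun t => f (F t)) t.
Proof.
move=> /cdiff_continuous[C [d d0 H]] cF e e0.
have C1 : 0 < `|C| + 1 by rewrite ltr_pwDr.
have [d' d'0 H'] := cF (Num.min d (e / (`|C| + 1))) ltac:(by rewrite lt_min d0 divr_gt0).
exists d' => // s /H'; rewrite lt_min ltr_pdivlMr// => /andP[/H{}H h].
rewrite (le_lt_trans H)// (le_lt_trans _ h)// mulrC ler_wpM2l ?normc_ge0//.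
by rewrite (le_trans (ler_norm _))// lerDl.
Qed.

Variables (zeta : R[i]) (c c' : R -> R[i]) (K : R).
Hypothesis c_rdiff : forall t, rdiff c t (c' t).
Hypothesis c'_cont : forall t, ccont c' t.
Hypothesis c_bound : forall t, normc (c t) <= K.
Hypothesis c'_bound : forall t, normc (c' t) <= K.
Hypothesis c_lip : forall s t, normc (c s - c t) <= K * `|s - t|.

(** The homotopy that contracts the curve zeta + c to the point zeta. Goursat's subdivision is
    carried out in the parameters (s, t) and not in the plane. *)
Let z (s t : R) := zeta + s%:C * c t.

Definition edge_t (G : R[i] -> R[i]) s t1 t2 :=
  cint t1 t2 (fun t => G (z s t) * (s%:C * c' t)).
Definition edge_s (G : R[i] -> R[i]) t s1 s2 :=
  cint s1 s2 (fun s => G (z s t) * c t).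
(** The pull-back of G dz integrated counterclockwise around the parameter rectangle [s1, s2] x
    [t1, t2]. *)
Definition boundary G s1 s2 t1 t2 :=
  edge_t G s2 t1 t2 - edge_t G s1 t1 t2 - edge_s G t2 s1 s2 + edge_s G t1 s1 s2.

Let K0 : 0 <= K. Proof. exact: le_trans (normc_ge0 _) (c_bound 0). Qed.

Let z_rdiff_t s t : rdiff (z s) t (s%:C * c' t).
Proof.
move=> e e0; have s1 : 0 < `|s| + 1 by rewrite ltr_pwDr.
have [d d0 H] := c_rdiff t (e := e / (`|s| + 1)) ltac:(by rewrite divr_gt0).
exists d => // x /H{}H.
rewrite (_ : _ - _ = s%:C * (c x - c t - c' t * (x - t)%:C)); last by rewrite /z; ring.
rewrite normcM normc_real (le_trans (ler_wpM2l _ H))// mulrA ler_wpM2r//.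
by rewrite mulrCA ler_piMr ?(ltW e0)// ler_pdivrMr// mul1r lerDl.
Qed.

Let z_rdiff_s s t : rdiff (fun s => z s t) s (c t).
Proof.
move=> e e0; exists 1 => // x _.
rewrite (_ : _ - _ = 0); last by rewrite /z rmorphB /=; ring.
by rewrite normc0 mulr_ge0 ?(ltW e0).
Qed.

Let z_cont_t s t : ccont (z s) t. Proof. exact: rdiff_ccont (z_rdiff_t s t). Qed.
Let z_cont_s s t : ccont (fun s => z s t) s.
Proof. exact: rdiff_ccont (z_rdiff_s s t). Qed.

Let edge_t_cont G s t1 t2 : (forall t, t1 <= t <= t2 -> exists l, cdiff G (z s t) l) ->
  cont_on t1 t2 (fun t => G (z s t) * (s%:C * c' t)).
Proof.
move=> H t /H[l Gl]; apply: ccontM; last exact: ccontZ.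
exact: ccont_comp Gl (z_cont_t s t).
Qed.

Let edge_s_cont G t s1 s2 : (forall s, s1 <= s <= s2 -> exists l, cdiff G (z s t) l) ->
  cont_on s1 s2 (fun s => G (z s t) * c t).
Proof.
move=> H s /H[l Gl]; apply: ccontM.
  exact: (@ccont_comp G l (fun s => z s t) s Gl (z_cont_s s t)).
by move=> e e0; exists 1 => // x _; rewrite subrr normc0.
Qed.

Let cdiff_affine (A B : R[i]) w : cdiff (fun w => A + B * w) w B.
Proof.
apply: cdiff_eq (cdiffD (cdiff_cst A w) (cdiffZ B (cdiff_id w))) _.
by rewrite mulr1 add0r.
Qed.

Let cdiff_quadratic (A B : R[i]) w :
  cdiff (fun w => A * w + B / 2 * (w * w)) w (A + B * w).
Proof.
apply: cdiff_eq (cdiffD (cdiffZ A (cdiff_id w)) (cdiffZ (B / 2) (cdiffM (cdiff_id w) (cdiff_id w)))) _.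
by field.
Qed.

(** An affine integrand has the primitive [P], and its values at the four corners cancel. *)
Let boundary_affine (A B : R[i]) s1 s2 t1 t2 : s1 <= s2 -> t1 <= t2 ->
  boundary (fun w => A + B * w) s1 s2 t1 t2 = 0.
Proof.
move=> s12 t12; pose P w := A * w + B / 2 * (w * w).
have et s : edge_t (fun w => A + B * w) s t1 t2 = P (z s t2) - P (z s t1).
  apply: (cint_FTC (F := fun t => P (z s t))) => //.
    by apply: (edge_t_cont (G := fun w => A + B * w)) => t _; eexists; exact: cdiff_affine.
  by move=> t _; exact: (rdiff_comp (cdiff_quadratic A B (z s t)) (z_rdiff_t s t)).
have es t : edge_s (fun w => A + B * w) t s1 s2 = P (z s2 t) - P (z s1 t).
  apply: (cint_FTC (F := fun s => P (z s t))) => //.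
    by apply: (edge_s_cont (G := fun w => A + B * w)) => s _; eexists; exact: cdiff_affine.
  move=> s _.
  exact: (@rdiff_comp _ (fun s => z s t) (fun s => P (z s t)) P s _ _
    (cdiff_quadratic A B (z s t)) (z_rdiff_s s t)).
by rewrite /boundary !et !es; ring.
Qed.

Variables (G : R[i] -> R[i]) (S1 S2 T1 T2 : R).
Hypothesis S01 : 0 <= S1.
Hypothesis S12 : S1 <= S2.
Hypothesis S21 : S2 <= 1.
Hypothesis T12 : T1 <= T2.
Hypothesis G_diff : forall s t, S1 <= s <= S2 -> T1 <= t <= T2 ->
  exists l, cdiff G (z s t) l.

Let z_lip s t s' t' : 0 <= s <= 1 -> 
  normc (z s t - z s' t') <= K * (`|s - s'| + `|t - t'|).
Proof.
move=> /andP[s0 s1].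
rewrite (_ : _ - _ = (s - s')%:C * c t' + s%:C * (c t - c t')); last first.
  by rewrite /z rmorphB /=; ring.
rewrite (le_trans (normcD _ _))// !normc_realM mulrDr lerD//.
  by rewrite mulrC ler_wpM2r.
by rewrite ger0_norm// (le_trans _ (c_lip _ _))// ler_piMl ?normc_ge0.
Qed.

Let boundary_add_s s1 s s2 t1 t2 : S1 <= s1 -> s1 <= s -> s <= s2 -> s2 <= S2 ->
  T1 <= t1 -> t1 <= t2 -> t2 <= T2 ->
  boundary G s1 s2 t1 t2 = boundary G s1 s t1 t2 + boundary G s s2 t1 t2.
Proof.
move=> a1 a2 a3 a4 b1 b2 b3.
have D t : T1 <= t <= T2 -> edge_s G t s1 s2 = edge_s G t s1 s + edge_s G t s s2.
  move=> tT; apply: cint_chasles => //; apply: edge_s_cont => x /andP[x1 x2].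
  by apply: G_diff => //; rewrite (le_trans a1)// (le_trans x2).
by rewrite /boundary !D; [ring| rewrite b1 (le_trans b2)|rewrite b3 (le_trans b1)].
Qed.

Let boundary_add_t s1 s2 t1 t t2 : S1 <= s1 -> s1 <= s2 -> s2 <= S2 ->
  T1 <= t1 -> t1 <= t -> t <= t2 -> t2 <= T2 ->
  boundary G s1 s2 t1 t2 = boundary G s1 s2 t1 t + boundary G s1 s2 t t2.
Proof.
move=> b1 b2 b3 a1 a2 a3 a4.
have D s : S1 <= s <= S2 -> edge_t G s t1 t2 = edge_t G s t1 t + edge_t G s t t2.
  move=> tT; apply: cint_chasles => //; apply: edge_t_cont => x /andP[x1 x2].
  by apply: G_diff => //; rewrite (le_trans a1)// (le_trans x2).
by rewrite /boundary !D; [ring| rewrite b1 (le_trans b2)|rewrite b3 (le_trans b1)].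
Qed.

(** Subtracting the affine approximation of G at z(s, t) does not change the boundary integral. On
    each of the four edges the remaining integrand is at most e K D times K, with D the half
    perimeter, and [cint_bound] brings a factor 2; hence the 8. *)
Let boundary_err e s t s1 s2 t1 t2 l : 0 <= e ->
  S1 <= s1 -> s1 <= s2 -> s2 <= S2 -> T1 <= t1 -> t1 <= t2 -> t2 <= T2 ->
  s1 <= s <= s2 -> t1 <= t <= t2 ->
  (forall s' t', s1 <= s' <= s2 -> t1 <= t' <= t2 ->
     normc (G (z s' t') - G (z s t) - l * (z s' t' - z s t)) <=
       e * normc (z s' t' - z s t)) ->
  normc (boundary G s1 s2 t1 t2) <= 8 * e * K ^+ 2 * ((s2 - s1) + (t2 - t1)) ^+ 2.
Proof.
move=> e0 a1 a2 a3 b1 b2 b3 ss tt H.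
pose A := G (z s t) - l * z s t; pose L w := A + l * w.
pose D := (s2 - s1) + (t2 - t1).
have D0 : 0 <= D by rewrite addr_ge0// subr_ge0.
have LD w : cdiff L w l by exact: cdiff_affine.
have GL s' t' : s1 <= s' <= s2 -> t1 <= t' <= t2 ->
    normc (G (z s' t') - L (z s' t')) <= e * K * D.
  move=> hs ht; rewrite (_ : _ - _ = G (z s' t') - G (z s t) - l * (z s' t' - z s t)); last first.
    by rewrite /L /A; ring.
  rewrite (le_trans (H _ _ hs ht))// -mulrA ler_wpM2l//.
  have s'01 : 0 <= s' <= 1.
    move: hs => /andP[h1 h2]; rewrite (le_trans S01 (le_trans a1 h1)).
    by rewrite (le_trans h2 (le_trans a3 S21)).
  rewrite (le_trans (z_lip _ _ _ s'01))// ler_wpM2l// lerD// ler_norml.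
    by move: ss hs => /andP[? ?] /andP[? ?]; apply/andP; split; lra.
  by move: tt ht => /andP[? ?] /andP[? ?]; apply/andP; split; lra.
have inS s' : s1 <= s' <= s2 -> S1 <= s' <= S2.
  by move=> /andP[h1 h2]; rewrite (le_trans a1 h1) (le_trans h2 a3).
have inT t' : t1 <= t' <= t2 -> T1 <= t' <= T2.
  by move=> /andP[h1 h2]; rewrite (le_trans b1 h1) (le_trans h2 b3).
have Et s' : s1 <= s' <= s2 ->
    normc (edge_t G s' t1 t2 - edge_t L s' t1 t2) <= 2 * (e * K * D * K) * D.
  move=> hs.
  have cG : cont_on t1 t2 (fun t => G (z s' t) * (s'%:C * c' t)).
    by apply: edge_t_cont => t' ht'; apply: G_diff; [exact: inS|exact: inT].
  have cL : cont_on t1 t2 (fun t => L (z s' t) * (s'%:C * c' t)).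
    by apply: edge_t_cont => t' _; exists l; exact: LD.
  rewrite /edge_t -cintB//.
  apply: (@le_trans _ _ (2 * (e * K * D * K) * (t2 - t1))).
    apply: cint_bound => //.
      exact: cont_onB.
    move=> t' ht'; rewrite -mulrBl normcM ler_pM ?normc_ge0//; first exact: GL.
    have /andP[h1 h2] := inS _ hs.
    have s'0 : 0 <= s' by rewrite (le_trans S01).
    rewrite normc_realM ger0_norm// (le_trans _ (c'_bound t'))// ler_piMl ?normc_ge0//.
    by rewrite (le_trans h2).
  by rewrite ler_wpM2l ?mulr_ge0// /D lerDr subr_ge0.
have Es t' : t1 <= t' <= t2 ->
    normc (edge_s G t' s1 s2 - edge_s L t' s1 s2) <= 2 * (e * K * D * K) * D.
  move=> ht.
  have cG : cont_on s1 s2 (fun s => G (z s t') * c t').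
    by apply: edge_s_cont => s' hs'; apply: G_diff; [exact: inS|exact: inT].
  have cL : cont_on s1 s2 (fun s => L (z s t') * c t').
    by apply: edge_s_cont => s' _; exists l; exact: LD.
  rewrite /edge_s -cintB//.
  apply: (@le_trans _ _ (2 * (e * K * D * K) * (s2 - s1))).
    apply: cint_bound => //.
      exact: cont_onB.
    by move=> s' hs'; rewrite -mulrBl normcM ler_pM ?normc_ge0//; exact: GL.
  by rewrite ler_wpM2l ?mulr_ge0// /D lerDl subr_ge0.
have bL := @boundary_affine A l s1 s2 t1 t2 a2 b2.
rewrite -(subr0 (boundary G _ _ _ _)) -bL /boundary.
rewrite (_ : _ - _ = (edge_t G s2 t1 t2 - edge_t L s2 t1 t2)
   - (edge_t G s1 t1 t2 - edge_t L s1 t1 t2) - (edge_s G t2 s1 s2 - edge_s L t2 s1 s2)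
   + (edge_s G t1 s1 s2 - edge_s L t1 s1 s2)); last by rewrite /L; ring.
rewrite (_ : 8 * _ * _ * _ = 4 * (2 * (e * K * D * K) * D)); last by rewrite -/D; ring.
have := Et s2 ltac:(by rewrite a2 lexx); have := Et s1 ltac:(by rewrite a2 lexx).
have := Es t2 ltac:(by rewrite b2 lexx); have := Es t1 ltac:(by rewrite b2 lexx).
move: (_ - _) (_ - _) (_ - _) (_ - _) (2 * _ * _) => x1 x2 x3 x4 Q h1 h2 h3 h4.
have := normcD (x1 - x2 - x3) x4; have := normcB (x1 - x2) x3; have := normcB x1 x2.
lra.
Qed.

Let ls := S2 - S1.
Let lt_ := T2 - T1.
Let p2 n : R := 2 ^- n.
Let p2_ge0 n : 0 <= p2 n. Proof. by rewrite invr_ge0 exprn_ge0. Qed.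
Let p2S n : p2 n = p2 n.+1 + p2 n.+1.
Proof.
rewrite /p2 exprS invfM -mulrDl.
by have -> : 2^-1 + 2^-1 = 1 :> R; [lra|rewrite mul1r].
Qed.
Let ls0 : 0 <= ls. Proof. by rewrite subr_ge0. Qed.
Let lt0 : 0 <= lt_. Proof. by rewrite subr_ge0. Qed.

Let cell n (x : R * R) := boundary G x.1 (x.1 + ls * p2 n) x.2 (x.2 + lt_ * p2 n).
Let incell n (x : R * R) := [/\ S1 <= x.1, x.1 + ls * p2 n <= S2, T1 <= x.2 & x.2 + lt_ * p2 n <= T2].

(** The boundary integral is the sum over the four quarters, so one of them carries at least a
    quarter of its modulus. *)
Let subdivide n x : incell n x -> exists y : R * R,
  [/\ incell n.+1 y, x.1 <= y.1, y.1 + ls * p2 n.+1 <= x.1 + ls * p2 n &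
   [/\ x.2 <= y.2, y.2 + lt_ * p2 n.+1 <= x.2 + lt_ * p2 n &
   normc (cell n x) <= 4 * normc (cell n.+1 y)]].
Proof.
move=> [h1 h2 h3 h4]; move: x h1 h2 h3 h4 => [a b] /= h1 h2 h3 h4.
rewrite p2S !mulrDr in h2 h4 *.
set u := ls * p2 n.+1 in h2 *; set v := lt_ * p2 n.+1 in h4 *.
have u0 : 0 <= u by rewrite mulr_ge0. have v0 : 0 <= v by rewrite mulr_ge0.
pose Y i j := (a + i%:R * u, b + j%:R * v).
have cE : cell n (a, b) = cell n.+1 (Y 0 0)%N + cell n.+1 (Y 0 1)%N + (cell n.+1 (Y 1 0)%N + cell n.+1 (Y 1 1)%N).
  rewrite /cell /Y /= !mul0r !mul1r !addr0 p2S !mulrDr -/u -/v !(addrA a) !(addrA b).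
  have e1 : boundary G a (a + u + u) b (b + v + v) =
     boundary G a (a + u) b (b + v + v) + boundary G (a + u) (a + u + u) b (b + v + v).
    by apply: boundary_add_s; lra.
  have e2 : boundary G a (a + u) b (b + v + v) =
     boundary G a (a + u) b (b + v) + boundary G a (a + u) (b + v) (b + v + v).
    by apply: boundary_add_t; lra.
  have e3 : boundary G (a + u) (a + u + u) b (b + v + v) =
     boundary G (a + u) (a + u + u) b (b + v) + boundary G (a + u) (a + u + u) (b + v) (b + v + v).
    by apply: boundary_add_t; lra.
  by rewrite e1 e2 e3.
have inY i j : (i <= 1)%N -> (j <= 1)%N -> [/\ incell n.+1 (Y i j), a <= (Y i j).1, (Y i j).1 + u <= a + (u + u) &
   b <= (Y i j).2 /\ (Y i j).2 + v <= b + (v + v)].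
  by move=> i1 j1; rewrite /incell -/u -/v /=; case: i i1 => [|[|//]] _; case: j j1 => [|[|//]] _;
    rewrite ?mul0r ?mul1r; do !split; lra.
suff [i [j [i1 j1 H]]] : exists i j, [/\ (i <= 1)%N, (j <= 1)%N & normc (cell n (a, b)) <= 4 * normc (cell n.+1 (Y i j))].
  by exists (Y i j); have [k1 k2 k3 [k4 k5]] := inY i j i1 j1.
apply: contrapT => N.
have {}N i j : (i <= 1)%N -> (j <= 1)%N -> 4 * normc (cell n.+1 (Y i j)) < normc (cell n (a, b)).
  by move=> i1 j1; rewrite ltNge; apply/negP => h; apply: N; exists i, j.
have n00 := N 0%N 0%N isT isT; have n01 := N 0%N 1%N isT isT.
have n10 := N 1%N 0%N isT isT; have n11 := N 1%N 1%N isT isT.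
move: n00 n01 n10 n11; rewrite cE.
move: (cell _ _) (cell _ _) (cell _ _) (cell _ _) => x1 x2 x3 x4 h5 h6 h7 h8.
have := normcD (x4 + x3) (x2 + x1); have := normcD x4 x3; have := normcD x2 x1.
lra.
Qed.

Let nested : exists x : nat -> R * R,
  [/\ x 0%N = (S1, T1), forall n, incell n (x n),
    forall n, [/\ (x n).1 <= (x n.+1).1, (x n.+1).1 + ls * p2 n.+1 <= (x n).1 + ls * p2 n,
     (x n).2 <= (x n.+1).2 & (x n.+1).2 + lt_ * p2 n.+1 <= (x n).2 + lt_ * p2 n] &
    forall n, normc (cell 0 (S1, T1)) <= 4 ^+ n * normc (cell n (x n))].
Proof.
have /choice[f fP] : forall nx : nat * (R * R), exists y : R * R, incell nx.1 nx.2 ->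
  [/\ incell nx.1.+1 y, nx.2.1 <= y.1, y.1 + ls * p2 nx.1.+1 <= nx.2.1 + ls * p2 nx.1 &
   [/\ nx.2.2 <= y.2, y.2 + lt_ * p2 nx.1.+1 <= nx.2.2 + lt_ * p2 nx.1 &
   normc (cell nx.1 nx.2) <= 4 * normc (cell nx.1.+1 y)]].
  move=> [n x]; have [h|h] := pselect (incell n x); last by exists x.
  by have [y yP] := subdivide h; exists y.
pose x := fix x n := if n is m.+1 then f (m, x m) else (S1, T1).
have xin n : incell n (x n).
  elim: n => [|n IH]; last by have [] := fP (n, x n) IH.
  by rewrite /incell /= /p2 expr0 invr1 !mulr1 /ls /lt_; split; lra.
exists x; split => // n.
  by have [h1 h2 h3 [h4 h5 h6]] := fP (n, x n) (xin n).
elim: n => [|n IH]; first by rewrite expr0 mul1r.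
have [h1 h2 h3 [h4 h5 h6]] := fP (n, x n) (xin n).
rewrite (le_trans IH)// exprSr -mulrA ler_wpM2l ?exprn_ge0//.
Qed.

Let nested_limit (a : nat -> R) (w : nat -> R) : (forall n, 0 <= w n) ->
  (forall n, a n <= a n.+1 /\ a n.+1 + w n.+1 <= a n + w n) ->
  exists l, forall n, a n <= l <= a n + w n.
Proof.
move=> w0 H.
have am m n : a m <= a n + w n.
  have up k : forall i, a k <= a (k + i)%N.
    by elim=> [|i IH]; rewrite ?addn0// addnS (le_trans IH)//; have [] := H (k + i)%N.
  have dn k : forall i, a (k + i)%N + w (k + i)%N <= a k + w k.
    by elim=> [|i IH]; rewrite ?addn0// addnS (le_trans _ IH)//; have [] := H (k + i)%N.
  have [mn|/ltnW nm] := leqP m n.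
    by rewrite -(subnKC mn) (le_trans (up m (n - m)%N))// lerDl.
  by rewrite -(subnKC nm) (le_trans _ (dn n (m - n)%N))// lerDl.
exists (sup (range a)) => n; apply/andP; split.
  apply: ub_le_sup; last by exists n.
  by exists (a 0%N + w 0%N) => _ [m _ <-]; exact: am.
by apply: sup_le_ub; [exists (a 0%N), 0%N|move=> _ [m _ <-]; exact: am].
Qed.

(** Only the differentiability of G at the points of the image is available, so continuity of the
    derivative cannot be invoked: differentiability at the limit of nested cells replaces it. *)
Theorem goursat : boundary G S1 S2 T1 T2 = 0.
Proof.
have [x [x0 xin xmon xcell]] := nested.
have [s sP] : exists l, forall n, (x n).1 <= l <= (x n).1 + ls * p2 n.
  by apply: nested_limit => n; [rewrite mulr_ge0|have [] := xmon n].
have [t tP] : exists l, forall n, (x n).2 <= l <= (x n).2 + lt_ * p2 n.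
  by apply: nested_limit => n; [rewrite mulr_ge0|have [] := xmon n].
have sS : S1 <= s <= S2.
  by have /andP[h1 h2] := sP 0%N; have [] := xin 0%N; rewrite x0 /= in h1 h2 *; lra.
have tT : T1 <= t <= T2.
  by have /andP[h1 h2] := tP 0%N; have [] := xin 0%N; rewrite x0 /= in h1 h2 *; lra.
have [l Gl] := G_diff sS tT.
apply: (@normc_le_forall_eps _ _ (8 * K ^+ 2 * (ls + lt_) ^+ 2)) => e e0.
have [d d0 H] := Gl e e0.
(* At this depth the image of the cell lies within the radius d on which G is affine up to e. *)
have [n nd] : exists n, K * (ls + lt_) * p2 n < d.
  have M0 : 0 <= K * (ls + lt_) by rewrite mulr_ge0// addr_ge0.
  have := archi_boundP (divr_ge0 M0 (ltW d0)).
  set n := Num.Def.archi_bound _ => h; exists n.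
  rewrite /p2 ltr_pdivrMr ?exprn_gt0// [ltRHS]mulrC -ltr_pdivrMr// (lt_trans h)//.
  by rewrite -natrX ltr_nat ltn_expl.
have [h1 h2 h3 h4] := xin n.
have E0 : cell 0 (S1, T1) = boundary G S1 S2 T1 T2.
  have e1 : S1 + ls * p2 0 = S2 by rewrite /p2 expr0 invr1 mulr1 addrC subrK.
  have e2 : T1 + lt_ * p2 0 = T2 by rewrite /p2 expr0 invr1 mulr1 addrC subrK.
  by rewrite /cell [(S1, T1).1]/= [(S1, T1).2]/= e1 e2.
have := xcell n; rewrite E0 => /le_trans; apply.
have u0 : 0 <= ls * p2 n by rewrite mulr_ge0. have v0 : 0 <= lt_ * p2 n by rewrite mulr_ge0.
have := @boundary_err e s t (x n).1 ((x n).1 + ls * p2 n) (x n).2 ((x n).2 + lt_ * p2 n) l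
  (ltW e0) h1 _ h2 h3 _ h4 (sP n) (tP n).
have aK (p q : R) : p + q - p = q by rewrite addrAC subrr add0r.
rewrite !lerDl !aK => /(_ u0 v0) E.
rewrite (le_trans (ler_wpM2l _ (E _)))//.
  move=> s' t' hs ht; apply: H.
  have s'01 : 0 <= s' <= 1.
    move: hs => /andP[k1 k2]; rewrite (le_trans S01 (le_trans h1 k1)).
    exact: le_trans k2 (le_trans h2 S21).
  apply: le_lt_trans nd; rewrite (le_trans (z_lip _ _ _ s'01))// -mulrA ler_wpM2l// mulrDl.
  move: (sP n) (tP n) => /andP[? ?] /andP[? ?].
  move: hs ht => /andP[? ?] /andP[? ?].
  by rewrite lerD// ler_norml; apply/andP; split; lra.
(* The factor 4^n lost in the subdivision cancels against the square of the side 2^-n. *)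
rewrite -mulrDl exprMn /p2 exprVn.
rewrite (_ : (4 : R) = 2 ^+ 2); last by rewrite -natrX.
rewrite -!exprM mulnC le_eqVlt; apply/orP; left; apply/eqP.
have : (2 : R) ^+ (n * 2) != 0 by rewrite expf_neq0.
by move: (_ ^+ (n * 2)) => y y0; field.
Qed.

End Goursat.

Section CauchyFormula.
Context {R : realType}.
Implicit Types (h : R[i] -> R[i]) (u v w z : R[i]).

(** Unlike [holomorphic_disk], nothing is fixed outside the disk, so that products, compositions and
    derivatives remain in the class. *)
Definition hol h := forall z, normc z < 1 -> exists l, cdiff h z l.

Definition ck v : R[i] := (1 - v)^-1.

Lemma subr1_neq0 v : normc v < 1 -> 1 - v != 0.
Proof.
by move=> v1; apply/eqP => /eqP; rewrite subr_eq0 => /eqP e; rewrite -e normc1 ltxx in v1.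
Qed.

Lemma normc_1B v : 1 - normc v <= normc (1 - v).
Proof. by rewrite -[X in X - _](@normc1 R) lerB_normc. Qed.

Lemma ck_bound (q : R) v : normc v <= q -> q < 1 -> normc (ck v) <= (1 - q)^-1.
Proof.
move=> vq q1; rewrite /ck normcV lef_pV2 ?posrE ?subr_gt0//; last first.
  by rewrite normc_gt0 subr1_neq0// (le_lt_trans vq).
by rewrite (le_trans _ (normc_1B v))// lerB.
Qed.

Lemma ckB u v : normc u < 1 -> normc v < 1 -> ck u - ck v = (u - v) * ck u * ck v.
Proof.
by move=> /subr1_neq0 u1 /subr1_neq0 v1; rewrite /ck; field; rewrite u1 v1.
Qed.

Lemma ck_cdiff v : normc v < 1 -> cdiff ck v (ck v ^+ 2).
Proof.
move=> v1; have n0 := subr1_neq0 v1.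
have h := cdiffB (cdiff_cst 1 v) (cdiff_id v).
apply: cdiff_eq (cdiff_comp h (cdiff_inv n0)) _.
by rewrite /ck exprVn; ring.
Qed.

Lemma ck_lip (q : R) u v : q < 1 -> normc u <= q -> normc v <= q ->
  normc (ck u - ck v) <= (1 - q)^-2 * normc (u - v).
Proof.
move=> q1 uq vq; rewrite ckB ?(le_lt_trans uq)// ?(le_lt_trans vq)// !normcM.
rewrite -mulrA mulrC ler_wpM2r ?normc_ge0// -exprVn expr2.
by rewrite ler_pM ?normc_ge0 ?ck_bound.
Qed.

(** Each of the n terms of the geometric sum 1 + ... + q^(n-1) is at least q^n, and the sum is at
    most 1 / (1 - q). *)
Lemma expr_le_invn (q : R) n : 0 <= q -> q < 1 -> (0 < n)%N -> q ^+ n <= ((1 - q) * n%:R)^-1.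
Proof.
move=> q0 q1 n0; have n1 : 0 < n%:R :> R by rewrite ltr0n.
rewrite invfM ler_pdivlMr// -[leRHS]mul1r ler_pdivlMr ?subr_gt0// mulrC.
have h := subrX1 q n; have s : q ^+ n * n%:R <= \sum_(i < n) q ^+ i.
  rewrite mulr_natr -[X in _ *+ X]card_ord -sumr_const; apply: ler_sum => i _.
  by rewrite ler_wiXn2l ?(ltW q1)// ltnW.
have := ler_wpM2l (_ : 0 <= 1 - q) s; rewrite subr_ge0 => /(_ (ltW q1)) /le_trans; apply.
by rewrite -opprB mulNr -h opprB lerBlDr lerDl exprn_ge0.
Qed.

Lemma rotate_lip u s t : normc (cexp (- s) * u - cexp (- t) * u) <= 4 * pi * normc u * `|s - t|.
Proof.
rewrite -mulrBl normcM -[leRHS]mulrA [normc u * _]mulrC mulrA ler_wpM2r ?normc_ge0//.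
have -> : `|s - t| = `|- s - - t| by rewrite -opprD normrN.
exact: cexp_lipschitz.
Qed.

Lemma normc_rotate t u : normc (cexp t * u) = normc u.
Proof. by rewrite normcM normc_cexp mul1r. Qed.

(** The Riemann sum with N nodes equals 1 / (1 - u^N) by [circle_avg_cauchy], and this tends to 1;
    no power series has to be integrated. *)
Lemma cint_ck u : normc u < 1 -> cint 0 1 (fun t => ck (cexp (- t) * u)) = 1.
Proof.
move=> u1; set q := normc u; have q0 : 0 < 1 - q by rewrite subr_gt0.
pose L := (1 - q)^-2 * (4 * pi).
have FL s t : normc (ck (cexp (- s) * u) - ck (cexp (- t) * u)) <= L * `|s - t|.
  rewrite (le_trans (ck_lip u1 _ _)) ?normc_rotate//.
  rewrite /L -mulrA ler_wpM2l ?invr_ge0 ?exprn_ge0 ?(ltW q0)//.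
  rewrite (le_trans (rotate_lip _ _ _))// ler_wpM2r// ler_piMr ?(ltW u1)// mulr_ge0// pi_ge0//.
apply/eqP; rewrite -subr_eq0; apply/eqP.
apply: (@normc_le_forall_eps _ _ (2 * L + (1 - q)^-2)) => e e0.
have := archi_boundP (ltW (_ : 0 < e^-1)); rewrite invr_gt0 => /(_ e0).
set N := Num.Def.archi_bound _ => eN.
have N0 : (0 < N)%N.
  by rewrite -(ltr0n R) (lt_trans _ eN)// invr_gt0.
have N1 : 0 < N%:R :> R by rewrite ltr0n.
have Ne : N%:R^-1 <= e by rewrite -[leRHS]invrK lef_pV2 ?posrE ?invr_gt0// ltW.
have := riemann_sum01 N0 FL; rewrite circle_avg_cauchy// => h1.
have h2 : normc ((1 - u ^+ N)^-1 - 1) <= (1 - q)^-2 / N%:R.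
  have uN : normc (u ^+ N) <= q by rewrite normcX /q -[leRHS]expr1 ler_wiXn2l ?normc_ge0 ?(ltW u1).
  have n0 := subr1_neq0 (le_lt_trans uN u1).
  have -> : (1 - u ^+ N)^-1 - 1 = u ^+ N * ck (u ^+ N) by rewrite /ck; field.
  rewrite normcM expr2 invfM -mulrA mulrC ler_pM ?normc_ge0 ?ck_bound//.
  by rewrite normcX -invfM expr_le_invn ?normc_ge0.
rewrite (le_trans (normc_dist_trans (1 - u ^+ N)^-1 _ _))// (le_trans (lerD h1 h2))//.
rewrite -mulrDl mulrC ler_wpM2r// addr_ge0 ?invr_ge0 ?exprn_ge0 ?(ltW q0)//.
by rewrite !mulr_ge0 ?invr_ge0 ?exprn_ge0 ?(ltW q0) ?pi_ge0.
Qed.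

Lemma cont_on_bounded a b (F : R -> R[i]) : a <= b -> cont_on a b F ->
  exists2 B : R, 0 <= B & forall t, a <= t <= b -> normc (F t) <= B.
Proof.
move=> ab cF.
have cn : {within `[a, b], continuous (fun t => normc (F t) : R)}.
  apply: continuous_in_subspaceT => t; rewrite inE/= in_itv/= => tab.
  apply/cvgrPdist_lt => e e0; have [d d0 H] := cF t tab e e0.
  near=> s.
  have : normc (F s - F t) < e.
    by apply: H; near: s; exists d => //= s /=; rewrite distrC.
  apply: le_lt_trans; rewrite ler_norml; apply/andP; split.
    by rewrite lerNl opprB lerB_normc.
  by rewrite normc_distC lerB_normc.
have [c _ cP] := EVT_max ab cn.
by exists (normc (F c)); [exact: normc_ge0|move=> t tab; apply: cP; rewrite in_itv].
Unshelve. all: by end_near. Qed.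

Section Formula.
Variables (h : R[i] -> R[i]) (r : R) (u : R[i]).
Hypotheses (hh : hol h) (r0 : 0 < r) (r1 : r < 1) (u1 : normc u < 1).

Let zeta := r%:C * u.
Let c t := r%:C * cexp t - zeta.
Let k : R[i] := (2 * pi)%:C * 'i%C.
Let c' t := k * (r%:C * cexp t).
(** A crude common bound for |c|, for |c'| and for the Lipschitz constant of c. *)
Let K : R := 8 * pi + 2.

Let nzeta : normc zeta < r.
Proof. by rewrite /zeta normc_realM gtr0_norm// gtr_pMr. Qed.

Let nk : normc k = 2 * pi.
Proof.
rewrite /k normc_realM /ComplexField.Normc.normc expr0n add0r expr1n sqrtr1 mulr1.
by rewrite gtr0_norm// mulr_gt0// pi_gt0.
Qed.

Let nc t : 0 < normc (c t).
Proof.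
rewrite (lt_le_trans _ (lerB_normc _ _))// subr_gt0 normc_realM normc_cexp mulr1.
by rewrite gtr0_norm.
Qed.

Let c_rdiff t : rdiff c t (c' t).
Proof.
move=> e e0; have [d d0 H] := rdiff_cexp t e0; exists d => // s /H{}H.
rewrite (_ : _ - _ = r%:C * (cexp s - cexp t - k * cexp t * (s - t)%:C)); last first.
  by rewrite /c /c' /zeta; ring.
rewrite normc_realM gtr0_norm// (le_trans _ H)// ler_piMl ?normc_ge0// ltW//.
Qed.

Let c'_bound t : normc (c' t) <= K.
Proof.
rewrite /c' normcM nk normc_realM normc_cexp mulr1 gtr0_norm// /K.
have p0 := @pi_ge0 R; rewrite (@le_trans _ _ (2 * pi))//; last by lra.
by rewrite ler_piMr ?mulr_ge0// ltW.
Qed.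

Let c_bound t : normc (c t) <= K.
Proof.
rewrite (le_trans (normcB _ _))// normc_realM normc_cexp mulr1 gtr0_norm// /K.
by have p0 := @pi_ge0 R; move: nzeta r1; lra.
Qed.

Let c_lip s t : normc (c s - c t) <= K * `|s - t|.
Proof.
have -> : c s - c t = r%:C * (cexp s - cexp t) by rewrite /c; ring.
rewrite normc_realM gtr0_norm// (@le_trans _ _ (normc (cexp s - cexp t)))//.
  by rewrite ler_piMl ?normc_ge0// ltW.
rewrite (le_trans (cexp_lipschitz _ _))// ler_wpM2r// /K.
by have p0 := @pi_ge0 R; lra.
Qed.

Let c'_cont t : ccont c' t.
Proof.
apply: (@ccontZ _ (fun t => r%:C * cexp t)); apply: ccontZ.
exact: rdiff_ccont (rdiff_cexp t).
Qed.

Let c_cont t : ccont c t. Proof. exact: rdiff_ccont (c_rdiff t). Qed.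

Let G w := h w * (w - zeta)^-1.

Let in_disk s t : 0 <= s <= 1 -> normc (zeta + s%:C * c t) < 1.
Proof.
move=> /andP[s0 s1].
have -> : zeta + s%:C * c t = (1 - s)%:C * zeta + s%:C * (r%:C * cexp t).
  by rewrite /c rmorphB /=; ring.
rewrite (le_lt_trans (normcD _ _))// !normc_realM normc_cexp mulr1.
rewrite (ger0_norm s0) (gtr0_norm r0) ger0_norm ?subr_ge0//.
apply: le_lt_trans r1; rewrite -[leRHS](_ : (1 - s) * r + s * r = _); last by ring.
by rewrite lerD2r ler_wpM2l ?subr_ge0// ler_piMr ?(ltW r0)// ltW.
Qed.

Let G_diff s t : 0 < s -> s <= 1 -> exists l, cdiff G (zeta + s%:C * c t) l.
Proof.
move=> s0 s1; have [l hl] := hh (in_disk t (s := s) ltac:(by rewrite (ltW s0))).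
have n0 : zeta + s%:C * c t - zeta != 0.
  by rewrite addrAC subrr add0r -normc_gt0 normc_realM mulr_gt0 ?normr_gt0 ?gt_eqF.
eexists; apply: cdiffM; first exact: hl.
apply: (cdiff_comp (f := fun w => w - zeta)); last exact: cdiff_inv.
exact: cdiffB (cdiff_id _) (cdiff_cst _ _).
Qed.

(** The integral of h(w) / (w - zeta) along the curve zeta + s c: the factor s cancels, so that the
    pole at zeta is not seen when s tends to 0. *)
Let P s := cint 0 1 (fun t => h (zeta + s%:C * c t) * (c' t / c t)).

(** Goursat on [s, 1] x [0, 1], which stays away from the pole. The edges t = 0 and t = 1 cancel
    because the curve is closed. *)
Let P_const s : 0 < s -> s <= 1 -> P s = P 1.
Proof.
move=> s0 s1.
have := goursat c_rdiff c'_cont c_bound c'_bound c_lip (zeta := zeta) (G := G) (ltW s0) s1 (lexx 1) ler01.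
move=> /(_ ltac:(by move=> s' t' /andP[a1 a2] _; apply: G_diff => //; exact: lt_le_trans a1)).
have c01 : c 1 = c 0 by rewrite /c cexp1 cexp0.
rewrite /boundary /edge_s c01 subrK => /eqP; rewrite subr_eq0 => /eqP.
have E x : 0 < x -> edge_t zeta c c' G x 0 1 = P x.
  move=> x0; apply: eq_cint => t _; rewrite /G addrAC subrr add0r.
  have ct : c t != 0 by rewrite -normc_gt0.
  have xt : x%:C != 0 :> R[i] by rewrite -normc_gt0 normc_real normr_gt0 gt_eqF.
  by field; rewrite ct xt.
by rewrite !E.
Qed.

Let quot_cont t : ccont (fun t => c' t / c t) t.
Proof.
apply: ccontM; first exact: c'_cont.
apply: (ccont_comp (f := fun w => w^-1)); last exact: c_cont.
by apply: cdiff_inv; rewrite -normc_gt0.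
Qed.

Let P_cauchy : P 1 = h zeta * cint 0 1 (fun t => c' t / c t).
Proof.
have [l hl] : exists l, cdiff h zeta l by apply: hh; exact: lt_trans nzeta r1.
have cq : cont_on 0 1 (fun t => c' t / c t) by move=> t _; exact: quot_cont.
have [B B0 BP] := cont_on_bounded ler01 cq.
apply/eqP; rewrite -subr_eq0; apply/eqP.
have [C [d d0 hC]] := cdiff_continuous hl.
apply: (@normc_le_forall_eps _ _ (2 * (`|C| * K * B))) => e e0.
have K0 : 0 < K by rewrite /K; have := @pi_ge0 R; lra.
(* The curve is shrunk until it lies within d of zeta, where |h - h(zeta)| is at most a constant
   times s K, and s <= e makes this small. *)
pose s := Num.min (Num.min 1 e) (d / K / 2).
have s0 : 0 < s by rewrite /s !lt_min ltr01 e0 !divr_gt0.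
have s1 : s <= 1 by rewrite /s !ge_min lexx.
have se : s <= e by rewrite /s !ge_min lexx orbT.
have sd : s * K < d.
  rewrite -ltr_pdivlMr// (@le_lt_trans _ _ (d / K / 2))//; first by rewrite /s ge_min lexx orbT.
  by rewrite ltr_pdivrMr// ltr_pMr ?divr_gt0// ltr1n.
have ch : cont_on 0 1 (fun t => h (zeta + s%:C * c t) * (c' t / c t)).
  move=> t _; apply: ccontM; last exact: quot_cont.
  have [l' hl'] := hh (in_disk t (s := s) ltac:(by rewrite (ltW s0))).
  apply: (ccont_comp hl'); apply: (@rdiff_ccont _ _ _ (s%:C * c' t)).
  move=> e' e'0; have [d' d'0 H] := c_rdiff t e'0; exists d' => // x /H{}H.
  rewrite (_ : _ - _ = s%:C * (c x - c t - c' t * (x - t)%:C)); last by ring.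
  by rewrite normc_realM gtr0_norm// (le_trans _ H)// ler_piMl ?normc_ge0.
rewrite -(P_const s0 s1) -cintZ// -cintB//; last exact: cont_onZ.
rewrite (le_trans (cint_bound (C := e * (`|C| * K * B)) _ _ _))//.
- by apply: cont_onB => //; exact: cont_onZ.
- move=> t t01; rewrite -mulrBl normcM mulrA ler_pM ?normc_ge0 ?BP//.
  have zc : normc (zeta + s%:C * c t - zeta) <= s * K.
    by rewrite addrAC subrr add0r normc_realM gtr0_norm// ler_wpM2l ?(ltW s0).
  rewrite (le_trans (hC _ (le_lt_trans zc sd)))//.
  rewrite (@le_trans _ _ (`|C| * (s * K)))//.
    by rewrite (le_trans (ler_wpM2r (normc_ge0 _) (ler_norm C)))// ler_wpM2l.
  by rewrite mulrCA ler_wpM2r ?mulr_ge0 ?(ltW K0)//.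
- by rewrite subr0 mulr1 mulrCA.
Qed.

(** On the circle c' / c is 2 pi i times the Cauchy kernel, whose mean is 1 by [cint_ck]. Writing
    the point as r u makes the kernel independent of r. *)
Lemma cauchy_formula : cint 0 1 (fun t => h (r%:C * cexp t) * ck (cexp (- t) * u)) = h (r%:C * u).
Proof.
have k0 : k != 0 by rewrite -normc_gt0 nk mulr_gt0 ?pi_gt0.
have rc : r%:C != 0 :> R[i] by rewrite -normc_gt0 normc_real normr_gt0 gt_eqF.
have qE t : c' t / c t = k * ck (cexp (- t) * u).
  have ct : c t != 0 by rewrite -normc_gt0.
  have v1 : 1 - cexp (- t) * u != 0 by apply: subr1_neq0; rewrite normc_rotate.
  have cE : c t = r%:C * cexp t * (1 - cexp (- t) * u).
    by rewrite mulrBr mulr1 -!mulrA [cexp t * _]mulrA [cexp t * _]mulrC cexpNM mul1r.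
  by rewrite cE /c' /ck; field; rewrite v1 cexp_neq0 rc.
have cck : cont_on 0 1 (fun t => ck (cexp (- t) * u)).
  move=> t _; have : ccont (fun t => k^-1 * (c' t / c t)) t by apply: ccontZ; exact: quot_cont.
  by congr ccont; apply/funext => x; rewrite qE mulrA mulVf// mul1r.
have chc : cont_on 0 1 (fun t => h (r%:C * cexp t) * ck (cexp (- t) * u)).
  move=> t t01; apply: ccontM; last exact: cck.
  have [l hl] : exists l, cdiff h (r%:C * cexp t) l.
    by apply: hh; rewrite normc_realM normc_cexp mulr1 gtr0_norm.
  apply: (ccont_comp hl); apply: ccontZ; exact: rdiff_ccont (rdiff_cexp t).
have := P_cauchy; rewrite /P.
have -> : cint 0 1 (fun t => c' t / c t) = k * 1.
  by rewrite -(cint_ck u1) -cintZ//; apply: eq_cint => t _; exact: qE.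
have -> : cint 0 1 (fun t => h (zeta + 1%:C * c t) * (c' t / c t)) =
   k * cint 0 1 (fun t => h (r%:C * cexp t) * ck (cexp (- t) * u)).
  rewrite -cintZ//; apply: eq_cint => t _; rewrite qE.
  have -> : zeta + 1%:C * c t = r%:C * cexp t by rewrite /c; ring.
  by rewrite mulrCA.
by rewrite mulr1 mulrC => /(mulIf k0).
Qed.

Lemma cauchy_integrand_cont :
  cont_on 0 1 (fun t => h (r%:C * cexp t) * ck (cexp (- t) * u)).
Proof.
move=> t t01; apply: ccontM.
  have [l hl] : exists l, cdiff h (r%:C * cexp t) l.
    by apply: hh; rewrite normc_realM normc_cexp mulr1 gtr0_norm.
  apply: (ccont_comp hl); apply: ccontZ; exact: rdiff_ccont (rdiff_cexp t).
apply: (@lipschitz_ccont _ _ _ ((1 - normc u)^-2 * (4 * pi))) => s.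
rewrite (le_trans (ck_lip u1 _ _)) ?normc_rotate// -mulrA ler_wpM2l//.
  by rewrite invr_ge0 exprn_ge0// subr_ge0 ltW.
rewrite (le_trans (rotate_lip _ _ _))// ler_wpM2r// ler_piMr ?(ltW u1)//.
by rewrite mulr_ge0// pi_ge0.
Qed.

End Formula.

End CauchyFormula.

(** * Taylor estimates, primitives and circle bounds derived from Cauchy's formula *)

Section CauchyConsequences.
Context {R : realType}.
Implicit Types (h : R[i] -> R[i]) (u v w z : R[i]).

Lemma cdiff_of_quadratic (f : R[i] -> R[i]) z l (C d : R) : 0 < d ->
  (forall w, normc (w - z) < d -> normc (f w - f z - l * (w - z)) <= C * normc (w - z) ^+ 2) ->
  cdiff f z l.
Proof.
move=> d0 H e e0; have C1 : 0 < `|C| + 1 by rewrite ltr_pwDr.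
exists (Num.min d (e / (`|C| + 1))); first by rewrite lt_min d0 divr_gt0.
move=> w; rewrite lt_min ltr_pdivlMr// => /andP[/H{}H wd].
rewrite (le_trans H)// expr2 mulrA ler_wpM2r ?normc_ge0// (le_trans _ (ltW wd))//.
by rewrite mulrC ler_wpM2l ?normc_ge0// (le_trans (ler_norm _))// lerDl.
Qed.

Lemma cdiff_derive1 (f : R[i] -> R[i]) z l : cdiff f z l -> derive1 f z = l.
Proof. by case/cdiffP. Qed.

Lemma hol_derive1 h z : hol h -> normc z < 1 -> cdiff h z (derive1 h z).
Proof. by move=> hh /hh[l hl]; rewrite (cdiff_derive1 hl). Qed.

Lemma ccont_rotate (k : R[i] -> R[i]) l u t : cdiff k (cexp (- t) * u) l ->
  ccont (fun t => k (cexp (- t) * u)) t.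
Proof.
move=> kl; apply: (ccont_comp kl).
apply: (@lipschitz_ccont _ _ _ (4 * pi * normc u)) => s; exact: rotate_lip.
Qed.

(** Differentiation under the integral sign with a quantitative remainder: a uniform second-order
    Taylor bound for the kernel passes to its integrals against psi. Applied with [ck] it
    differentiates h, and with the square of [ck] it differentiates the derivative of h. *)
Lemma param_integral_quadratic (psi : R -> R[i]) (k k' k'' : R[i] -> R[i]) (r q C : R) :
  0 < r -> q < 1 -> cont_on 0 1 psi ->
  (forall v, normc v < 1 -> cdiff k v (k' v)) ->
  (forall v, normc v < 1 -> cdiff k' v (k'' v)) ->
  (forall u v, normc u <= q -> normc v <= q ->
     normc (k v - k u - (v - u) * k' u) <= C * normc (v - u) ^+ 2) ->
  exists C' : R, forall u v, normc u <= q * r -> normc v <= q * r ->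
    normc (cint 0 1 (fun t => psi t * k (cexp (- t) * (v / r%:C)))
        - cint 0 1 (fun t => psi t * k (cexp (- t) * (u / r%:C)))
        - cint 0 1 (fun t => psi t * (cexp (- t) / r%:C) * k' (cexp (- t) * (u / r%:C))) * (v - u))
     <= C' * normc (v - u) ^+ 2.
Proof.
move=> r0 q1 cpsi kd kd' kC; have [B B0 BP] := cont_on_bounded ler01 cpsi.
have rc : r%:C != 0 :> R[i] by rewrite -normc_gt0 normc_real normr_gt0 gt_eqF.
exists (2 * (B * (C / r ^+ 2))) => u v uq vq.
have ur x : normc x <= q * r -> normc (x / r%:C) <= q.
  by move=> xq; rewrite normcM normcV normc_real gtr0_norm// ler_pdivrMr.
have ur1 x t : normc x <= q * r -> normc (cexp (- t) * (x / r%:C)) < 1.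
  by move=> /ur xq; rewrite normc_rotate (le_lt_trans xq).
have c1 x : normc x <= q * r -> cont_on 0 1 (fun t => psi t * k (cexp (- t) * (x / r%:C))).
  move=> xq t t01; apply: ccontM; first exact: cpsi.
  by apply: ccont_rotate; apply: kd; exact: ur1.
have c2 : cont_on 0 1 (fun t => psi t * (cexp (- t) / r%:C) * k' (cexp (- t) * (u / r%:C))).
  move=> t t01; apply: ccontM; last by apply: ccont_rotate; apply: kd'; exact: ur1.
  apply: ccontM; first exact: cpsi.
  exact: (@ccont_rotate id 1 (r%:C^-1) t (cdiff_id _)).
rewrite [_ * (v - u)]mulrC -cintZ// -cintB; [|exact: c1|exact: c1].
rewrite -cintB; [|by apply: cont_onB; exact: c1|exact: cont_onZ].
rewrite (le_trans (cint_bound (C := B * (C / r ^+ 2 * normc (v - u) ^+ 2)) _ _ _))//.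
- by apply: cont_onB; [apply: cont_onB; exact: c1|exact: cont_onZ].
- move=> t t01.
  set U := cexp (- t) * (u / r%:C); set V := cexp (- t) * (v / r%:C).
  have VU : V - U = (v - u) * (cexp (- t) / r%:C) by rewrite /V /U; ring.
  rewrite (_ : _ - _ = psi t * (k V - k U - (V - U) * k' U)); last by rewrite VU; ring.
  rewrite normcM ler_pM ?normc_ge0 ?BP// (le_trans (kC _ _ _ _)) ?normc_rotate ?ur//.
  rewrite VU !normcM normc_cexp mul1r normcV normc_real gtr0_norm// exprMn exprVn.
  by rewrite le_eqVlt; apply/orP; left; apply/eqP; ring.
- by rewrite subr0 mulr1 !mulrA.
Qed.

Lemma ck_quadratic (q : R) u v : q < 1 -> normc u <= q -> normc v <= q ->
  normc (ck v - ck u - (v - u) * ck u ^+ 2) <= (1 - q)^-1 ^+ 3 * normc (v - u) ^+ 2.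
Proof.
move=> q1 uq vq.
have u1 := subr1_neq0 (le_lt_trans uq q1); have v1 := subr1_neq0 (le_lt_trans vq q1).
have -> : ck v - ck u - (v - u) * ck u ^+ 2 = ck u ^+ 2 * ck v * (v - u) ^+ 2.
  by rewrite /ck; field; rewrite u1 v1.
rewrite normcM normcX ler_wpM2r ?exprn_ge0 ?normc_ge0// normcM normcX.
have -> : (1 - q)^-1 ^+ 3 = (1 - q)^-1 * (1 - q)^-1 * (1 - q)^-1 by ring.
by rewrite expr2 ler_pM ?mulr_ge0 ?normc_ge0 ?ck_bound// ler_pM ?normc_ge0 ?ck_bound.
Qed.

Lemma ck2_cdiff v : normc v < 1 -> cdiff (fun v => ck v ^+ 2) v (2 * ck v ^+ 3).
Proof. by move=> v1; apply: cdiff_eq (cdiffM (ck_cdiff v1) (ck_cdiff v1)) _; ring. Qed.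

Lemma ck2_quadratic (q : R) u v : q < 1 -> normc u <= q -> normc v <= q ->
  normc (ck v ^+ 2 - ck u ^+ 2 - (v - u) * (2 * ck u ^+ 3)) <= 3 * (1 - q)^-1 ^+ 4 * normc (v - u) ^+ 2.
Proof.
move=> q1 uq vq.
have u1 := subr1_neq0 (le_lt_trans uq q1); have v1 := subr1_neq0 (le_lt_trans vq q1).
have -> : ck v ^+ 2 - ck u ^+ 2 - (v - u) * (2 * ck u ^+ 3) =
   (ck u * ck u) * (ck v * (2 * ck u + ck v)) * (v - u) ^+ 2.
  by rewrite /ck; field; rewrite u1 v1.
have b1 : normc (ck u) <= (1 - q)^-1 by exact: ck_bound.
have b2 : normc (ck v) <= (1 - q)^-1 by exact: ck_bound.
rewrite normcM normcX ler_wpM2r ?exprn_ge0 ?normc_ge0// !normcM.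
have -> : 3 * (1 - q)^-1 ^+ 4 = (1 - q)^-1 * (1 - q)^-1 * ((1 - q)^-1 * (3 * (1 - q)^-1)) by ring.
have b3 : normc (2 * ck u + ck v) <= 3 * (1 - q)^-1.
  rewrite (le_trans (normcD _ _))// mulr_natl mulr2n; have := normcD (ck u) (ck u); lra.
by rewrite ler_pM ?mulr_ge0 ?normc_ge0// ler_pM ?normc_ge0.
Qed.

Lemma ck3_cdiff v : normc v < 1 -> exists l, cdiff (fun v => 2 * ck v ^+ 3) v l.
Proof.
move=> v1; eexists; apply: cdiffZ.
exact: cdiffM (ck_cdiff v1) (ck2_cdiff v1).
Qed.

Section Taylor.
Variables (h : R[i] -> R[i]) (r0 : R).
Hypotheses (hh : hol h) (r00 : 0 <= r0) (r01 : r0 < 1).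

(** Two margins: the circle of integration has radius r between r0 and 1, and the estimates hold for
    |z| <= q r with r0 < q r < r, so that every point of |z| <= r0 is interior to their range. *)
Let r := (1 + r0) / 2.
Let q := (r0 / r + 1) / 2.
Let rr : r0 < r. Proof. by rewrite /r; move: r01; lra. Qed.
Let rp : 0 < r. Proof. exact: le_lt_trans rr. Qed.
Let r1 : r < 1. Proof. by rewrite /r; move: r01; lra. Qed.
Let qq : r0 / r < 1. Proof. by rewrite ltr_pdivrMr// mul1r. Qed.
Let q1 : q < 1. Proof. by rewrite /q; move: qq; lra. Qed.
Let qr : r0 < q * r. Proof. by rewrite -ltr_pdivrMr// /q; move: qq; lra. Qed.
Let psi t := h (r%:C * cexp t).
Let rc : r%:C != 0 :> R[i].
Proof. by rewrite -normc_gt0 normc_real normr_gt0 gt_eqF. Qed.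
Let qr1 : q * r < r. Proof. by rewrite gtr_pMl. Qed.

Let cpsi : cont_on 0 1 psi.
Proof.
move=> t t01; have [l hl] : exists l, cdiff h (r%:C * cexp t) l.
  by apply: hh; rewrite normc_realM normc_cexp mulr1 gtr0_norm.
apply: (ccont_comp hl); apply: ccontZ; exact: rdiff_ccont (rdiff_cexp t).
Qed.

Let J z := cint 0 1 (fun t => psi t * (cexp (- t) / r%:C) * ck (cexp (- t) * (z / r%:C)) ^+ 2).

Let hE z : normc z <= q * r -> h z = cint 0 1 (fun t => psi t * ck (cexp (- t) * (z / r%:C))).
Proof.
move=> zq; rewrite /psi (cauchy_formula hh rp r1).
  by rewrite mulrC divfK.
by rewrite normcM normcV normc_real gtr0_norm// ltr_pdivrMr// mul1r (le_lt_trans zq).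
Qed.

Let taylor_aux : exists C : R, forall u v, normc u <= q * r -> normc v <= q * r ->
  normc (h v - h u - J u * (v - u)) <= C * normc (v - u) ^+ 2.
Proof.
have [C CP] := param_integral_quadratic rp q1 cpsi ck_cdiff ck2_cdiff
  (fun u v => @ck_quadratic q u v q1).
by exists C => u v uq vq; rewrite !hE//; exact: CP.
Qed.

Let h_J z : normc z < q * r -> cdiff h z (J z).
Proof.
move=> zq; have [C CP] := taylor_aux.
apply: (@cdiff_of_quadratic _ _ _ C (q * r - normc z)); first by rewrite subr_gt0.
move=> w wz; apply: CP; first exact: ltW.
by rewrite -(subrK z w) (le_trans (normcD _ _))// -lerBrDr ltW.
Qed.

Lemma hol_taylor : exists C : R, forall u v, normc u <= r0 -> normc v <= r0 ->
  normc (h v - h u - derive1 h u * (v - u)) <= C * normc (v - u) ^+ 2.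
Proof.
have [C CP] := taylor_aux; exists C => u v ur vr.
by rewrite (cdiff_derive1 (h_J (le_lt_trans ur qr))) CP// ltW// (le_lt_trans _ qr).
Qed.

Lemma derive1_cdiff_within z : normc z <= r0 -> exists l, cdiff (derive1 h) z l.
Proof.
move=> zr; have zq := le_lt_trans zr qr.
have cpsi' : cont_on 0 1 (fun t => psi t * (cexp (- t) / r%:C)).
  move=> t t01; apply: ccontM; first exact: cpsi.
  exact: (@ccont_rotate id 1 (r%:C^-1) t (cdiff_id _)).
have /choice[k3 k3P] : forall v, exists l, normc v < 1 -> cdiff (fun v => 2 * ck v ^+ 3) v l.
  move=> v; have [v1|v1] := boolP (normc v < 1); last by exists 0.
  by have [l] := ck3_cdiff v1; exists l.
have [C CP] := param_integral_quadratic rp q1 cpsi' ck2_cdiff k3P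
  (fun u v => @ck2_quadratic q u v q1).
eexists; apply: (@cdiff_ext _ J _ _ _ (q * r - normc z)); first by rewrite subr_gt0.
  move=> w wz; rewrite (cdiff_derive1 (h_J _))//.
  by rewrite -(subrK z w) (le_lt_trans (normcD _ _))// -ltrBrDr.
apply: (@cdiff_of_quadratic _ _ _ C (q * r - normc z)); first by rewrite subr_gt0.
move=> w wz; apply: CP; first exact: ltW.
by rewrite -(subrK z w) (le_trans (normcD _ _))// -lerBrDr ltW.
Qed.

End Taylor.

Lemma hol_derive1_hol h : hol h -> hol (derive1 h).
Proof. by move=> hh z z1; exact: (derive1_cdiff_within hh (normc_ge0 z) z1). Qed.

Lemma hol_segment_cont h z : hol h -> normc z < 1 ->
  cont_on 0 1 (fun t => h (t%:C * z)).
Proof.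
move=> hh z1 t /andP[t0 t1]; have [l hl] : exists l, cdiff h (t%:C * z) l.
  by apply: hh; rewrite normc_realM ger0_norm// (le_lt_trans _ z1)// ler_piMl ?normc_ge0.
apply: (ccont_comp hl); apply: (@lipschitz_ccont _ _ _ (normc z)) => s.
by rewrite -mulrBl -rmorphB normc_realM mulrC.
Qed.

Lemma primitive_cdiff h z : hol h -> normc z < 1 ->
  cdiff (fun z => cint 0 1 (fun t => h (t%:C * z) * z)) z (h z).
Proof.
move=> hh z1; have hh' := hol_derive1_hol hh.
pose r := (1 + normc z) / 2.
have zr : normc z < r by rewrite /r; lra.
have r1 : r < 1 by rewrite /r; lra.
have r0 : 0 <= r := le_trans (normc_ge0 z) (ltW zr).
have [C CP] := hol_taylor hh r0 r1.
have [B B0 BP] := cont_on_bounded ler01 (hol_segment_cont hh' z1).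
apply: (@cdiff_of_quadratic _ _ _ (2 * (`|C| + B)) (r - normc z)); first by rewrite subr_gt0.
move=> w wz; have wr : normc w < r.
  by rewrite -(subrK z w) (le_lt_trans (normcD _ _))// -ltrBrDr.
have w1 := lt_trans wr r1.
have tz1 t x : normc x < r -> 0 <= t <= 1 -> normc (t%:C * x) <= r.
  move=> /ltW xr /andP[t0 t1]; rewrite normc_realM ger0_norm// (le_trans _ xr)//.
  by rewrite ler_piMl ?normc_ge0.
have tc t : rdiff (fun t => t%:C * z) t z.
  move=> e e0; exists 1 => // s _; rewrite (_ : _ - _ = 0) ?normc0 ?mulr_ge0 ?(ltW e0)//.
  by rewrite rmorphB /=; ring.
have tcc t : ccont (fun t => t%:C : R[i]) t.
  by apply: (@lipschitz_ccont _ _ _ 1) => s; rewrite -rmorphB normc_real mul1r.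
pose F' t := h (t%:C * z) + t%:C * (derive1 h (t%:C * z) * z).
have cz : cont_on 0 1 (fun t => h (t%:C * z)) by exact: hol_segment_cont.
have cw : cont_on 0 1 (fun t => h (t%:C * w)) by exact: hol_segment_cont.
have cM x F : cont_on 0 1 F -> cont_on 0 1 (fun t => F t * x).
  by move=> cF; apply: cont_on_ext (cont_onZ x cF) => t; rewrite mulrC.
have cF' : cont_on 0 1 F'.
  apply: cont_onD => // t t01; apply: ccontM; first exact: tcc.
  exact: cM (hol_segment_cont hh' z1) t t01.
have -> : h z = cint 0 1 F'.
  rewrite (cint_FTC (F := fun t => t%:C * h (t%:C * z)) ler01 cF').
    by rewrite mul1r mul0r subr0 mul1r.
  move=> t t01 e e0.
  have hl : cdiff h (t%:C * z) (derive1 h (t%:C * z)).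
    by apply: hol_derive1 => //; rewrite (le_lt_trans (tz1 _ _ zr t01)).
  have Fl := rdiff_comp hl (tc t) (fun s => erefl (h (s%:C * z))).
  have Fc := rdiff_ccont Fl.
  have [d d0 H] := Fl (e / 2 / (`|t| + 1)) ltac:(by rewrite !divr_gt0// ltr_pwDr).
  have [d' d'0 H'] := Fc (e / 2) ltac:(by rewrite divr_gt0).
  exists (Num.min d d'); first by rewrite lt_min d0.
  move=> s; rewrite lt_min => /andP[/H{}H /H'{}H'].
  rewrite (_ : _ - _ = (s - t)%:C * (h (s%:C * z) - h (t%:C * z)) +
     t%:C * (h (s%:C * z) - h (t%:C * z) - derive1 h (t%:C * z) * z * (s - t)%:C)); last first.
    by rewrite /F' rmorphB /=; ring.
  rewrite (le_trans (normcD _ _))// !normc_realM (splitr e) mulrDl lerD//.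
    by rewrite mulrC ler_wpM2r// ltW.
  rewrite (le_trans (ler_wpM2l _ H))// mulrA ler_wpM2r//.
  by rewrite mulrCA ler_piMr ?divr_ge0 ?(ltW e0)// ler_pdivrMr ?ltr_pwDr// mul1r lerDl.
rewrite [cint 0 1 F' * _]mulrC -cintZ// -cintB; [|exact: cM|exact: cM].
rewrite -cintB; [|by apply: cont_onB; exact: cM|exact: cont_onZ].
rewrite (le_trans (cint_bound (C := (`|C| + B) * normc (w - z) ^+ 2) _ _ _))//.
- by apply: cont_onB; [apply: cont_onB; exact: cM|exact: cont_onZ].
- move=> t t01; have /andP[t0 t1] := t01.
  rewrite (_ : _ - _ = w * (h (t%:C * w) - h (t%:C * z) - derive1 h (t%:C * z) * (t%:C * w - t%:C * z))
     + t%:C * (derive1 h (t%:C * z) * (w - z) ^+ 2)); last by rewrite /F'; ring.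
  rewrite (le_trans (normcD _ _))// mulrDl lerD//.
    rewrite normcM (le_trans (ler_piMl (normc_ge0 _) (ltW w1)))//.
    rewrite (le_trans (CP _ _ (tz1 _ _ zr t01) (tz1 _ _ wr t01)))//.
    rewrite -mulrBr normc_realM exprMn.
    rewrite (@le_trans _ _ (`|C| * (`|t| ^+ 2 * normc (w - z) ^+ 2)))//.
      by rewrite ler_wpM2r ?ler_norm// mulr_ge0 ?exprn_ge0 ?normc_ge0.
    rewrite ler_wpM2l// ler_piMl ?exprn_ge0 ?normc_ge0// exprn_ile1//.
    by rewrite ger0_norm.
  rewrite normc_realM ger0_norm// (le_trans (ler_piMl (normc_ge0 _) t1))//.
  by rewrite normcM normcX ler_wpM2r ?exprn_ge0 ?normc_ge0// BP.
- by rewrite subr0 mulr1 mulrA.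
Qed.

Section CircleBounds.
Variables (h : R[i] -> R[i]) (r B q : R).
Hypotheses (hh : hol h) (r0 : 0 < r) (r1 : r < 1) (q1 : q < 1).
Hypothesis hB : forall t, normc (h (r%:C * cexp t)) <= B.

(** A weak form of the maximum principle, read off Cauchy's formula; the loss 1 / (1 - q) is a
    constant wherever it is applied. *)
Lemma circle_bound u : normc u <= q -> normc (h (r%:C * u)) <= 2 * (B / (1 - q)).
Proof.
move=> uq; have u1 := le_lt_trans uq q1.
rewrite -(cauchy_formula hh r0 r1 u1).
rewrite (le_trans (cint_bound (C := B / (1 - q)) _ _ _))//.
- exact: cauchy_integrand_cont.
- by move=> t _; rewrite normcM ler_pM ?normc_ge0// ck_bound// normc_rotate.
- by rewrite subr0 mulr1.
Qed.

Lemma circle_lip u v : normc u <= q -> normc v <= q ->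
  normc (h (r%:C * u) - h (r%:C * v)) <= 2 * (B / (1 - q) ^+ 2) * normc (u - v).
Proof.
move=> uq vq; have u1 := le_lt_trans uq q1; have v1 := le_lt_trans vq q1.
rewrite -(cauchy_formula hh r0 r1 u1) -(cauchy_formula hh r0 r1 v1).
rewrite -cintB; [|exact: cauchy_integrand_cont|exact: cauchy_integrand_cont].
rewrite (le_trans (cint_bound (C := B * ((1 - q)^-2 * normc (u - v))) _ _ _))//.
- by apply: cont_onB; exact: cauchy_integrand_cont.
- move=> t _; rewrite -mulrBr normcM ler_pM ?normc_ge0//.
  by rewrite (le_trans (ck_lip q1 _ _)) ?normc_rotate// -mulrBr normc_rotate.
- by rewrite subr0 mulr1 !mulrA.
Qed.

End CircleBounds.

End CauchyConsequences.

(** * The dyadic lattice of the disk *)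

Section PowerSums.
Context {R : realType}.
Implicit Types (x y a b s p : R).

Lemma powRDp x a b : 0 < x -> x `^ (a + b) = x `^ a * x `^ b.
Proof. by move=> x0; rewrite powRD// (gt_eqF x0) implybT. Qed.

Lemma powR_le x y p : 0 <= p -> 0 <= x -> x <= y -> x `^ p <= y `^ p.
Proof. by move=> p0 x0 xy; apply: ge0_ler_powR => //; rewrite nnegrE// (le_trans x0). Qed.

Lemma powR_anti x y p : p <= 0 -> 0 < x -> x <= y -> y `^ p <= x `^ p.
Proof.
move=> p0 x0 xy; have y0 := lt_le_trans x0 xy.
rewrite -(opprK p) (powRN y) (powRN x) lef_pV2 ?posrE ?powR_gt0//.
by apply: powR_le; rewrite ?oppr_ge0// ltW.
Qed.

(** Covers both signs of the exponent, since alpha - beta + 1 may be negative. *)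
Lemma powR_comparable x y K p : 0 < K -> 0 < y -> y <= K * x -> x <= K * y ->
  x `^ p <= K `^ `|p| * y `^ p.
Proof.
move=> K0 y0 yx xy; have x0 : 0 < x by rewrite -(pmulr_rgt0 _ K0) (lt_le_trans y0).
have [p0|p0] := leP 0 p.
  by rewrite (ger0_norm p0) -powRM ?(ltW K0) ?(ltW y0)// powR_le// ltW.
rewrite (ltr0_norm p0) (_ : x `^ p = K `^ (- p) * (K * x) `^ p).
  by rewrite ler_wpM2l ?powR_ge0// powR_anti// ltW.
by rewrite powRM ?(ltW K0) ?(ltW x0)// mulrA -powRDp// addNr powRr0 mul1r.
Qed.

Lemma bernoulli_ge x n : 0 <= x -> 1 + n%:R * x <= (1 + x) ^+ n.
Proof.
move=> x0; elim: n => [|n IH]; first by rewrite mul0r addr0 expr0.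
rewrite exprS; apply: le_trans (ler_wpM2l _ IH); last by rewrite addr_ge0.
rewrite -natr1; have : 0 <= n%:R * x * x by rewrite !mulr_ge0.
lra.
Qed.

Definition dyad m : R := 2 ^- m.

Lemma dyad_gt0 m : 0 < dyad m. Proof. by rewrite invr_gt0 exprn_gt0. Qed.

Lemma dyad0 : dyad 0 = 1. Proof. by rewrite /dyad expr0 invr1. Qed.

Lemma dyadS m : dyad m.+1 = dyad m / 2.
Proof. by rewrite /dyad exprS invfM mulrC. Qed.

Lemma dyad_le1 m : dyad m <= 1.
Proof. by rewrite /dyad invf_le1 ?exprn_gt0// exprn_ege1// ler1n. Qed.

Lemma dyad_natr m : dyad m = (2 ^ m)%N%:R^-1.
Proof. by rewrite /dyad natrX. Qed.

Lemma ltr_dyad m n : (m < n)%N -> dyad n <= dyad m / 2.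
Proof.
move=> mn; rewrite -dyadS /dyad lef_pV2 ?posrE ?exprn_gt0//.
by rewrite ler_eXn2l// ltr1n.
Qed.

(** As long as d_m >= delta the terms are at most d_m^-b and grow geometrically; beyond, they are at
    most d_m^a delta^-(a + b) and decay geometrically. Both sums are governed by their value at the
    scale delta. *)
Lemma geometric_two_scale a b : 0 < a -> 0 < b -> exists2 C : R, 0 < C &
  forall (delta : R) (x : nat -> R) n, 0 < delta -> delta <= 1 ->
   (forall m, dyad m <= x m) -> (forall m, delta <= x m) ->
   \sum_(m < n) dyad m `^ a * x m `^ (- (a + b)) <= C * delta `^ (- b).
Proof.
move=> a0 b0.
have two p : (2^-1 : R) `^ p = (2 `^ p)^-1 :> R by rewrite -powR_inv1// -powRrM mulN1r powRN.
have one p : 1 `^ p = 1 :> R by rewrite powR1.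
have b1 : 1 < (2 : R) `^ b.
  by rewrite -[ltLHS](one b) gt0_ltr_powR// ?nnegrE// ltr1n.
have a1 : (2 : R) `^ (- a) < 1.
  by rewrite powRN invf_lt1 ?powR_gt0// -[ltLHS](one a) gt0_ltr_powR// ?nnegrE// ltr1n.
pose C1 := ((2 : R) `^ b - 1)^-1; pose C2 := (1 - (2 : R) `^ (- a))^-1.
have C10 : 0 < C1 by rewrite invr_gt0 subr_gt0.
have C20 : 0 < C2 by rewrite invr_gt0 subr_gt0.
have C1E : C1 + 1 = C1 * 2 `^ b.
  by rewrite /C1; field; rewrite subr_eq0 gt_eqF.
have C2E : C2 * 2 `^ (- a) = C2 - 1.
  by rewrite /C2; field; rewrite subr_eq0 gt_eqF.
exists (C1 * 2 `^ b + C2); first by rewrite addr_gt0// mulr_gt0// powR_gt0.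
move=> delta x n dl0 dl1 xd xdl.
set K := C1 * 2 `^ b + C2.
have dS p m : dyad m.+1 `^ p = dyad m `^ p * 2 `^ (- p).
  by rewrite dyadS powRM ?(ltW (dyad_gt0 _))// two powRN.
(* An explicit bound for the partial sums that makes the induction close: a growing geometric sum
   down to the scale delta, then the final bound minus the geometric tail still to come. *)
pose Phi n := if delta <= dyad n then C1 * dyad n `^ (- b)
  else K * delta `^ (- b) - C2 * dyad n `^ a * delta `^ (- (a + b)).
have dab p : 0 < p -> p `^ a * p `^ (- (a + b)) = p `^ (- b).
  by move=> p0; rewrite -powRDp//; congr (_ `^ _); ring.
have db0 : 0 < delta `^ (- b) by rewrite powR_gt0.
suff H : \sum_(m < n) dyad m `^ a * x m `^ (- (a + b)) <= Phi n.
  rewrite (le_trans H)// /Phi; case: ifP => [dd|_].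
    rewrite (@le_trans _ _ (C1 * delta `^ (- b)))//.
      by rewrite ler_wpM2l ?(ltW C10)// powR_anti// oppr_le0 ltW.
    rewrite ler_wpM2r ?(ltW db0)// /K (@le_trans _ _ (C1 * 2 `^ b))//.
      by rewrite ler_peMr// ltW.
    by rewrite lerDl ltW.
  by rewrite lerBlDr lerDl !mulr_ge0 ?powR_ge0// ltW.
elim: n => [|n IH].
  rewrite big_ord0 /Phi dyad0 dl1 mulr_ge0 ?powR_ge0// ltW//.
rewrite big_ord_recr /= (le_trans (lerD IH (lexx _)))//.
have ab0 : - (a + b) <= 0 by rewrite oppr_le0 ltW// addr_gt0.
rewrite {1}/Phi; case: ifPn => [dn|].
  have h1 : C1 * dyad n `^ (- b) + dyad n `^ a * x n `^ (- (a + b)) <=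
      C1 * dyad n.+1 `^ (- b).
    rewrite dS opprK [leRHS]mulrCA -C1E mulrDr mulr1 [C1 * _]mulrC lerD// -dab ?dyad_gt0//.
    by rewrite ler_wpM2l ?powR_ge0// powR_anti// dyad_gt0.
  rewrite (le_trans h1)// /Phi; case: ifPn => // ; rewrite -ltNge => dn1.
  have h2 : dyad n.+1 `^ (- b) <= 2 `^ b * delta `^ (- b).
    by rewrite dS opprK mulrC ler_wpM2l ?powR_ge0//; apply: powR_anti; rewrite ?oppr_le0 ?(ltW b0).
  have h3 : dyad n.+1 `^ a * delta `^ (- (a + b)) <= delta `^ (- b).
    by rewrite -dab// ler_wpM2r ?powR_ge0//; apply: powR_le; exact: ltW || (apply: ltW; exact: dyad_gt0).
  rewrite lerBrDr /K mulrDl -!mulrA lerD//; first by rewrite ler_wpM2l// ltW.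
  by rewrite ler_wpM2l// ltW.
rewrite -ltNge => dn.
have dn1 : dyad n.+1 < delta.
  by rewrite (lt_trans _ dn)// dyadS ltr_pdivrMr// ltr_pMr ?dyad_gt0// ltr1n.
rewrite /Phi ifN -?ltNge// -addrA lerD2l dS.
have h1 : dyad n `^ a * x n `^ (- (a + b)) <= dyad n `^ a * delta `^ (- (a + b)).
  by rewrite ler_wpM2l ?powR_ge0// powR_anti.
rewrite (_ : C2 * (dyad n `^ a * _) * _ =
  (C2 * 2 `^ (- a)) * (dyad n `^ a * delta `^ (- (a + b)))); last by ring.
by rewrite C2E; move: h1; lra.
Qed.

Definition radius m : R := 1 - dyad m.

Lemma radius_ge0 m : 0 <= radius m. Proof. by rewrite subr_ge0 dyad_le1. Qed.

Lemma radius_lt1 m : radius m < 1. Proof. by rewrite ltrBlDr ltrDl dyad_gt0. Qed.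

(** (1 - d)(1 + d) <= 1 and Bernoulli's inequality (1 + 2^-m)^(2^m) >= 2. This is what makes 2^m
    roots of unity enough on the circle of radius 1 - 2^-m. *)
Lemma radius_pow m N : (2 ^ m <= N)%N -> radius m ^+ N <= 2^-1.
Proof.
move=> mN; have d0 := dyad_gt0 m.
have r1 : 0 < 1 + dyad m by rewrite addr_gt0.
have h1 : radius m <= (1 + dyad m)^-1.
  rewrite -[leRHS]mul1r ler_pdivlMr// /radius -subr_sqr expr1n lerBlDr lerDl sqr_ge0//.
rewrite (@le_trans _ _ (radius m ^+ (2 ^ m)))//.
  by rewrite ler_wiXn2l ?radius_ge0// ltW// radius_lt1.
rewrite (@le_trans _ _ ((1 + dyad m)^-1 ^+ (2 ^ m)))//.
  by rewrite lerXn2r ?nnegrE ?radius_ge0 ?invr_ge0 ?(ltW r1).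
rewrite exprVn lef_pV2 ?posrE ?exprn_gt0//.
rewrite (le_trans _ (bernoulli_ge _ _)) ?(ltW d0)//.
by rewrite dyad_natr divff ?pnatr_eq0 ?expn_eq0.
Qed.

End PowerSums.

(** * Lattice nodes, means of the kernel and sums over cells *)

Section Lattice.
Context {R : realType}.
Implicit Types (s b : R) (w z zeta : R[i]).

Definition node m N j : R[i] := (@radius R m)%:C * cexp (j%:R / N%:R).

Definition lattice m j := node m (2 ^ m) j.

Definition cker s zeta w : R := (normc (1 - zeta^*%C * w) `^ s)^-1.

Lemma conj_real (r : R) : (r%:C)^*%C = r%:C.
Proof. by rewrite /conjc /= oppr0. Qed.

Lemma conj_node m N j : (node m N j)^*%C = (radius m)%:C * cexp (- (j%:R / N%:R)).
Proof. by rewrite /node conjcM conj_real cexp_conj. Qed.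

Lemma normc_node m N j : normc (node m N j) = radius m.
Proof. by rewrite /node normc_realM normc_cexp mulr1 ger0_norm// radius_ge0. Qed.

Lemma normc_node_lt1 m N j : normc (node m N j) < 1.
Proof. by rewrite normc_node radius_lt1. Qed.

Lemma cker_ge0 s zeta w : 0 <= cker s zeta w.
Proof. by rewrite invr_ge0 powR_ge0. Qed.

Lemma normc_1Bconj zeta w : normc zeta < 1 -> 1 - normc w <= normc (1 - zeta^*%C * w).
Proof.
move=> z1; rewrite (le_trans _ (normc_1B _))// lerB// normcM normcJ.
by rewrite ler_piMl ?normc_ge0// ltW.
Qed.

Lemma normc_1Bconj_gt0 zeta w : normc zeta < 1 -> normc w < 1 ->
  0 < normc (1 - zeta^*%C * w).
Proof. by move=> z1 w1; rewrite (lt_le_trans _ (normc_1Bconj _ z1))// subr_gt0. Qed.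

(** The exponent 2 is handled by [circle_avg_sqr]; the remaining power s - 2 >= 0 is estimated
    pointwise by |1 - conj(zeta) w| >= 1 - |u|. The constant 4 is (1/2)^-2, from |u|^N <= 1/2. *)
Lemma circle_avg_pow s m N w : 2 <= s -> (2 ^ m <= N)%N -> normc w < 1 ->
  N%:R^-1 * \sum_(j < N) cker s (node m N j) w
    <= 4 * (1 - radius m * normc w) `^ (1 - s).
Proof.
move=> s2 mN w1; have N0 : (0 < N)%N by rewrite (leq_trans _ mN)// expn_gt0.
pose u := (radius m)%:C * w.
have nu : normc u = radius m * normc w by rewrite normc_realM ger0_norm// radius_ge0.
have ur : normc u <= radius m by rewrite nu ler_piMr ?radius_ge0// ltW.
have u1 : normc u < 1 := le_lt_trans ur (radius_lt1 m).
have u0 : 0 < 1 - normc u by rewrite subr_gt0.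
rewrite -nu.
have H j : cker s (node m N j) w <=
    (1 - normc u) `^ (2 - s) * (normc (1 - cexp (- (j%:R / N%:R)) * u) ^+ 2)^-1.
  rewrite /cker.
  have -> : (node m N j)^*%C * w = cexp (- (j%:R / N%:R)) * u.
    by rewrite conj_node /u; ring.
  set x := normc (1 - _).
  have ux : 1 - normc u <= x by rewrite (le_trans _ (normc_1B _))// normc_rotate.
  have x0 : 0 < x by exact: lt_le_trans ux.
  rewrite -powRN -powR_mulrn ?(ltW x0)// -powRN.
  have -> : x `^ (- s) = x `^ (2 - s + - 2) by congr (_ `^ _); ring.
  rewrite powRDp// ler_wpM2r ?powR_ge0//; apply: powR_anti => //.
  by rewrite subr_le0.
apply: (@le_trans _ _ (N%:R^-1 * \sum_(j < N) (1 - normc u) `^ (2 - s) *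
   (normc (1 - cexp (- (j%:R / N%:R)) * u) ^+ 2)^-1)).
  by rewrite ler_wpM2l ?invr_ge0// ler_sum.
rewrite -mulr_sumr mulrCA.
have := circle_avg_sqr N0 u1 => h.
rewrite (le_trans (ler_wpM2l (powR_ge0 _ _) h))//.
have hN : 2^-1 <= 1 - normc u ^+ N.
  rewrite lerBrDr -lerBrDl (le_trans _ (_ : 2^-1 <= _))//; last by lra.
  rewrite (le_trans _ (radius_pow mN))// lerXn2r ?nnegrE ?normc_ge0 ?radius_ge0//.
rewrite invfM mulrA.
have -> : (1 - normc u) `^ (1 - s) = (1 - normc u) `^ (2 - s) * (1 - normc u)^-1.
  by rewrite -powR_inv1 ?(ltW u0)// -powRDp//; congr (_ `^ _); ring.
rewrite mulrC ler_wpM2r ?mulr_ge0 ?powR_ge0 ?invr_ge0 ?(ltW u0)//.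
have -> : 4 = (2^-1 ^+ 2)^-1 :> R by rewrite exprVn invrK -natrX.
by rewrite lef_pV2 ?posrE ?exprn_gt0 ?invr_gt0// ?lerXn2r ?nnegrE ?invr_ge0// ?(le_trans _ hN)// (lt_le_trans _ hN).
Qed.

(** [geometric_two_scale] with a = s - 1 - b, delta = 1 - |w| and x_m = 1 - (1 - d_m) |w|. The bound
    is uniform in the numbers N m >= 2^m of nodes, so that it serves both the lattice and the finer
    quadratures. *)
Lemma lattice_sum s b : 2 <= s -> 0 < b -> 0 < s - 1 - b -> exists2 C : R, 0 < C &
  forall w (N : nat -> nat) n, normc w < 1 -> (forall m, 2 ^ m <= N m)%N ->
  \sum_(m < n) dyad m `^ (s - 1 - b) *
     ((N m)%:R^-1 * \sum_(j < N m) cker s (node m (N m) j) w)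
   <= C * (1 - normc w) `^ (- b).
Proof.
move=> s2 b0 a0; have [C C0 H] := geometric_two_scale a0 b0.
exists (4 * C); first by rewrite mulr_gt0.
move=> w N n w1 mN.
have d0 : 0 < 1 - normc w by rewrite subr_gt0.
have d1 : 1 - normc w <= 1 by rewrite gerBl normc_ge0.
have := H (1 - normc w) (fun m => 1 - radius m * normc w) n d0 d1 _ _.
have -> : - (s - 1 - b + b) = 1 - s by ring.
move=> {}H; rewrite -mulrA; apply: le_trans (ler_wpM2l _ (H _ _)) => //.
- rewrite mulr_sumr; apply: ler_sum => m _; rewrite [leRHS]mulrCA ler_wpM2l ?powR_ge0//.
  exact: circle_avg_pow.
- move=> m; rewrite -[leLHS](subKr 1) lerB// -/(radius m) ler_piMr ?radius_ge0//.
  exact: ltW.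
- by move=> m; rewrite lerB// ler_piMl ?normc_ge0// ltW// radius_lt1.
Qed.

(** In units of d_m: 1 for the error in the modulus, 4 pi for the error in the argument, by
    [cexp_lipschitz]. *)
Definition cover_const : R := 1 + 4 * pi.

Lemma cover_const_ge1 : 1 <= cover_const.
Proof. by rewrite lerDl mulr_ge0// pi_ge0. Qed.

Lemma dyad_scale (d : R) : 0 < d -> d <= 1 -> exists m, dyad m / 2 < d <= dyad m.
Proof.
move=> d0 d1.
have [n nd] : exists n, dyad n < d.
  have := archi_boundP (ltW (_ : 0 < d^-1)); rewrite invr_gt0 => /(_ d0).
  set n := Num.Def.archi_bound _ => h; exists n.
  rewrite -[ltRHS]invrK /dyad ltf_pV2 ?posrE ?invr_gt0 ?exprn_gt0// (lt_trans h)//.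
  by rewrite -natrX ltr_nat ltn_expl.
elim: n nd => [|n IH] nd; first by rewrite dyad0 ltNge d1 in nd.
have [/IH//|dn] := ltP (dyad n) d.
by exists n; rewrite dn -dyadS nd.
Qed.

Lemma lattice_cover w : normc w < 1 -> exists m j, [/\ (j < 2 ^ m)%N,
  normc (w - lattice m j) <= cover_const * dyad m, dyad m <= 2 * (1 - normc w) &
  1 - normc w <= dyad m].
Proof.
move=> w1; have d0 : 0 < 1 - normc w by rewrite subr_gt0.
have d1 : 1 - normc w <= 1 by rewrite gerBl normc_ge0.
have [m /andP[m1 m2]] := dyad_scale d0 d1.
have [t /andP[t0 t1] wt] := polar w.
have N1 : 0 < (2 ^ m)%N%:R :> R by rewrite ltr0n expn_gt0.
have N0 : (2 ^ m)%N%:R != 0 :> R by rewrite gt_eqF.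
have tN : 0 <= t * (2 ^ m)%N%:R by rewrite mulr_ge0// ltW.
have /andP[j1 j2] := truncn_itv tN.
set j := Num.truncn _ in j1 j2.
exists m, j; split; [|  |by move: m1; lra|by []].
  rewrite -(ltr_nat R) (le_lt_trans j1)// gtr_pMl//.
rewrite {1}wt /lattice /node.
have key (a b : R) (x y : R[i]) : a%:C * x - b%:C * y = (a - b)%:C * x + b%:C * (x - y).
  by rewrite (rmorphB (real_complex R)) /=; ring.
rewrite key.
rewrite (le_trans (normcD _ _))// !normc_realM normc_cexp mulr1 /cover_const mulrDl mul1r lerD//.
  rewrite ler_norml /radius; apply/andP; split; move: m1 m2 (@dyad_gt0 R m); lra.
rewrite (ger0_norm (radius_ge0 m)) (le_trans (ler_piMl (normc_ge0 _) (ltW (radius_lt1 m))))//.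
rewrite (le_trans (cexp_lipschitz _ _))// ler_wpM2l ?mulr_ge0 ?pi_ge0//.
rewrite dyad_natr ger0_norm ?subr_ge0 ?ler_pdivrMr// lerBlDr -[X in _ <= X + _]mul1r -mulrDl.
by rewrite ler_pdivlMr// nat1r ltW.
Qed.

(** |1 - conj(zeta) w| is at least 1 - |w|, so a displacement of w by O(1 - |w|) changes it at most
    by a constant factor, uniformly in zeta. *)
Lemma cker_shift s zeta w v (d : R) : 0 <= s -> normc zeta < 1 -> normc w < 1 -> normc v < 1 ->
  normc (w - v) <= cover_const * d -> d <= 2 * (1 - normc w) ->
  cker s zeta w <= (1 + 2 * cover_const) `^ s * cker s zeta v.
Proof.
move=> s0 z1 w1 v1 wv dw; have c1 := cover_const_ge1.
have cc : 0 < 1 + 2 * cover_const by lra.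
have k1 := normc_1Bconj_gt0 z1 w1; have k2 := normc_1Bconj_gt0 z1 v1.
rewrite /cker -[leLHS]mul1r ler_pdivrMr ?powR_gt0// mulrAC ler_pdivlMr ?powR_gt0// mul1r.
rewrite -powRM ?(ltW cc) ?(ltW k1)//; apply: powR_le; rewrite ?(ltW k2)//.
rewrite (_ : 1 - zeta^*%C * v = 1 - zeta^*%C * w + zeta^*%C * (w - v)); last by ring.
rewrite (le_trans (normcD _ _))// mulrDl mul1r lerD// normcM normcJ.
rewrite (le_trans (ler_piMl (normc_ge0 _) (ltW z1)))// (le_trans wv)//.
rewrite mulrAC [leRHS]mulrC ler_wpM2l ?(le_trans _ c1)//.
by rewrite (le_trans dw)// ler_wpM2l// normc_1Bconj.
Qed.

Section Majorant.
Variables (W : R[i] -> R) (phi : R[i] -> R[i]) (BW : R).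
Hypotheses (W0 : forall z, normc z < 1 -> 0 <= W z)
  (WB : forall z, normc z < 1 -> W z <= BW)
  (phi1 : forall z, normc z < 1 -> normc (phi z) < 1).

(** The value 0 is included so that a cell not met by phi has supremum 0. *)
Definition cell_set m j : set R := [set x | x = 0 \/
  exists z, [/\ normc z < 1, normc (phi z - lattice m j) <= cover_const * dyad m & x = W z]].

Definition cell_sup m j : R := sup (cell_set m j).

Definition cell_summable b := exists C : R, forall n,
  \sum_(m < n) dyad m `^ (- b) * \sum_(j < 2 ^ m) cell_sup m j <= C.

Lemma cell_set_ub m j : has_ubound (cell_set m j).
Proof.
exists `|BW| => x [->//|[z [z1 _ ->]]].
by rewrite (le_trans (WB z1))// ler_norm.
Qed.

Lemma cell_sup_ge0 m j : 0 <= cell_sup m j.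
Proof. by apply: ub_le_sup; [exact: cell_set_ub|left]. Qed.

Lemma cell_sup_ub m j z : normc z < 1 ->
  normc (phi z - lattice m j) <= cover_const * dyad m -> W z <= cell_sup m j.
Proof. by move=> z1 H; apply: ub_le_sup; [exact: cell_set_ub|right; exists z]. Qed.

Lemma cell_sup_le m j (x : R) : 0 <= x -> (forall z, normc z < 1 ->
  normc (phi z - lattice m j) <= cover_const * dyad m -> W z <= x) -> cell_sup m j <= x.
Proof.
move=> x0 H; apply: sup_le_ub; first by exists 0; left.
by move=> _ [->//|[z [z1 zl ->]]]; exact: H.
Qed.

(** G(zeta) is a constant times the sum over all cells of the cell supremum times the kernel at the
    lattice point. It dominates W(z) |1 - conj(zeta) phi(z)|^-s because phi(z) lies in some cell.
    After an exchange of sums, [lattice_sum] at w = [lattice m' j'], where 1 - |w| = d_m', turns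
    each kernel into d_m'^-b, which gives back the double series. *)
Lemma majorant s b : 2 <= s -> 0 < b -> 0 < s - 1 - b -> cell_summable b ->
  exists G : R[i] -> R, [/\ forall zeta, normc zeta < 1 -> 0 <= G zeta,
    forall zeta z, normc zeta < 1 -> normc z < 1 -> W z * cker s zeta (phi z) <= G zeta &
    exists C : R, forall (N : nat -> nat) n, (forall m, 2 ^ m <= N m)%N ->
     \sum_(m < n) dyad m `^ (s - 1 - b) *
       ((N m)%:R^-1 * \sum_(j < N m) G (node m (N m) j)) <= C].
Proof.
move=> s2 b0 a0 [CW CWP].
have [C C0 HC] := lattice_sum s2 b0 a0.
have s0 : 0 <= s by rewrite (le_trans _ s2).
pose K := (1 + 2 * cover_const) `^ s.
have K0 : 0 <= K by rewrite powR_ge0.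
pose g n zeta := \sum_(m < n) \sum_(j < 2 ^ m) cell_sup m j * cker s zeta (lattice m j).
have g0 n zeta : 0 <= g n zeta.
  by rewrite sumr_ge0// => m _; rewrite sumr_ge0// => j _; rewrite mulr_ge0 ?cell_sup_ge0 ?cker_ge0.
have gS n zeta : g n zeta <= g n.+1 zeta.
  by rewrite /g [leRHS]big_ord_recr lerDl /= sumr_ge0// => j _; rewrite mulr_ge0 ?cell_sup_ge0 ?cker_ge0.
have gmon zeta : nondecreasing_seq (g ^~ zeta) by apply/nondecreasing_seqP => n; exact: gS.
(* A crude bound depending on zeta, only to make the limit finite. *)
have gub zeta : normc zeta < 1 -> has_ubound (range (g ^~ zeta)).
  move=> z1; exists (CW * (1 - normc zeta) `^ (- s)) => _ [n _ <-].
  apply: le_trans (ler_wpM2r (powR_ge0 _ _) (CWP n)).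
  rewrite mulr_suml; apply: ler_sum => m _.
  rewrite -mulrA mulr_suml mulr_sumr; apply: ler_sum => j _.
  apply: (@le_trans _ _ (cell_sup m j * (1 - normc zeta) `^ (- s))).
    rewrite ler_wpM2l ?cell_sup_ge0// /cker -powRN; apply: powR_anti; rewrite ?oppr_le0 ?subr_gt0//.
    rewrite (le_trans _ (normc_1B _))// lerB// normcM normcJ ler_piMr ?normc_ge0//.
    by rewrite ltW// normc_node_lt1.
  rewrite ler_peMl ?mulr_ge0 ?cell_sup_ge0 ?powR_ge0// powRN invf_ge1 ?powR_gt0 ?dyad_gt0//.
  have -> : 1 = 1 `^ b :> R by rewrite powR1.
  by apply: powR_le; rewrite ?(ltW b0) ?(ltW (dyad_gt0 _))// dyad_le1.
pose G zeta := K * limn (g ^~ zeta).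
have gcvg zeta : normc zeta < 1 -> cvgn (g ^~ zeta).
  by move=> /gub; exact: nondecreasing_is_cvgn.
have gG n zeta : normc zeta < 1 -> g n zeta <= limn (g ^~ zeta).
  by move=> z1; apply: nondecreasing_cvgn_le; [exact: gmon|exact: gcvg].
exists G; split.
- by move=> zeta z1; rewrite mulr_ge0// (le_trans (g0 0%N zeta) (gG _ _ z1)).
- move=> zeta z z1 zz1; have [m [j [jm h1 h2 h3]]] := lattice_cover (phi1 zz1).
  have k := cker_shift s0 z1 (phi1 zz1) (normc_node_lt1 m _ j) h1 h2.
  have w := cell_sup_ub zz1 h1.
  rewrite (le_trans (ler_pM (W0 zz1) (cker_ge0 _ _ _) w k))// mulrCA ler_wpM2l//.
  rewrite (le_trans _ (gG m.+1 _ z1))// /g big_ord_recr /=.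
  rewrite (bigD1 (Ordinal jm))//= addrCA lerDl addr_ge0//.
    by rewrite sumr_ge0// => i _; rewrite sumr_ge0// => l _; rewrite mulr_ge0 ?cell_sup_ge0 ?cker_ge0.
  by rewrite sumr_ge0// => i _; rewrite mulr_ge0 ?cell_sup_ge0 ?cker_ge0.
- exists (K * (C * CW)) => N n mN.
  pose S (F : R[i] -> R) := \sum_(m < n) dyad m `^ (s - 1 - b) *
     ((N m)%:R^-1 * \sum_(j < N m) F (node m (N m) j)).
  have Sg n' : S (g n') <= C * CW.
    have -> : S (g n') = \sum_(m' < n') \sum_(j' < 2 ^ m') cell_sup m' j' *
       S (fun zeta => cker s zeta (lattice m' j')).
      rewrite /S /g.
      under eq_bigr => m _.
        rewrite exchange_big /= mulr_sumr mulr_sumr.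
        under eq_bigr => m' _ do rewrite exchange_big /= mulr_sumr mulr_sumr.
        over.
      rewrite exchange_big /=; apply: eq_bigr => m' _.
      rewrite exchange_big /=; apply: eq_bigr => j' _.
      rewrite mulr_sumr; apply: eq_bigr => m _.
      rewrite -mulr_sumr; ring.
    rewrite (le_trans _ (ler_wpM2l (ltW C0) (CWP n')))// mulr_sumr; apply: ler_sum => m' _.
    rewrite mulrA mulr_sumr; apply: ler_sum => j' _; rewrite mulrC ler_wpM2r ?cell_sup_ge0//.
    rewrite (le_trans (HC _ _ _ (normc_node_lt1 m' _ j') mN))// ler_wpM2l ?(ltW C0)//.
    by rewrite normc_node /radius opprB addrC subrK.
  have SG : S (g n') @[n' --> \oo] --> S (fun zeta => limn (g ^~ zeta)).
    apply: cvg_big => [|m _]; first exact: add_continuous.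
    apply: cvgMl_tmp; apply: cvgMl_tmp; apply: cvg_big => [|j _]; first exact: add_continuous.
    exact: gcvg (normc_node_lt1 _ _ _).
  have -> : \sum_(m < n) dyad m `^ (s - 1 - b) *
       ((N m)%:R^-1 * \sum_(j < N m) G (node m (N m) j)) = K * S (fun zeta => limn (g ^~ zeta)).
    rewrite /S mulr_sumr; apply: eq_bigr => m _; rewrite /G -mulr_sumr; ring.
  rewrite ler_wpM2l//.
  by rewrite -(cvg_lim _ SG)//; apply: limr_le; [exact: cvgP SG|apply: nearW].
Qed.

End Majorant.

End Lattice.

(** * The area integral *)

Section NonmeasurableMonotonicity.
Context d (T : measurableType d) (R : realType) (mu : {measure set T -> \bar R}).
Local Open Scope ereal_scope.

(* No measurability is asked of f or g: the integral of a nonnegative function is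
   a supremum over the simple functions below it. *)
Lemma le_integral_nonneg (D : set T) (f g : T -> \bar R) :
  (forall x, D x -> 0 <= f x) -> (forall x, D x -> f x <= g x) ->
  \int[mu]_(x in D) f x <= \int[mu]_(x in D) g x.
Proof.
move=> f0 fg.
have g0 x : D x -> 0 <= g x by move=> Dx; rewrite (le_trans (f0 x Dx))// fg.
have neg0 (h : T -> \bar R) : (forall x, D x -> 0 <= h x) -> (h \_ D)^\- = cst 0.
  move=> h0; apply/funext => x; rewrite funenegE /patch; case: ifPn => [|_]; last first.
    by rewrite oppe0 maxxx.
  by rewrite inE => Dx; apply: max_idPr; rewrite leeNl oppe0 h0.
rewrite /integral (neg0 _ f0) (neg0 _ g0); apply: leeD2r.
apply: le_ereal_sup => _ [h hf <-]; exists h => // x.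
apply: (le_trans (hf x)); rewrite !funeposE /patch.
case: ifPn => [|_//]; rewrite inE => Dx.
by apply: Order.TotalTheory.le_max2 => //; exact: fg.
Qed.

End NonmeasurableMonotonicity.

Section Squares.
Context {R : realType}.
Implicit Types (s b t : R) (w z zeta : R[i]).
Local Notation mu := (@lebesgue_measure R).
Local Notation mu2 := (mu \x mu)%E.

(** Squares take the place of disks because the product measure of a rectangle is the product of two
    lengths. *)
Definition square zeta (r : R) : set (R * R) :=
  `[complex.Re zeta - r, complex.Re zeta + r] `*`
  `[complex.Im zeta - r, complex.Im zeta + r].

Lemma measurable_square zeta (r : R) : measurable (square zeta r).
Proof. exact: measurableX. Qed.

Lemma measure_square zeta (r : R) : 0 <= r -> mu2 (square zeta r) = ((2 * r) ^+ 2)%:E.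
Proof.
move=> r0; rewrite /square product_measure1E//.
have E (x : R) : mu `[x - r, x + r] = (2 * r)%:E.
  rewrite lebesgue_measure_itv/= lte_fin; case: ltP => h.
    by rewrite -EFinB; congr EFin; ring.
  by congr EFin; move: h; lra.
by rewrite expr2 EFinM; congr (_ * _)%E; exact: E.
Qed.

Lemma square_dist zeta (r : R) (p : R * R) : square zeta r p ->
  normc ((p.1 +i* p.2)%C - zeta) <= 2 * r.
Proof.
case: zeta p => [a b] [x y] /= [/=]; rewrite !in_itv/= => /andP[h1 h2] /andP[h3 h4].
rewrite (le_trans (normc_le_ReIm _))//= mulr_natl mulr2n lerD// ler_norml; apply/andP; split; lra.
Qed.

Lemma dist_square zeta (r : R) (p : R * R) :
  normc ((p.1 +i* p.2)%C - zeta) <= r -> square zeta r p.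
Proof.
case: zeta p => [a b] [x y] /= h.
have h1 := le_trans (normc_Re _) h; have h2 := le_trans (normc_Im _) h.
move: h1 h2 => /=; rewrite !ler_norml => /andP[? ?] /andP[? ?].
by split; rewrite /= in_itv/=; apply/andP; split; lra.
Qed.

Lemma integral_squares (c : nat -> nat -> R) (r : nat -> R) n :
  (forall m j, 0 <= c m j) -> (forall m, 0 <= r m) ->
  (\int[mu2]_p (\sum_(m < n) \sum_(j < 2 ^ m) c m j * \1_(square (lattice m j) (r m)) p)%:E =
   (\sum_(m < n) (2 * r m) ^+ 2 * \sum_(j < 2 ^ m) c m j)%:E)%E.
Proof.
move=> c0 r0.
have m1 m j : measurable_fun setT (EFin \o (fun p : R * R => c m j * \1_(square (lattice m j) (r m)) p)).
  apply/measurable_EFinP; apply: measurable_funM => //.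
  exact: measurable_indic (measurable_square _ _).
have p0 m j p : (0 <= (c m j * \1_(square (@lattice R m j) (r m)) p)%:E)%E.
  by rewrite lee_fin mulr_ge0.
have e1 : (fun p => (\sum_(m < n) \sum_(j < 2 ^ m) c m j * \1_(square (@lattice R m j) (r m)) p)%:E) =
   (fun p => (\sum_(m < n) \sum_(j < 2 ^ m) (c m j * \1_(square (@lattice R m j) (r m)) p)%:E)%E).
  by apply/funext => p; rewrite -sumEFin; apply: eq_bigr => m _; rewrite -sumEFin.
rewrite e1 ge0_integral_sum//; last 2 first.
  by move=> m; apply: emeasurable_sum => j; exact: m1.
  by move=> m p _; apply: sume_ge0 => j _.
rewrite -sumEFin; apply: eq_bigr => m _.
rewrite ge0_integral_sum//; last by move=> j; exact: m1.
rewrite mulr_sumr -sumEFin; apply: eq_bigr => j _.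
have e2 : (fun p => (c m j * \1_(square (@lattice R m j) (r m)) p)%:E) =
   (fun p => (c m j)%:E * (\1_(square (@lattice R m j) (r m)) p)%:E)%E.
  by apply/funext => p; rewrite EFinM.
rewrite e2 ge0_integralZl_EFin//; last first.
  by apply/measurable_EFinP; exact: measurable_indic (measurable_square _ _).
rewrite integral_indic ?setIT//; last exact: measurable_square.
by rewrite [LHS]/= measure_square// -EFinM mulrC.
Qed.

End Squares.

Section IntegralCondition.
Context {R : realType}.
Implicit Types (s b t : R) (w z zeta : R[i]).
Local Notation mu := (@lebesgue_measure R).
Local Notation mu2 := (mu \x mu)%E.

Variables (W : R[i] -> R) (phi : R[i] -> R[i]) (BW s b : R) (K : R[i] -> \bar R).
Hypotheses (W0 : forall z, normc z < 1 -> 0 <= W z)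
  (WB : forall z, normc z < 1 -> W z <= BW)
  (phi1 : forall z, normc z < 1 -> normc (phi z) < 1).
Hypotheses (K_lower : forall zeta z, normc zeta < 1 -> normc z < 1 ->
    ((W z * cker s zeta (phi z))%:E <= K zeta)%E)
  (K_upper : forall zeta (x : R), normc zeta < 1 ->
    (forall z, normc z < 1 -> W z * cker s zeta (phi z) <= x) -> (K zeta <= x%:E)%E).
Hypotheses (s2 : 2 <= s) (b0 : 0 < b) (a0 : 0 < s - 1 - b).

(** With s = alpha + 3 and b = beta this is the exponent alpha - beta + 1 of the weight; [K] stands
    for [kernel_sup] and enters only through its upper and lower bounds. *)
Let t := s - 2 - b.
Let disk : set (R * R) := [set p | normc (p.1 +i* p.2)%C < 1].
Let H (p : R * R) : \bar R :=
  (K (p.1 +i* p.2)%C * ((1 - normc (p.1 +i* p.2)%C ^+ 2) `^ t)%:E)%E.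

Let s0 : 0 <= s. Proof. by rewrite (le_trans _ s2). Qed.

Let K_ge0 zeta : normc zeta < 1 -> (0 <= K zeta)%E.
Proof.
move=> z1; apply: le_trans (K_lower z1 (_ : normc 0 < 1)); last by rewrite normc0 ltr01.
by rewrite lee_fin mulr_ge0 ?cker_ge0// W0// normc0 ltr01.
Qed.

Let H_ge0 p : disk p -> (0 <= H p)%E.
Proof. by move=> Dp; rewrite mule_ge0 ?K_ge0// lee_fin powR_ge0. Qed.

Let csup0 m j : 0 <= cell_sup W phi m j.
Proof. exact: (cell_sup_ge0 phi WB). Qed.

Let cc : R := cover_const.
Let cc1 : 1 <= cc. Proof. exact: cover_const_ge1. Qed.

(** Small enough that points of a square stay within d_m / 8 of its centre, hence in the disk and
    away from all the other squares. *)
Let small m : R := dyad m / 16.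
Let small_gt0 m : 0 < small m. Proof. by rewrite divr_gt0// dyad_gt0. Qed.

Let square_small m j p : square (lattice m j) (small m) p ->
  normc ((p.1 +i* p.2)%C - lattice m j) <= dyad m / 8.
Proof. by move=> /square_dist /le_trans; apply; rewrite /small; lra. Qed.

Let square_norm m j p : square (lattice m j) (small m) p ->
  1 - dyad m * 9 / 8 <= normc (p.1 +i* p.2)%C <= 1 - dyad m * 7 / 8.
Proof.
move=> /square_small h; set zeta := (p.1 +i* p.2)%C in h *.
have e : normc (@lattice R m j) = 1 - dyad m by rewrite normc_node.
have h1 := lerB_normc (lattice m j) zeta; rewrite normc_distC in h1.
have h2 := lerB_normc zeta (lattice m j).
by move: h1 h2 h; rewrite e => *; apply/andP; split; lra.
Qed.

Let square_disk m j p : square (lattice m j) (small m) p -> disk p.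
Proof.
move=> /square_norm /andP[_ h]; rewrite /disk /= (le_lt_trans h)//.
have := @dyad_gt0 R m; lra.
Qed.

(** Different levels are separated by the modulus, and nodes of one level by [roots_dist], since the
    radius is at least 1/2 for m > 0; the level 0 has a single node. *)
Let squares_disjoint m j m' j' p : (j < 2 ^ m)%N -> (j' < 2 ^ m')%N ->
  square (lattice m j) (small m) p -> square (lattice m' j') (small m') p ->
  m = m' /\ j = j'.
Proof.
move=> jm jm' h h'.
have mm' k k' i i' : square (lattice k i) (small k) p ->
    square (lattice k' i') (small k') p -> (k <= k')%N.
  move=> /square_norm /andP[h1 _] /square_norm /andP[_ h2]; rewrite leqNgt; apply/negP => kk.
  have := @ltr_dyad R _ _ kk; have := @dyad_gt0 R k; have := @dyad_gt0 R k'; lra.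
have mE : m = m' by apply/eqP; rewrite eqn_leq (mm' _ _ _ _ h h') (mm' _ _ _ _ h' h).
subst m'; split => //; apply/eqP/negPn/negP => jj.
have m0 : (0 < m)%N.
  by case: m jm jm' {h h'} => // ; case: j jj => // ; case: j'.
have h1 : dyad m <= normc (cexp (j%:R / (2 ^ m)%N%:R) - cexp (j'%:R / (2 ^ m)%N%:R)) :> R.
  by rewrite [leLHS]dyad_natr roots_dist.
have h2 : normc (@lattice R m j - lattice m j') <= dyad m / 4.
  rewrite (le_trans (normc_dist_trans (p.1 +i* p.2)%C _ _))//.
  have k1 := square_small h; have k2 := square_small h'; rewrite normc_distC in k1.
  move: k1 k2; lra.
have rm : 2^-1 <= radius m :> R.
  by have := @ltr_dyad R _ _ m0; rewrite dyad0 /radius; lra.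
move: h2; rewrite /lattice /node -mulrBr normc_realM ger0_norm ?radius_ge0// => h2.
have h3 := ler_pM (_ : 0 <= 2^-1) (ltW (dyad_gt0 m)) rm h1.
have : 0 <= 2^-1 :> R by [].
by move=> /h3 h4; have := @dyad_gt0 R m; lra.
Qed.

Let lower_const : R := ((3 + cc) `^ s * 4 `^ `|t|)^-1.
Let lower_const_gt0 : 0 < lower_const.
Proof. by rewrite invr_gt0 mulr_gt0 ?powR_gt0//; have := cc1; lra. Qed.

(** For zeta in the square around a lattice point a, and phi(z) in its cell, 1 - conj(zeta) phi(z)
    differs from 1 - |a|^2 by O(d_m), so the kernel is at least a multiple of d_m^-s; the weight is
    comparable to d_m^t. *)
Let H_lower m j p : square (lattice m j) (small m) p ->
  ((lower_const * dyad m `^ (t - s) * cell_sup W phi m j)%:E <= H p)%E.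
Proof.
move=> pm; have Dp := square_disk pm.
set zeta := (p.1 +i* p.2)%C; have z1 : normc zeta < 1 by [].
have /andP[n1 n2] := square_norm pm; rewrite -/zeta in n1 n2.
have d0 := @dyad_gt0 R m.
have n0 := normc_ge0 zeta.
have wlow : dyad m / 4 <= 1 - normc zeta ^+ 2.
  have : normc zeta * normc zeta <= normc zeta by rewrite ler_piMr// ltW.
  by rewrite expr2; lra.
have whigh : 1 - normc zeta ^+ 2 <= 4 * dyad m.
  have e : 1 - normc zeta ^+ 2 = (1 - normc zeta) * (1 + normc zeta) by ring.
  have : (1 - normc zeta) * (1 + normc zeta) <= (1 - normc zeta) * 2.
    by rewrite ler_wpM2l; lra.
  by rewrite -e; lra.
have w0 : 0 < 1 - normc zeta ^+ 2 by rewrite (lt_le_trans _ wlow)// divr_gt0.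
have wt : dyad m `^ t <= 4 `^ `|t| * (1 - normc zeta ^+ 2) `^ t.
  by apply: powR_comparable => //; lra.
(* The supremum in (c) may be infinite at some points, where the bound is trivial; elsewhere it is a
   real number x. *)
have [Hinf|Hfin] := eqVneq (H p) +oo%E; first by rewrite Hinf leey.
have wt0 : 0 < (1 - normc zeta ^+ 2) `^ t by rewrite powR_gt0.
have Kfin : K zeta \is a fin_num.
  rewrite ge0_fin_numE ?K_ge0// ltey; apply: contra Hfin => /eqP e.
  by rewrite /H -/zeta e mulyr gtr0_sg// mul1e.
pose x := fine (K zeta).
have KE : K zeta = x%:E by rewrite fineK.
have x0 : 0 <= x by rewrite fine_ge0// K_ge0.
rewrite /H -/zeta KE -EFinM lee_fin.
have c3 : 0 < 3 + cc by have := cc1; lra.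
pose c3d := ((3 + cc) * dyad m) `^ s.
have c3d0 : 0 < c3d by rewrite powR_gt0// mulr_gt0.
have cell : cell_sup W phi m j <= x * c3d.
  apply: cell_sup_le; first by rewrite mulr_ge0// ltW.
  move=> z zz1 zc; rewrite -ler_pdivrMr//.
  have := K_lower z1 zz1; rewrite KE lee_fin; apply: le_trans.
  rewrite ler_wpM2l ?W0// /cker lef_pV2 ?posrE ?powR_gt0 ?normc_1Bconj_gt0 ?phi1 ?mulr_gt0//.
  apply: powR_le => //; first exact: normc_ge0.
  set a := lattice m j in zc pm *.
  have na : normc a = 1 - dyad m by rewrite normc_node.
  rewrite (_ : 1 - zeta^*%C * phi z = (1 - a^*%C * a) - a^*%C * (phi z - a) - (zeta - a)^*%C * phi z); last first.
    by rewrite conjcB; ring.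
  have e1 : normc (1 - a^*%C * a) <= 2 * dyad m.
    rewrite [_ * a]mulrC -normc_sqr na -(rmorph1 (real_complex R)) -(rmorphB (real_complex R)) normc_real ger0_norm.
      by rewrite expr2; have := mulr_ge0 (ltW d0) (ltW d0); lra.
    rewrite subr_ge0 exprn_ile1// ?subr_ge0 ?dyad_le1//; lra.
  have e2 : normc (a^*%C * (phi z - a)) <= cc * dyad m.
    rewrite normcM normcJ (le_trans _ zc)// ler_piMl ?normc_ge0// na; lra.
  have e3 : normc ((zeta - a)^*%C * phi z) <= dyad m / 8.
    rewrite normcM normcJ (le_trans _ (square_small pm))// ler_piMr ?normc_ge0// ltW// phi1//.
  have := normcB (1 - a^*%C * a - a^*%C * (phi z - a)) ((zeta - a)^*%C * phi z).
  have := normcB (1 - a^*%C * a) (a^*%C * (phi z - a)).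
  lra.
have dts : dyad m `^ (t - s) * dyad m `^ s = dyad m `^ t.
  by rewrite -powRDp// subrK.
apply: (@le_trans _ _ (lower_const * dyad m `^ (t - s) * (x * c3d))).
  by rewrite ler_wpM2l// mulr_ge0 ?powR_ge0// ltW.
rewrite /c3d powRM ?(ltW c3) ?(ltW d0)//.
rewrite (_ : _ * _ = lower_const * (3 + cc) `^ s * x * (dyad m `^ (t - s) * dyad m `^ s)); last by ring.
rewrite dts /lower_const invfM.
rewrite (_ : _ * x * _ = x * (((3 + cc) `^ s)^-1 * (3 + cc) `^ s) * ((4 `^ `|t|)^-1 * dyad m `^ t)); last by ring.
rewrite mulVf ?gt_eqF ?powR_gt0// mulr1 ler_wpM2l//.
by rewrite ler_pdivrMl ?powR_gt0.
Qed.

(** The disjoint squares have area d_m^2 / 64, and 2 + (t - s) = - b turns the lower bound on each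
    square into the weight d_m^-b of the double series. *)
Lemma integral_cell_summable :
  (\int[mu2]_(p in disk) H p < +oo)%E -> cell_summable W phi b.
Proof.
move=> Hfin.
pose c m j := lower_const * dyad m `^ (t - s) * cell_sup W phi m j.
have c0 m j : 0 <= c m j.
  by rewrite !mulr_ge0 ?powR_ge0 ?(ltW lower_const_gt0)// csup0.
have H0 : (0 <= \int[mu2]_(p in disk) H p)%E by apply: integral_ge0 => p; exact: H_ge0.
have HE : (\int[mu2]_(p in disk) H p)%E \is a fin_num by rewrite ge0_fin_numE.
pose I := fine (\int[mu2]_(p in disk) H p)%E.
exists (64 * I / lower_const) => n.
have : (\int[mu2]_p (\sum_(m < n) \sum_(j < 2 ^ m) c m j * \1_(square (lattice m j) (small m)) p)%:E
   <= \int[mu2]_(p in disk) H p)%E.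
  rewrite [leRHS]integral_mkcond; apply: le_integral_nonneg => p _.
    by rewrite lee_fin sumr_ge0// => m _; rewrite sumr_ge0// => j _; rewrite mulr_ge0.
  have Hp0 : (0 <= (H \_ disk) p)%E.
    by rewrite /patch; case: ifPn => //; rewrite inE => /H_ge0.
  have [[m [j [mn jm pm]]]|N] := pselect (exists m j, [/\ (m < n)%N, (j < 2 ^ m)%N & square (lattice m j) (small m) p]).
    have -> : \sum_(m < n) \sum_(j < 2 ^ m) c m j * \1_(square (lattice m j) (small m)) p = c m j.
      rewrite (bigD1 (Ordinal mn))//= (bigD1 (Ordinal jm))//= indicE mem_set// mulr1.
      rewrite big1 ?addr0 => [|i ij]; last first.
        rewrite indicE memNset ?mulr0// => ip; move/eqP: ij; apply; apply/val_inj.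
        by have [] := squares_disjoint (ltn_ord i) jm ip pm.
      rewrite big1 ?addr0// => i im; rewrite big1// => l _.
      rewrite indicE memNset ?mulr0// => ip; move/eqP: im; apply; apply/val_inj.
      by have [] := squares_disjoint (ltn_ord l) jm ip pm.
    by rewrite patchE mem_set; [exact: H_lower|exact: square_disk pm].
  rewrite big1// => m _; rewrite big1// => j _; rewrite indicE memNset ?mulr0// => pm.
  by apply: N; exists m, j.
rewrite integral_squares//; last by move=> m; exact: ltW.
rewrite -[leRHS]fineK// lee_fin -/I => h.
rewrite ler_pdivlMr// mulrC -ler_pdivrMl// mulrA mulr_sumr; apply: le_trans h.
apply: ler_sum => m _; rewrite /c -!mulr_sumr.
rewrite [leRHS](_ : _ = 64^-1 * lower_const * (dyad m ^+ 2 * dyad m `^ (t - s) * \sum_(j < 2 ^ m) cell_sup W phi m j)); last first.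
  by rewrite /small; field.
rewrite ler_wpM2l ?mulr_ge0 ?(ltW lower_const_gt0)// ler_wpM2r//.
  by apply: sumr_ge0 => j _; exact: csup0.
rewrite -powR_mulrn ?(ltW (dyad_gt0 m))// -powRDp ?dyad_gt0//.
by rewrite /t (_ : 2 + (s - 2 - b - s) = - b)//; ring.
Qed.

Let cker_sym zeta w : cker s zeta w = cker s w zeta.
Proof.
by rewrite /cker -[normc (1 - zeta^*%C * w)]normcJ conjcB conjcM conjcK conjc1 mulrC.
Qed.

(** Squares of half side [cover_const] d_m around the lattice points cover the disk. On such a
    square, by symmetry of |1 - conj(zeta) w|, the point zeta itself can be moved to the lattice
    point, so that the integrand is bounded by the majorant there; the areas supply the factor
    d_m^2. The integrand is compared with a sum of indicators, so its measurability is not at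
    issue. *)
Lemma cell_summable_integral : cell_summable W phi b ->
  (\int[mu2]_(p in disk) H p < +oo)%E.
Proof.
move=> cs; have [G [G0 GP [C CP]]] := majorant W0 WB phi1 s2 b0 a0 cs.
have c12 : 0 < 1 + 2 * cc by have := cc1; lra.
pose k := (1 + 2 * cc) `^ s * 2 `^ `|t|.
have k0 : 0 <= k by rewrite mulr_ge0 ?powR_ge0.
pose c m j := k * dyad m `^ t * G (lattice m j).
have c0 m j : 0 <= c m j by rewrite !mulr_ge0 ?powR_ge0// G0// normc_node_lt1.
pose r m : R := cc * dyad m.
have r0 m : 0 <= r m by rewrite mulr_ge0 ?(le_trans _ cc1)// ltW// dyad_gt0.
pose f m p : \bar R := (\sum_(j < 2 ^ m) c m j * \1_(square (lattice m j) (r m)) p)%:E.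
have mf m : measurable_fun setT (f m).
  apply/measurable_EFinP; apply: measurable_sum => j; apply: measurable_funM => //.
  exact: measurable_indic (measurable_square _ _).
have f0 m p : (0 <= f m p)%E by rewrite lee_fin sumr_ge0// => j _; rewrite mulr_ge0.
have Hf p : disk p -> (H p <= \sum_(m <oo) f m p)%E.
  move=> Dp; set zeta := (p.1 +i* p.2)%C; have z1 : normc zeta < 1 by [].
  have [m [j [jm h1 h2 h3]]] := lattice_cover z1.
  have l1 : normc (@lattice R m j) < 1 := normc_node_lt1 m _ j.
  have d0 := @dyad_gt0 R m; have n0 := normc_ge0 zeta.
  have w0 : 0 < 1 - normc zeta ^+ 2 by rewrite subr_gt0 expr2 mulr_ilt1.
  have e : 1 - normc zeta ^+ 2 = (1 - normc zeta) * (1 + normc zeta) by ring.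
  have e1 : 1 - normc zeta <= 1 - normc zeta ^+ 2.
    by rewrite e ler_peMr ?subr_ge0 ?(ltW z1)// lerDl.
  have e2 : 1 - normc zeta ^+ 2 <= 2 * (1 - normc zeta).
    by rewrite e mulrC ler_wpM2r ?subr_ge0 ?(ltW z1)//; lra.
  have wt : (1 - normc zeta ^+ 2) `^ t <= 2 `^ `|t| * dyad m `^ t.
    apply: powR_comparable => //; lra.
  have Kz : (K zeta <= ((1 + 2 * cc) `^ s * G (lattice m j))%:E)%E.
    apply: K_upper => // z zz1.
    rewrite (le_trans _ (ler_wpM2l (powR_ge0 _ _) (GP _ _ l1 zz1)))// mulrCA.
    rewrite ler_wpM2l ?W0// cker_sym (cker_sym (lattice m j)).
    by apply: (@cker_shift _ _ _ _ _ (dyad m)) => //; exact: phi1.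
  have fm : (H p <= f m p)%E.
    apply: (@le_trans _ _ (((1 + 2 * cc) `^ s * G (lattice m j)) * (2 `^ `|t| * dyad m `^ t))%:E).
      by rewrite EFinM lee_pmul ?K_ge0 ?lee_fin ?powR_ge0.
    rewrite lee_fin (bigD1 (Ordinal jm))//= indicE mem_set; last exact: dist_square.
    rewrite mulr1 (_ : _ * _ = c m j); last by rewrite /c /k; ring.
    by rewrite lerDl sumr_ge0// => i _; rewrite mulr_ge0.
  rewrite (le_trans fm)//.
  rewrite (le_trans _ (nneseries_lim_ge m.+1 _))// big_mkord big_ord_recr /=.
  by rewrite leeDr// sume_ge0.
apply: (@le_lt_trans _ _ (\int[mu2]_p (\sum_(m <oo) f m p))%E).
  rewrite integral_mkcond; apply: le_integral_nonneg => p _.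
    by rewrite /patch; case: ifPn => //; rewrite inE => /H_ge0.
  rewrite /patch; case: ifPn => [|_]; first by rewrite inE => /Hf.
  exact: nneseries_ge0.
rewrite integral_nneseries//.
apply: (@le_lt_trans _ _ (k * (2 * cc) ^+ 2 * C)%:E); last exact: ltry.
apply: lime_le; first by apply: is_cvg_nneseries => m _ _; exact: integral_ge0.
apply: nearW => n; rewrite big_mkord -ge0_integral_sum//; last by move=> m; exact: mf.
under eq_integral do rewrite sumEFin.
rewrite integral_squares// lee_fin -mulrA.
have := CP (fun m => 2 ^ m)%N n (fun m => leqnn _) => h.
have cc2 : 0 <= (2 * cc) ^+ 2 by rewrite exprn_ge0// mulr_ge0// (le_trans _ cc1).
rewrite (le_trans _ (ler_wpM2l k0 (ler_wpM2l cc2 h)))//.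
rewrite !mulr_sumr; apply: ler_sum => m _.
rewrite /c -mulr_sumr /r -/(lattice m _) -dyad_natr.
rewrite (_ : s - 1 - b = t + 1); last by rewrite /t; ring.
rewrite powRDp ?dyad_gt0// powRr1 ?(ltW (dyad_gt0 m))//.
by rewrite le_eqVlt; apply/orP; left; apply/eqP; rewrite /lattice; ring.
Qed.

End IntegralCondition.

(** * Bloch spaces and functionals *)

Section OperatorNorms.
Context {R : realType} {V : lmodType R[i]}.
Variables (E : set V) (N : V -> R).
Hypotheses (E0 : E 0) (EZ : forall a x, E x -> E (a *: x)) (ED : forall x y, E x -> E y -> E (x + y)).
Hypotheses (N0 : forall x, E x -> 0 <= N x) (NZ : forall a x, E x -> N (a *: x) = normc a * N x).
Hypothesis (ND : forall x y, E x -> E y -> N (x + y) <= N x + N y).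

Section LinearOn.
Context {W : lmodType R[i]}.
Variable T : V -> W.
Hypothesis Tlin : linear_on E T.

Lemma linear_on0 : T 0 = 0.
Proof.
have := Tlin 1 E0 E0; rewrite !scale1r addr0 => /eqP.
by rewrite -subr_eq subrr eq_sym => /eqP.
Qed.

Lemma linear_onD x y : E x -> E y -> T (x + y) = T x + T y.
Proof. by move=> Ex Ey; have := Tlin 1 Ex Ey; rewrite !scale1r. Qed.

Lemma linear_onZ a x : E x -> T (a *: x) = a *: T x.
Proof. by move=> Ex; have := Tlin a Ex E0; rewrite linear_on0 !addr0. Qed.

Lemma linear_on_sum I (s : seq I) (F : I -> V) : (forall i, E (F i)) ->
  E (\sum_(i <- s) F i) /\ T (\sum_(i <- s) F i) = \sum_(i <- s) T (F i).
Proof.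
move=> EF; elim: s => [|i s [IH1 IH2]]; first by rewrite !big_nil linear_on0.
by rewrite !big_cons linear_onD// IH2; split=> //; exact: ED.
Qed.

End LinearOn.

Lemma norm_sum_le I (s : seq I) (F : I -> V) : (forall i, E (F i)) ->
  E (\sum_(i <- s) F i) /\ N (\sum_(i <- s) F i) <= \sum_(i <- s) N (F i).
Proof.
move=> EF; elim: s => [|i s [IH1 IH2]].
  by rewrite !big_nil; split => //; have := NZ 0 E0; rewrite scale0r normc0 mul0r => ->.
rewrite !big_cons; split; first exact: ED.
by rewrite (le_trans (ND _ _))// lerD2l.
Qed.

Variable l : V -> R[i].
Hypothesis ldual : continuous_dual E N l.

Let dual_set := [set normc (l x) | x in [set x | E x /\ N x <= 1]].

Let dual_set_ub : has_ubound dual_set.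
Proof.
have [_ [C CP]] := ldual; exists `|C| => _ [x [Ex Nx] <-].
rewrite (le_trans (CP x Ex))// (@le_trans _ _ (`|C| * N x))//.
  by rewrite ler_wpM2r ?N0// ler_norm.
by rewrite ler_piMr.
Qed.

Lemma dual_norm_ge0 : 0 <= dual_norm E N l.
Proof.
rewrite (le_trans (normc_ge0 (l 0)))//; apply: ub_le_sup => //.
by exists 0 => //; split => //; have := NZ 0 E0; rewrite scale0r normc0 mul0r => ->.
Qed.

Lemma dual_norm_bound x : E x -> normc (l x) <= dual_norm E N l * N x.
Proof.
move=> Ex; have [[_ llin] [C CP]] := ldual.
have [Nx0|Nx] := eqVneq (N x) 0.
  by rewrite (le_trans (CP x Ex))// Nx0 !mulr0.
have Nx1 : 0 < N x by rewrite lt_neqAle eq_sym Nx N0.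
rewrite -ler_pdivrMr//; apply: ub_le_sup => //.
exists ((N x)^-1%:C *: x); first split; first exact: EZ.
  by rewrite NZ// normc_real ger0_norm ?invr_ge0 ?N0// mulVf.
by rewrite linear_onZ// -[_ *: _]/(_ * _) normc_realM ger0_norm ?invr_ge0 ?N0// mulrC.
Qed.

Lemma dual_norm_le (C : R) : (forall x, E x -> N x <= 1 -> normc (l x) <= C) ->
  dual_norm E N l <= C.
Proof.
move=> H; apply: sup_le_ub => [|_ [x [Ex Nx] <-]]; last exact: H.
exists (normc (l 0)), 0 => //; split => //.
by have := NZ 0 E0; rewrite scale0r normc0 mul0r => ->.
Qed.

End OperatorNorms.

Section BlochBasics.
Context {R : realType}.
Implicit Types (f h : R[i] -> R[i]) (z w : R[i]) (beta : R).

Lemma holomorphic_hol f : holomorphic_disk f -> hol f.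
Proof. by move=> [H _] z z1; exists (derive1 f z); apply/cdiffP; split => //; exact: H. Qed.

Lemma hol_holomorphic f : hol f -> (forall z, ~ normc z < 1 -> f z = 0) -> holomorphic_disk f.
Proof. by move=> H f0; split => // z /H[l /cdiffP[]]. Qed.

Lemma holomorphic_cdiff f z : holomorphic_disk f -> normc z < 1 -> cdiff f z (derive1 f z).
Proof. by move=> /holomorphic_hol; exact: hol_derive1. Qed.

Lemma cdiff_disk_ext f h z l : (forall w, normc w < 1 -> f w = h w) -> normc z < 1 ->
  cdiff f z l -> cdiff h z l.
Proof.
move=> fh z1; apply: (@cdiff_ext _ _ _ _ _ (1 - normc z)); first by rewrite subr_gt0.
move=> w wz; apply: fh.
by rewrite -(subrK z w) (le_lt_trans (normcD _ _))// -ltrBrDr.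
Qed.

Lemma holomorphic_disk_comb (a : R[i]) f h : holomorphic_disk f -> holomorphic_disk h ->
  holomorphic_disk (a *: f + h) /\
  forall z, normc z < 1 -> derive1 (a *: f + h) z = a * derive1 f z + derive1 h z.
Proof.
move=> Hf Hh.
have D z : normc z < 1 -> cdiff (a *: f + h) z (a * derive1 f z + derive1 h z).
  move=> z1; apply: cdiff_ext ltr01 _ (cdiffD (cdiffZ a (holomorphic_cdiff Hf z1)) (holomorphic_cdiff Hh z1)).
  by [].
split; last by move=> z /D /cdiff_derive1.
apply: hol_holomorphic => [z z1|z z1]; first by eexists; exact: D.
rewrite -[LHS]/(a * f z + h z).
by have [_ -> //] := Hf; have [_ -> //] := Hh; rewrite mulr0 addr0.
Qed.

Lemma disk_weight_le1 beta z : 0 < beta -> normc z < 1 -> (1 - normc z ^+ 2) `^ beta <= 1.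
Proof.
move=> b0 z1; rewrite -[leRHS](_ : 1 `^ beta = 1); last by rewrite powR1.
apply: powR_le; rewrite ?(ltW b0)//.
  by rewrite subr_ge0 exprn_ile1 ?normc_ge0// ltW.
by rewrite gerBl exprn_ge0 ?normc_ge0.
Qed.

Lemma unit_disk_nonempty : normc (0 : R[i]) < 1.
Proof. by rewrite normc0 ltr01. Qed.

Lemma bloch_weight_ge0 beta f z : 0 <= bloch_weight beta f z.
Proof. by rewrite mulr_ge0 ?powR_ge0 ?normc_ge0. Qed.

Lemma bloch_weight_le_norm beta f z : bloch beta f -> normc z < 1 ->
  bloch_weight beta f z <= bloch_norm beta f.
Proof.
move=> [_ ub] z1; rewrite /bloch_norm (@le_trans _ _ (sup [set bloch_weight beta f z | z in unit_disk]))//.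
  by apply: ub_le_sup => //; exists z.
by rewrite lerDr normc_ge0.
Qed.

Lemma normc0_le_bloch_norm beta f : bloch beta f -> normc (f 0) <= bloch_norm beta f.
Proof.
move=> [_ ub]; rewrite lerDl (le_trans (bloch_weight_ge0 beta f 0))//.
by apply: ub_le_sup => //; exists 0 => //; exact: unit_disk_nonempty.
Qed.

Lemma bloch_norm_ge0 beta f : bloch beta f -> 0 <= bloch_norm beta f.
Proof. by move=> /normc0_le_bloch_norm; apply: le_trans; exact: normc_ge0. Qed.

Lemma bloch_norm_le beta f (A B : R) : normc (f 0) <= A ->
  (forall z, normc z < 1 -> bloch_weight beta f z <= B) -> bloch_norm beta f <= A + B.
Proof.
move=> fA fB; rewrite lerD//; apply: sup_le_ub => [|_ [z z1 <-]]; last exact: fB.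
by exists (bloch_weight beta f 0), 0 => //; exact: unit_disk_nonempty.
Qed.

Lemma bloch_sup_ub beta f z : bloch beta f -> normc z < 1 ->
  bloch_weight beta f z <= bloch_norm beta f - normc (f 0).
Proof.
by move=> [_ ub] z1; rewrite /bloch_norm addrAC subrr add0r; apply: ub_le_sup => //; exists z.
Qed.

Lemma bloch_comb beta (a : R[i]) f h : bloch beta f -> bloch beta h ->
  bloch beta (a *: f + h) /\
  bloch_norm beta (a *: f + h) <= normc a * bloch_norm beta f + bloch_norm beta h.
Proof.
move=> bf bh; have [hc dc] := holomorphic_disk_comb a bf.1 bh.1.
have H z : normc z < 1 -> bloch_weight beta (a *: f + h) z <=
    normc a * (bloch_norm beta f - normc (f 0)) + (bloch_norm beta h - normc (h 0)).
  move=> z1; rewrite /bloch_weight dc//.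
  rewrite (le_trans (ler_wpM2l (powR_ge0 _ _) (normcD _ _)))// mulrDr lerD//; last exact: bloch_sup_ub.
  by rewrite normcM mulrCA ler_wpM2l ?normc_ge0//; exact: bloch_sup_ub.
split.
  by split => //; eexists => _ [z z1 <-]; exact: H.
have key (p q r x y : R) : p * q + r = (p * x + y) + (p * (q - x) + (r - y)) by ring.
rewrite (key _ _ _ (normc (f 0)) (normc (h 0))).
apply: bloch_norm_le => //.
by rewrite -[(a *: f + h) 0]/(a * f 0 + h 0) (le_trans (normcD _ _))// normcM.
Qed.

Lemma holomorphic_disk0 : holomorphic_disk (0 : R[i] -> R[i]).
Proof.
by apply: hol_holomorphic => // z _; exists 0; exact: cdiff_cst.
Qed.

Lemma derive1_zero z : derive1 (0 : R[i] -> R[i]) z = 0.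
Proof. exact: cdiff_derive1 (cdiff_cst 0 z). Qed.

Lemma bloch0 beta : bloch beta (0 : R[i] -> R[i]).
Proof.
split; first exact: holomorphic_disk0.
by exists 0 => _ [z _ <-]; rewrite /bloch_weight derive1_zero normc0 mulr0.
Qed.

Lemma bloch_norm0 beta : bloch_norm beta (0 : R[i] -> R[i]) = 0.
Proof.
apply/eqP; rewrite eq_le bloch_norm_ge0 ?andbT; last exact: bloch0.
rewrite -[leRHS]addr0; apply: bloch_norm_le; first by rewrite normc0.
by move=> z _; rewrite /bloch_weight derive1_zero normc0 mulr0.
Qed.

Lemma blochD beta f h : bloch beta f -> bloch beta h -> bloch beta (f + h).
Proof. by move=> bf bh; have [] := bloch_comb 1 bf bh; rewrite scale1r. Qed.

Lemma blochZ beta a f : bloch beta f -> bloch beta (a *: f).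
Proof. by move=> bf; have [] := bloch_comb a bf (bloch0 beta); rewrite addr0. Qed.

Lemma bloch_normD beta f h : bloch beta f -> bloch beta h ->
  bloch_norm beta (f + h) <= bloch_norm beta f + bloch_norm beta h.
Proof. by move=> bf bh; have [_] := bloch_comb 1 bf bh; rewrite scale1r normc1 mul1r. Qed.

(** The upper bound applied to a^-1 gives the lower bound. *)
Lemma bloch_normZ beta a f : bloch beta f ->
  bloch_norm beta (a *: f) = normc a * bloch_norm beta f.
Proof.
move=> bf.
have le b h : bloch beta h -> bloch_norm beta (b *: h) <= normc b * bloch_norm beta h.
  by move=> bh; have [_] := bloch_comb b bh (bloch0 beta); rewrite addr0 bloch_norm0 addr0.
have [->|a0] := eqVneq a 0; first by rewrite scale0r normc0 mul0r bloch_norm0.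
apply/eqP; rewrite eq_le le//=; have na : 0 < normc a by rewrite normc_gt0.
rewrite -ler_pdivlMl//; have := le a^-1 _ (blochZ a bf).
by rewrite scalerA mulVf// scale1r normcV.
Qed.

Lemma bloch_norm_diff beta f h : bloch beta f -> bloch beta h ->
  bloch_norm beta f <= bloch_norm beta (f - h) + bloch_norm beta h.
Proof.
move=> bf bh; have bd : bloch beta (f - h).
  by rewrite -scaleN1r; exact: blochD bf (blochZ (-1) bh).
by have := bloch_normD bd bh; rewrite subrK.
Qed.

(** The primitive that vanishes at 0, extended by zero outside the disk as [holomorphic_disk]
    requires. *)
Definition prim (H : R[i] -> R[i]) : R[i] -> R[i] :=
  patch (fun=> 0) unit_disk (fun z => cint 0 1 (fun t => H (t%:C * z) * z)).

Lemma prim_cdiff H z : hol H -> normc z < 1 -> cdiff (prim H) z (H z).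
Proof.
move=> hH z1; apply: cdiff_disk_ext z1 (primitive_cdiff hH z1) => w w1.
by rewrite /prim patchE mem_set.
Qed.

Lemma prim_derive1 H z : hol H -> normc z < 1 -> derive1 (prim H) z = H z.
Proof. by move=> hH z1; exact: cdiff_derive1 (prim_cdiff hH z1). Qed.

Lemma prim_holomorphic H : hol H -> holomorphic_disk (prim H).
Proof.
move=> hH; apply: hol_holomorphic => [z z1|z z1]; first by exists (H z); exact: prim_cdiff.
by rewrite /prim patchE memNset.
Qed.

Lemma prim_at0 H : prim H 0 = 0.
Proof.
rewrite /prim patchE mem_set; last exact: unit_disk_nonempty.
rewrite (@eq_cint _ _ _ _ (fun=> 0)); last by move=> t _; rewrite mulr0.
by rewrite cint_cst// mulr0.
Qed.

Lemma volterraE g phi f : volterra g phi f = prim (fun z => derive1 f (phi z) * g z).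
Proof. by []. Qed.

Lemma hol_comp h phi : hol h -> hol phi -> (forall z, normc z < 1 -> normc (phi z) < 1) ->
  hol (fun z => h (phi z)).
Proof.
move=> hh hphi phi1 z z1; have [l pl] := hphi z z1; have [m hm] := hh _ (phi1 z z1).
by exists (m * l); exact: cdiff_comp pl hm.
Qed.

Lemma holM h f : hol h -> hol f -> hol (fun z => h z * f z).
Proof. by move=> hh hf z z1; have [l hl] := hh z z1; have [m fm] := hf z z1; eexists; exact: cdiffM hl fm. Qed.

Lemma hol_ck (a : R[i]) : normc a <= 1 -> hol (fun w => ck (a * w)).
Proof.
move=> a1 z z1; eexists; apply: (cdiff_comp (f := fun w => a * w)).
  by apply: cdiffZ; exact: cdiff_id.
by apply: ck_cdiff; rewrite normcM (le_lt_trans _ z1)// ler_piMl ?normc_ge0.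
Qed.

Lemma holX h n : hol h -> hol (fun z => h z ^+ n).
Proof.
move=> hh; elim: n => [|n IH]; first by move=> z _; exists 0; exact: cdiff_cst.
by move=> z z1; have [l hl] := holM hh IH z1; exists l; apply: cdiff_ext ltr01 _ hl => w _; rewrite exprS.
Qed.

Lemma holZ (a : R[i]) h : hol h -> hol (fun z => a * h z).
Proof. by move=> hh z z1; have [l hl] := hh z z1; eexists; exact: cdiffZ hl. Qed.

Lemma tame_bloch beta f (B : R) : 0 < beta -> holomorphic_disk f ->
  (forall z, normc z < 1 -> normc (derive1 f z) <= B) -> bloch beta f.
Proof.
move=> b0 hf fB; split => //; exists B => _ [z z1 <-].
rewrite /bloch_weight (le_trans _ (fB z z1))// ler_piMl ?normc_ge0//.
exact: disk_weight_le1.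
Qed.

(** A bounded derivative is multiplied by a weight that tends to 0. This is how the test functions
    are seen to lie in the smaller space. *)
Lemma tame_little_bloch beta f (B : R) : 0 < beta -> holomorphic_disk f ->
  (forall z, normc z < 1 -> normc (derive1 f z) <= B) -> little_bloch beta f.
Proof.
move=> b0 hf fB; split => // e e0.
have B1 : 0 < `|B| + 1 by rewrite ltr_pwDr.
have eB : 0 < e / (`|B| + 1) by rewrite divr_gt0.
(* Chosen so that (2 d)^beta (|B| + 1) = e; the factor 2 accounts for 1 - r^2 <= 2 (1 - r). *)
pose d := (e / (`|B| + 1)) `^ beta^-1 / 2.
have d0 : 0 < d by rewrite divr_gt0// powR_gt0.
near=> r => z zr.
have r1 : r < 1 by near: r; exact: nbhs_left_lt.
have r0 : 0 < r by near: r; apply: nbhs_left_gt.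
have rd : 1 - d < r by near: r; apply: nbhs_left_gt; rewrite ltrBlDr ltrDl.
have z1 : normc z < 1 by rewrite zr.
rewrite /bloch_weight (@le_lt_trans _ _ ((1 - normc z ^+ 2) `^ beta * `|B|))//.
  by rewrite ler_wpM2l ?powR_ge0// (le_trans (fB z z1))// ler_norm.
rewrite (@le_lt_trans _ _ ((2 * d) `^ beta * `|B|))//.
  rewrite ler_wpM2r//; apply: powR_le; rewrite ?(ltW b0)//.
    by rewrite subr_ge0 exprn_ile1 ?normc_ge0// ltW.
  rewrite zr; have e1 : 1 - r ^+ 2 = (1 - r) * (1 + r) by ring.
  by rewrite e1 mulrC ler_pM ?subr_ge0 ?addr_ge0 ?(ltW r1) ?(ltW r0)//; lra.
have -> : 2 * d = (e / (`|B| + 1)) `^ beta^-1 by rewrite /d mulrCA divff// mulr1.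
rewrite -powRrM mulVf ?gt_eqF// powRr1 ?(ltW eB)//.
by rewrite mulrAC ltr_pdivrMr// ltr_pM2l// ltrDl.
Unshelve. all: by end_near. Qed.

(** In an outer annulus the weighted derivative is below 1; on the remaining disk [circle_bound]
    controls f' by its values on a circle of that annulus. *)
Lemma little_bloch_bloch beta f : 0 < beta -> little_bloch beta f -> bloch beta f.
Proof.
move=> b0 [hf H]; split => //.
have hh := hol_derive1_hol (holomorphic_hol hf).
have [r0 r00 r01] : exists2 r0 : R, r0 < 1 & forall r, r0 < r -> r < 1 ->
    forall z, normc z = r -> bloch_weight beta f z < 1.
  have [d /= d0 dP] := H 1 ltr01; exists (1 - d); first by rewrite ltrBlDr ltrDl.
  move=> r rd r1; apply: dP => //=.
  by rewrite ger0_norm ?subr_ge0 ?(ltW r1)// ltrBlDr addrC -ltrBlDr.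
pose r1 := Num.max r0 0; have r1lt : r1 < 1 by rewrite /r1 gt_max r00 ltr01.
have r1ge : 0 <= r1 by rewrite /r1 le_max lexx orbT.
pose r := (1 + r1) / 2; have rr1 : r1 < r by rewrite /r; lra.
have rlt : r < 1 by rewrite /r; lra.
have rgt : 0 < r := le_lt_trans r1ge rr1.
have r0r : r0 < r by rewrite (le_lt_trans _ rr1)// /r1 le_max lexx.
have w0 : 0 < (1 - r ^+ 2) `^ beta.
  by rewrite powR_gt0// subr_gt0 expr2 mulr_ilt1 ?(ltW rgt).
have hB t : normc (derive1 f (r%:C * cexp t)) <= ((1 - r ^+ 2) `^ beta)^-1.
  have nr : normc (r%:C * cexp t) = r by rewrite normc_realM normc_cexp mulr1 gtr0_norm.
  have := r01 r r0r rlt _ nr; rewrite /bloch_weight nr => h.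
  by rewrite -[leRHS]mul1r ler_pdivlMr// mulrC ltW.
have q1 : r1 / r < 1 by rewrite ltr_pdivrMr// mul1r.
pose B := 2 * (((1 - r ^+ 2) `^ beta)^-1 / (1 - r1 / r)).
exists (Num.max 1 B) => _ [z z1 <-]; rewrite le_max.
have [zr|rz] := leP (normc z) r1; last first.
  rewrite (ltW (r01 _ _ _ _ (erefl (normc z))))//.
  by rewrite (le_lt_trans _ rz)// /r1 le_max lexx.
apply/orP; right.
have zE : z = r%:C * (z / r%:C).
  by rewrite mulrC divfK// -normc_gt0 normc_real normr_gt0 gt_eqF.
have zq : normc (z / r%:C) <= r1 / r.
  by rewrite normcM normcV normc_real gtr0_norm// ler_pM2r ?invr_gt0.
have := circle_bound hh rgt rlt q1 hB zq; rewrite -zE => h.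
rewrite /bloch_weight (le_trans _ h)// ler_piMl ?normc_ge0//.
exact: disk_weight_le1.
Unshelve. all: by end_near. Qed.

End BlochBasics.

(** * Nuclearity implies summability over the lattice *)

Section NuclearImpliesSummable.
Context {R : realType}.
Variables (beta gamma : R) (g phi : R[i] -> R[i]).
Hypotheses (hbeta : 1 < beta) (hgamma : 0 < gamma).
Hypotheses (hg : holomorphic_disk g) (hphi : holomorphic_disk phi).
Hypothesis hphiD : forall z, normc z < 1 -> normc (phi z) < 1.
Hypothesis hS : bounded_operator (bloch beta) (bloch_norm beta)
            (bloch gamma) (bloch_norm gamma) (volterra g phi).

Let T := volterra g phi.
Let b0 : 0 < beta. Proof. exact: lt_trans ltr01 hbeta. Qed.

Definition weight_symbol (z : R[i]) : R := (1 - normc z ^+ 2) `^ gamma * normc (g z).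

Local Notation W := weight_symbol.

Lemma weight_symbol_ge0 z : 0 <= W z.
Proof. by rewrite mulr_ge0 ?powR_ge0 ?normc_ge0. Qed.

Lemma volterra_derive1 f z : holomorphic_disk f -> normc z < 1 ->
  derive1 (T f) z = derive1 f (phi z) * g z.
Proof.
move=> hf z1; rewrite /T volterraE prim_derive1//.
apply: holM; last exact: holomorphic_hol.
apply: hol_comp => //; last exact: holomorphic_hol.
exact/hol_derive1_hol/holomorphic_hol.
Qed.

Lemma volterra_weight f z : holomorphic_disk f -> normc z < 1 ->
  bloch_weight gamma (T f) z = W z * normc (derive1 f (phi z)).
Proof.
by move=> hf z1; rewrite /bloch_weight volterra_derive1// normcM [normc _ * _]mulrC mulrA.
Qed.

(** Boundedness of the operator is tested on the identity function [prim (fun=> 1)], whose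
    derivative is 1. *)
Lemma weight_symbol_bounded : exists B : R, forall z, normc z < 1 -> W z <= B.
Proof.
have h1 : hol (fun=> 1 : R[i]) by move=> z _; exists 0; exact: cdiff_cst.
have hi := prim_holomorphic h1.
have bi : bloch beta (prim (fun=> 1)).
  by apply: (@tame_bloch _ _ _ 1) => // z z1; rewrite prim_derive1// normc1.
have [[TE _] _] := hS; exists (bloch_norm gamma (T (prim (fun=> 1)))) => z z1.
have := bloch_weight_le_norm (TE _ bi) z1.
by rewrite volterra_weight// prim_derive1 ?hphiD// normc1 mulr1.
Qed.

Variable E : set (R[i] -> R[i]).
Hypotheses (E_bloch : forall f, E f -> bloch beta f)
  (E0 : E 0) (EZ : forall a x, E x -> E (a *: x)) (ED : forall x y, E x -> E y -> E (x + y)).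
Hypothesis E_tame : forall f (B : R), holomorphic_disk f ->
  (forall z, normc z < 1 -> normc (derive1 f z) <= B) -> E f.

Section TestFunctions.
Variable M : nat.
Hypotheses (M2 : (2 <= M)%N) (Mb : beta + 1 < M%:R).

Let coef m : R := dyad m `^ (M%:R - beta).

Definition test_function (p : nat * nat) : R[i] -> R[i] :=
  prim (fun w => (coef p.1)%:C * ck ((lattice p.1 p.2)^*%C * w) ^+ M).

Let test_hol p : hol (fun w => (coef p.1)%:C * ck ((@lattice R p.1 p.2)^*%C * w) ^+ M).
Proof.
apply: holZ; apply: holX; apply: hol_ck; rewrite normcJ; exact/ltW/normc_node_lt1.
Qed.

Let test_derive1 p w : normc w < 1 ->
  derive1 (test_function p) w = (coef p.1)%:C * ck ((lattice p.1 p.2)^*%C * w) ^+ M.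
Proof. by move=> w1; rewrite prim_derive1. Qed.

Let coef_ge0 m : 0 <= coef m. Proof. exact: powR_ge0. Qed.

Let test_normc p w : normc w < 1 ->
  normc (derive1 (test_function p) w) = coef p.1 * cker M%:R (lattice p.1 p.2) w.
Proof.
move=> w1; rewrite test_derive1// normc_realM ger0_norm ?coef_ge0//; congr (_ * _).
by rewrite /cker powR_mulrn ?normc_ge0// normcX /ck normcV exprVn.
Qed.

Let test_holomorphic p : holomorphic_disk (test_function p).
Proof. exact: prim_holomorphic. Qed.

Let test_E p : E (test_function p).
Proof.
apply: (E_tame (B := coef p.1 * (1 - radius p.1)^-1 ^+ M)) => // z z1.
rewrite test_derive1// normc_realM ger0_norm ?coef_ge0// ler_wpM2l ?coef_ge0//.
rewrite normcX lerXn2r ?nnegrE ?normc_ge0 ?invr_ge0 ?subr_ge0 ?(ltW (radius_lt1 _))//.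
apply: ck_bound; last exact: radius_lt1.
by rewrite normcM normcJ normc_node ler_piMr ?radius_ge0// ltW.
Qed.

Let box n := [seq (m, j) | m <- index_iota 0 n, j <- index_iota 0 (2 ^ m)].

Let box_sum (Z : nmodType) (F : nat -> nat -> Z) n :
  \sum_(p <- box n) F p.1 p.2 = \sum_(m < n) \sum_(j < 2 ^ m) F m j.
Proof.
rewrite /box (big_allpairs_dep (op := +%R)) /= big_mkord; apply: eq_bigr => m _.
by rewrite big_mkord.
Qed.

(** The coefficient d_m^(M - beta) is d_m^(M - 1 - beta) times the weight 2^-m of an average over
    the lattice points of level m, so [lattice_sum] with s = M bounds the sum of the moduli of the
    derivatives, whatever the phases. *)
Let comb_bound : exists2 C : R, 0 < C & forall (u : nat * nat -> R[i]) n,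
  (forall p, normc (u p) <= 1) ->
  E (\sum_(p <- box n) u p *: test_function p) /\
  bloch_norm beta (\sum_(p <- box n) u p *: test_function p) <= C.
Proof.
have M2' : 2 <= M%:R :> R by rewrite ler_nat.
have Mb' : 0 < M%:R - 1 - beta by move: Mb; lra.
have [C C0 CP] := lattice_sum M2' b0 Mb'.
exists (2 `^ beta * C); first by rewrite mulr_gt0// powR_gt0.
move=> u n u1; set F := \sum_(p <- box n) _.
have F0 : F 0 = 0.
  rewrite /F fct_sumE big1// => p _.
  by rewrite -[LHS]/(u p * test_function p 0) /test_function prim_at0 mulr0.
have FD w : normc w < 1 -> cdiff F w (\sum_(p <- box n) u p * derive1 (test_function p) w).
  move=> w1.
  have := @cdiff_sum R _ (box n) (fun p w => u p * test_function p w) (fun p => u p * derive1 (test_function p) w) w.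
  move=> /(_ (fun p => cdiffZ (u p) (holomorphic_cdiff (test_holomorphic p) w1))).
  apply: cdiff_ext ltr01 _ => v _; rewrite /F fct_sumE; exact: eq_bigr.
have EF : E F.
  have EF' (p : nat * nat) : E (u p *: test_function p) by apply: EZ; exact: test_E.
  rewrite /F; elim: (box n) => [|p s IH]; first by rewrite big_nil.
  by rewrite big_cons; apply: ED.
split => //; rewrite -[leRHS]add0r; apply: bloch_norm_le; first by rewrite F0 normc0.
move=> w w1; rewrite /bloch_weight (cdiff_derive1 (FD w w1)).
have w0 : 0 < 1 - normc w by rewrite subr_gt0.
have Fb : normc (\sum_(p <- box n) u p * derive1 (test_function p) w) <= C * (1 - normc w) `^ (- beta).
  rewrite (le_trans (normc_sum _ _ _))//.
  apply: le_trans (CP w (fun m => 2 ^ m)%N n w1 (fun m => leqnn _)).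
  apply: (@le_trans _ _ (\sum_(p <- box n) coef p.1 * cker M%:R (lattice p.1 p.2) w)).
    apply: ler_sum => p _; rewrite normcM -test_normc//.
    by rewrite ler_piMl ?normc_ge0.
  rewrite (box_sum (fun m j => coef m * cker M%:R (lattice m j) w)).
  apply: ler_sum => m _; rewrite -mulr_sumr /coef mulrA ler_wpM2r//.
    by apply: sumr_ge0 => j _; exact: cker_ge0.
  rewrite -dyad_natr -[X in _ <= _ * X]powRr1 ?(ltW (dyad_gt0 _))// -powRDp ?dyad_gt0//.
  by rewrite (_ : M%:R - 1 - beta + 1 = M%:R - beta)//; ring.
rewrite (le_trans (ler_wpM2l (powR_ge0 _ _) Fb))//.
have wb : (1 - normc w ^+ 2) `^ beta <= 2 `^ beta * (1 - normc w) `^ beta.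
  rewrite -powRM ?(ltW w0)//; apply: powR_le; rewrite ?(ltW b0)//.
    by rewrite subr_ge0 exprn_ile1 ?normc_ge0// ltW.
  have -> : 1 - normc w ^+ 2 = (1 + normc w) * (1 - normc w) by ring.
  by rewrite ler_wpM2r ?(ltW w0)//; lra.
rewrite (le_trans (ler_wpM2r _ wb))//; first by rewrite mulr_ge0 ?(ltW C0) ?powR_ge0.
by rewrite mulrACA -powRDp// subrr powRr0 mulr1.
Qed.

(** When phi(z) is in the cell of a, |1 - conj(a) phi(z)| <= (3 + [cover_const]) d_m, so the
    derivative of the test function at phi(z) is at least a constant times d_m^-beta. *)
Let cell_le_norm m j : dyad m `^ (- beta) * cell_sup W phi m j <=
  (3 + cover_const) ^+ M * bloch_norm gamma (T (test_function (m, j))).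
Proof.
have cc1 := @cover_const_ge1 R; have c3 : 0 < 3 + @cover_const R by lra.
have d0 := @dyad_gt0 R m.
have [[TE _] _] := hS; have bT := TE _ (E_bloch (test_E (m, j))).
have db : 0 < dyad m `^ (- beta) by rewrite powR_gt0.
rewrite -ler_pdivlMl//; apply: cell_sup_le.
  by rewrite mulr_ge0 ?invr_ge0 ?(ltW db)// mulr_ge0 ?bloch_norm_ge0// exprn_ge0// ltW.
move=> z z1 zc; rewrite ler_pdivlMl//.
have phz := hphiD z1.
have := bloch_weight_le_norm bT z1; rewrite volterra_weight// test_normc//= => h.
apply: le_trans (ler_wpM2l (exprn_ge0 _ (ltW c3)) h).
rewrite mulrC mulrCA ler_wpM2l ?weight_symbol_ge0// /cker.
set a := lattice m j in zc *.
have na : normc a = 1 - dyad m by rewrite normc_node.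
have x0 : 0 < normc (1 - a^*%C * phi z) := normc_1Bconj_gt0 (normc_node_lt1 m _ j) phz.
have xb : normc (1 - a^*%C * phi z) <= (3 + cover_const) * dyad m.
  rewrite (_ : 1 - a^*%C * phi z = (1 - a^*%C * a) - a^*%C * (phi z - a)); last by ring.
  have e1 : normc (1 - a^*%C * a) <= 2 * dyad m.
    have d1 := @dyad_le1 R m.
    rewrite [_ * a]mulrC -normc_sqr na -(rmorph1 (real_complex R)) -(rmorphB (real_complex R)) normc_real ger0_norm.
      by rewrite expr2; have := mulr_ge0 (ltW d0) (ltW d0); lra.
    by rewrite subr_ge0 exprn_ile1// ?subr_ge0 ?dyad_le1//; lra.
  have e2 : normc (a^*%C * (phi z - a)) <= cover_const * dyad m.
    by rewrite normcM normcJ (le_trans _ zc)// ler_piMl ?normc_ge0// na; lra.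
  by have := normcB (1 - a^*%C * a) (a^*%C * (phi z - a)); lra.
rewrite mulrA ler_pdivlMr ?powR_gt0// powR_mulrn ?normc_ge0//.
apply: (@le_trans _ _ (dyad m `^ (- beta) * ((3 + cover_const) * dyad m) ^+ M)).
  by rewrite ler_wpM2l ?(ltW db)// lerXn2r ?nnegrE ?normc_ge0// mulr_ge0// ltW.
rewrite exprMn mulrCA ler_wpM2l ?exprn_ge0 ?(ltW c3)//.
rewrite -powR_mulrn ?(ltW d0)// -powRDp// /coef.
by rewrite addrC.
Qed.

(** On a finite box of lattice indices, the sum of the norms of the images is bounded by the sum
    over k < K of |l_k(F_p)| times the norm of y_k, plus remainders that vanish as K grows. The
    order of the two sums is exchanged, so that [comb_bound] applies to one functional at a time,
    uniformly in the box. *)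
Lemma nuclear_cell_summable_aux :
  nuclear E (bloch_norm beta) (bloch gamma) (bloch_norm gamma) T ->
  cell_summable W phi beta.
Proof.
move=> [_ [l [y [ldual yF lcvg Tcvg]]]].
have N0 f : E f -> 0 <= bloch_norm beta f by move=> /E_bloch; exact: bloch_norm_ge0.
have NZ a f : E f -> bloch_norm beta (a *: f) = normc a * bloch_norm beta f.
  by move=> /E_bloch; exact: bloch_normZ.
have dn0 k := dual_norm_ge0 E0 N0 NZ (ldual k).
have dnb k := dual_norm_bound E0 EZ N0 NZ (ldual k).
have [C C0 CP] := comb_bound.
pose a k := dual_norm E (bloch_norm beta) (l k) * bloch_norm gamma (y k).
have a0 k : 0 <= a k by rewrite mulr_ge0// bloch_norm_ge0.
pose S := limn (series a).
have aS K : \sum_(0 <= k < K) a k <= S.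
  have mono : nondecreasing_seq (series a).
    by apply/nondecreasing_seqP => k; rewrite /series /= big_nat_recr//= lerDl.
  exact: (nondecreasing_cvgn_le mono lcvg K).
pose c3 := (3 + @cover_const R) ^+ M.
have c30 : 0 <= c3 by rewrite exprn_ge0//; have := @cover_const_ge1 R; lra.
exists (c3 * (C * S)) => n.
have -> : \sum_(m < n) dyad m `^ (- beta) * \sum_(j < 2 ^ m) cell_sup W phi m j =
   \sum_(p <- box n) dyad p.1 `^ (- beta) * cell_sup W phi p.1 p.2.
  rewrite (box_sum (fun m j => dyad m `^ (- beta) * cell_sup W phi m j)).
  by apply: eq_bigr => m _; rewrite mulr_sumr.
apply: (@le_trans _ _ (c3 * \sum_(p <- box n) bloch_norm gamma (T (test_function p)))).
  by rewrite mulr_sumr; apply: ler_sum => -[m j] _; exact: cell_le_norm.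
rewrite ler_wpM2l//.
have [[TE _] _] := hS.
pose r K p := bloch_norm gamma (T (test_function p) - \sum_(0 <= k < K) l k (test_function p) *: y k).
have sum_bloch K p : bloch gamma (\sum_(0 <= k < K) l k (test_function p) *: y k) /\
  bloch_norm gamma (\sum_(0 <= k < K) l k (test_function p) *: y k) <=
    \sum_(0 <= k < K) normc (l k (test_function p)) * bloch_norm gamma (y k).
  have := @norm_sum_le R _ (bloch gamma) (bloch_norm gamma) (bloch0 gamma) (fun f h => @blochD R gamma f h)
    (fun a f => @bloch_normZ R gamma a f) (fun f h => @bloch_normD R gamma f h) _ (index_iota 0 K)
    (fun k => l k (test_function p) *: y k) (fun k => blochZ _ (yF k)).
  move=> [h1 h2]; split => //; rewrite (le_trans h2)//; apply: ler_sum => k _.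
  by rewrite (bloch_normZ (l k (test_function p)) (yF k)).
have key K : \sum_(p <- box n) bloch_norm gamma (T (test_function p)) <=
    \sum_(p <- box n) r K p + C * S.
  apply: (@le_trans _ _ (\sum_(p <- box n) (r K p +
      \sum_(0 <= k < K) normc (l k (test_function p)) * bloch_norm gamma (y k)))).
    apply: ler_sum => p _; have [h1 h2] := sum_bloch K p.
    have bT : bloch gamma (T (test_function p)) := TE _ (E_bloch (test_E p)).
    apply: (le_trans (bloch_norm_diff bT h1)).
    by apply: lerD; [exact: lexx|exact: h2].
  rewrite big_split /= lerD2l exchange_big /=.
  rewrite (le_trans _ (ler_wpM2l (ltW C0) (aS K)))// mulr_sumr; apply: ler_sum => k _.
  rewrite -mulr_suml /a mulrA ler_wpM2r ?bloch_norm_ge0//.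
  (* With these phases the functional l k adds up the |l k (F p)| without cancellation. *)
  pose u p := if l k (test_function p) == 0 then 0 else (l k (test_function p))^*%C / (normc (l k (test_function p)))%:C.
  have u1 p : normc (u p) <= 1.
    rewrite /u; case: ifPn => [_|l0]; first by rewrite normc0.
    by rewrite normcM normcV normcJ normc_real ger0_norm ?normc_ge0// divff// normc_eq0.
  have ul p : u p * l k (test_function p) = (normc (l k (test_function p)))%:C.
    rewrite /u; case: ifPn => [/eqP ->|l0]; first by rewrite normc0 mulr0.
    have n0 : (normc (l k (test_function p)))%:C != 0 :> R[i].
      by rewrite -normc_gt0 normc_real normr_gt0 normc_eq0.
    by rewrite mulrAC [_^*%C * _]mulrC -normc_sqr expr2 (rmorphM (real_complex R)) /= mulfK.
  have [EF NF] := CP u n u1.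
  have [[_ llin] _] := ldual k.
  have EuF (p : nat * nat) : E (u p *: test_function p) by apply: EZ; exact: test_E.
  have [_ lsum] := linear_on_sum E0 ED llin (box n) EuF.
  have lE : l k (\sum_(p <- box n) u p *: test_function p) =
      (\sum_(p <- box n) normc (l k (test_function p)))%:C.
    rewrite lsum (rmorph_sum (real_complex R)) /=; apply: eq_bigr => p _.
    by rewrite (linear_onZ E0 llin) //; exact: ul.
  have := dnb k _ EF; rewrite lE normc_real ger0_norm ?sumr_ge0// => [h|p _]; last exact: normc_ge0.
  by rewrite (le_trans h)// mulrC ler_wpM2r.
have r0 : \sum_(p <- box n) r K p + C * S @[K --> \oo] --> (\sum_(p <- box n) 0) + C * S.
  apply: cvgD; last exact: cvg_cst.
  apply: cvg_big => [|p _]; first exact: add_continuous.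
  exact: Tcvg (test_E p).
rewrite big1// add0r in r0.
rewrite -(cvg_lim _ r0)//; apply: limr_ge; first exact: cvgP r0.
by apply: nearW => K; exact: key.
Qed.

End TestFunctions.

(** Stated for any space E between the functions with bounded derivative and [bloch beta], hence for
    both Bloch spaces. Adding 2 to the archimedean bound ensures M >= 2. *)
Lemma nuclear_cell_summable :
  nuclear E (bloch_norm beta) (bloch gamma) (bloch_norm gamma) T ->
  cell_summable W phi beta.
Proof.
have b1 : 0 <= beta + 1 by rewrite addr_ge0// ltW.
have := archi_boundP b1; set M := Num.Def.archi_bound _ => bM.
apply: (@nuclear_cell_summable_aux M.+2) => //.
by rewrite (lt_trans bM)// ltr_nat.
Qed.

End NuclearImpliesSummable.

(** * Smoothing kernels *)

Section SmoothingKernels.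
Context {R : realType}.
Implicit Types (x s : R) (v w : R[i]) (h : R[i] -> R[i]).

(* Coefficients of prod_(j < p) (1 - x^-j s) as a polynomial in s. *)
Fixpoint qc x p i : R :=
  if p is p'.+1 then qc x p' i - x ^- p' * (if i is i'.+1 then qc x p' i' else 0)
  else (i == 0)%:R.

Lemma qc0 x p : qc x p 0 = 1.
Proof. by elim: p => [|p IH] //=; rewrite mulr0 subr0. Qed.

Lemma qc_gt x p i : (p < i)%N -> qc x p i = 0.
Proof.
elim: p i => [|p IH] [|i] //= pi; rewrite IH ?(ltnW pi)// IH// mulr0 subrr//.
Qed.

(** Multiplication of the polynomial by its next factor 1 - x^-p s, with F i in the role of s^i. *)
Lemma qc_sum (Z : lmodType R) x p (F : nat -> Z) :
  \sum_(i < p.+2) qc x p.+1 i *: F i =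
  \sum_(i < p.+1) qc x p i *: F i - x ^- p *: \sum_(i < p.+1) qc x p i *: F i.+1.
Proof.
rewrite [LHS]big_ord_recl /= mulr0 subr0 scaler_sumr -sumrB.
rewrite [X in _ = X](_ : _ = qc x p 0 *: F 0%N + \sum_(i < p.+1) (qc x p i.+1 *: F i.+1 - x ^- p *: (qc x p i *: F i.+1))); last first.
  rewrite sumrB [in RHS]sumrB addrA; congr (_ - _).
  by rewrite [LHS]big_ord_recl [in RHS]big_ord_recr /= (@qc_gt _ _ p.+1)// scale0r addr0.
congr (_ + _); apply: eq_bigr => i _.
by rewrite /bump /= add1n add0n scalerBl scalerA.
Qed.

(** The factor j = 0 of the product is 1 - s, which vanishes at s = 1. *)
Lemma qc_sum1 x p : \sum_(i < p.+2) qc x p.+1 i = 0.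
Proof.
elim: p => [|p IH].
  by rewrite !big_ord_recr big_ord0 /= expr0 invr1 !mulr1 !mulr0 add0r !subr0 add0r subrr.
have := @qc_sum R^o x p.+1 (fun=> 1).
have e n q : \sum_(i < n) qc x q i *: (1 : R^o) = \sum_(i < n) qc x q i.
  by apply: eq_bigr => i _; rewrite -[LHS]/(_ * 1) mulr1.
by rewrite !e IH scaler0 subr0.
Qed.

(** The product of the 1 + 4^j, j < p, which bounds the product of the 1 + x^-j for all x >= 1/4. *)
Fixpoint qc_bound p : R := if p is p'.+1 then qc_bound p' * (1 + 4 ^+ p') else 1.

Lemma qc_bound_ge1 p : 1 <= qc_bound p.
Proof.
elim: p => [|p IH] //=; rewrite (le_trans IH)// ler_peMr ?(le_trans _ IH)//.
by rewrite lerDl exprn_ge0.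
Qed.

Lemma qc_abs_sum x p : 4^-1 <= x -> \sum_(i < p.+1) `|qc x p i| <= qc_bound p.
Proof.
move=> x4; have x0 : 0 < x by rewrite (lt_le_trans _ x4).
elim: p => [|p IH]; first by rewrite big_ord_recr big_ord0 /= normr1 add0r.
have xp : x ^- p <= 4 ^+ p.
  rewrite -[leRHS]invrK lef_pV2 ?posrE ?invr_gt0 ?exprn_gt0// -exprVn lerXn2r// nnegrE ?ltW//.
rewrite /= mulrDr mulr1.
apply: (@le_trans _ _ (\sum_(i < p.+2) (`|qc x p i| + x ^- p * `|if nat_of_ord i is i'.+1 then qc x p i' else 0|))).
  apply: ler_sum => i _ /=; rewrite (le_trans (ler_normB _ _))// normrM.
  by rewrite [`|x ^- p|]ger0_norm// invr_ge0 exprn_ge0 ?ltW.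
rewrite big_split /= lerD//.
  by rewrite big_ord_recr /= (@qc_gt _ _ p.+1)// normr0 addr0.
rewrite big_ord_recl /= normr0 mulr0 add0r mulrC -mulr_sumr ler_pM ?invr_ge0 ?exprn_ge0 ?(ltW x0)//.
by apply: sumr_ge0 => i _.
Qed.

Definition qprod x p v : R[i] :=
  (\prod_(i < p) (1 - x ^+ i.+1))%:C * v ^+ p * \prod_(j < p.+1) ck ((x ^+ j)%:C * v).

Lemma normc_expM x j v : 0 <= x -> x <= 1 -> normc ((x ^+ j)%:C * v) <= normc v.
Proof.
move=> x0 x1; rewrite normc_realM ger0_norm ?exprn_ge0// ler_piMl ?normc_ge0//.
exact: exprn_ile1.
Qed.

(* The combination of dilated Cauchy kernels cancels to the order p as x tends to 1. *)
Lemma qc_kernel x p v : 0 < x -> x <= 1 -> normc v < 1 ->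
  \sum_(i < p.+1) (qc x p i)%:C * ck ((x ^+ i)%:C * v) = qprod x p v.
Proof.
move=> x0 x1; have x0' := ltW x0.
elim: p v => [|p IH] v v1.
  have -> : \sum_(i < 1) (qc x 0 i)%:C * ck ((x ^+ i)%:C * v) = ck v.
    by rewrite big_ord1 qc0 expr0 !mul1r.
  have -> : qprod x 0 v = (1 : R)%:C * v ^+ 0 * ck ((x ^+ 0)%:C * v).
    by rewrite /qprod big_ord1 big_ord0.
  by rewrite !expr0 !mul1r.
have xv1 : normc (x%:C * v) < 1 by rewrite (le_lt_trans _ v1)// -(expr1 x) normc_expM.
have IH' := IH _ v1; have IHx := IH _ xv1.
have -> : \sum_(i < p.+2) (qc x p.+1 i)%:C * ck ((x ^+ i)%:C * v) =
  \sum_(i < p.+1) (qc x p i)%:C * ck ((x ^+ i)%:C * v) -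
  (x ^- p)%:C * \sum_(i < p.+1) (qc x p i)%:C * ck ((x ^+ i.+1)%:C * v).
  have := @qc_sum (Rcomplex R) x p (fun i => ck ((x ^+ i)%:C * v)).
  have sc (a : R) (z : R[i]) : (a *: (z : Rcomplex R)) = a%:C * z.
    by case: z => b c; rewrite /GRing.scale /=; congr (_ +i* _); ring.
  rewrite sc; under eq_bigr do rewrite sc; move=> ->.
  by congr (_ - _ * _); apply: eq_bigr => i _; rewrite sc.
have -> : \sum_(i < p.+1) (qc x p i)%:C * ck ((x ^+ i.+1)%:C * v) = qprod x p (x%:C * v).
  rewrite -IHx; apply: eq_bigr => i _; congr (_ * ck _).
  by rewrite exprSr (rmorphM (real_complex R)) /= mulrA.
rewrite IH' /qprod.
have -> : \prod_(j < p.+1) ck ((x ^+ j)%:C * (x%:C * v)) = \prod_(j < p.+1) ck ((x ^+ j.+1)%:C * v).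
  by apply: eq_bigr => j _; rewrite exprSr (rmorphM (real_complex R)) /= mulrA.
have e1 : \prod_(j < p.+1) ck ((x ^+ j)%:C * v) = ck v * \prod_(j < p) ck ((x ^+ j.+1)%:C * v).
  by rewrite big_ord_recl expr0 mul1r.
have e2 : \prod_(j < p.+1) ck ((x ^+ j.+1)%:C * v) =
   \prod_(j < p) ck ((x ^+ j.+1)%:C * v) * ck ((x ^+ p.+1)%:C * v) by rewrite big_ord_recr.
have e3 : \prod_(j < p.+2) ck ((x ^+ j)%:C * v) =
   ck v * (\prod_(j < p) ck ((x ^+ j.+1)%:C * v) * ck ((x ^+ p.+1)%:C * v)).
  by rewrite big_ord_recl expr0 mul1r big_ord_recr.
rewrite e1 e2 e3 big_ord_recr /= (rmorphM (real_complex R)) /=.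
set A := \prod_(i < p) (1 - _); set P := \prod_(j < p) _.
have xp : (x ^+ p)%:C != 0 :> R[i] by rewrite -normc_gt0 normc_real normr_gt0 expf_neq0 ?gt_eqF.
have -> : (x ^- p)%:C * (A%:C * (x%:C * v) ^+ p * (P * ck ((x ^+ p.+1)%:C * v))) =
    A%:C * v ^+ p * (P * ck ((x ^+ p.+1)%:C * v)).
  rewrite exprMn (fmorphV (real_complex R)) /=.
  rewrite -(rmorphXn (real_complex R)) /=; field; exact: xp.
(* All factors but one are common to the two products; the difference of the remaining Cauchy
   kernels yields the new factor (1 - x^(p+1)) v. *)
have d := @ckB R v ((x ^+ p.+1)%:C * v) v1 (le_lt_trans (normc_expM p.+1 v x0' x1) v1).
have -> : A%:C * v ^+ p * (ck v * P) - A%:C * v ^+ p * (P * ck ((x ^+ p.+1)%:C * v)) =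
   A%:C * v ^+ p * P * (ck v - ck ((x ^+ p.+1)%:C * v)) by ring.
by rewrite d (rmorphB (real_complex R)) /= [v ^+ p.+1]exprSr; ring.
Qed.

(** |1 - v| <= |1 - s v| + (1 - s) |v|, and (1 - s) |v| <= 1 - s <= 1 - s |v| <= |1 - s v|. *)
Lemma ck_contract s v : 0 <= s -> s <= 1 -> normc v < 1 ->
  normc (ck (s%:C * v)) <= 2 * normc (ck v).
Proof.
move=> s0 s1 v1; rewrite /ck !normcV.
have sv1 : normc (s%:C * v) < 1 by rewrite normc_realM ger0_norm// (le_lt_trans _ v1)// ler_piMl ?normc_ge0.
have n1 : 0 < normc (1 - v) by rewrite normc_gt0 subr1_neq0.
have n2 : 0 < normc (1 - s%:C * v) by rewrite normc_gt0 subr1_neq0.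
rewrite ler_pdivlMr// ler_pdivrMl// [leRHS]mulrC.
rewrite (_ : 1 - v = 1 - s%:C * v - (1 - s)%:C * v); last by rewrite (rmorphB (real_complex R)) /=; ring.
rewrite (le_trans (normcB _ _))// mulr_natl mulr2n lerD//.
rewrite normc_realM ger0_norm ?subr_ge0//.
have := normc_1B (s%:C * v); rewrite normc_realM ger0_norm//.
have h1 : (1 - s) * normc v <= 1 - s by rewrite ler_piMr ?subr_ge0// ltW.
have h2 : s * normc v <= s by rewrite ler_piMr// ltW.
lra.
Qed.

Lemma one_sub_expr x i : 0 <= x -> x <= 1 -> 0 <= 1 - x ^+ i <= i%:R * (1 - x).
Proof.
move=> x0 x1; rewrite subr_ge0 exprn_ile1//=.
elim: i => [|i IH]; first by rewrite expr0 subrr mul0r.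
rewrite exprS -natr1 mulrDl mul1r.
have -> : 1 - x * x ^+ i = x * (1 - x ^+ i) + (1 - x) by ring.
by rewrite lerD2r (le_trans _ IH)// ler_piMl// subr_ge0 exprn_ile1.
Qed.

Lemma qprod_bound x p v : 0 <= x -> x <= 1 -> normc v < 1 ->
  normc (qprod x p v) <= p%:R ^+ p * 2 ^+ p.+1 * (1 - x) ^+ p * normc (ck v) ^+ p.+1.
Proof.
move=> x0 x1 v1; rewrite /qprod !normcM normcX normc_real.
have b1 : `|\prod_(i < p) (1 - x ^+ i.+1)| <= p%:R ^+ p * (1 - x) ^+ p.
  rewrite -exprMn normr_prod -[X in _ <= _ ^+ X]card_ord -prodr_const.
  apply: ler_prod => i _; rewrite normr_ge0 /=.
  have /andP[h1 h2] := one_sub_expr i.+1 x0 x1; rewrite ger0_norm// (le_trans h2)//.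
  by rewrite ler_wpM2r ?subr_ge0// ler_nat.
have b2 : normc (\prod_(j < p.+1) ck ((x ^+ j)%:C * v)) <= (2 * normc (ck v)) ^+ p.+1.
  elim: (p.+1) => [|q IH]; first by rewrite big_ord0 expr0 normc1.
  rewrite big_ord_recr /= normcM exprSr ler_pM ?normc_ge0//.
  by rewrite ck_contract ?exprn_ge0// exprn_ile1.
rewrite (le_trans (ler_pM _ (normc_ge0 _) (_ : _ <= p%:R ^+ p * (1 - x) ^+ p) b2))//.
- by rewrite mulr_ge0 ?exprn_ge0 ?normc_ge0.
- by rewrite (le_trans _ b1)// ler_piMr// exprn_ile1 ?normc_ge0// ltW.
- by rewrite exprMn le_eqVlt; apply/orP; left; apply/eqP; ring.
Qed.

(** Kernels are encoded by lists of pairs (coefficient, dilation), so that holomorphy, Lipschitz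
    bounds and Cauchy's formula follow by induction on the list. *)
Definition kap (L : seq (R * R)) v : R[i] := \sum_(p <- L) p.1%:C * ck (p.2%:C * v).

Definition unit_scales (L : seq (R * R)) := forall p, p \in L -> 0 <= p.2 <= 1.

Lemma hol_kap L (a : R[i]) : unit_scales L -> normc a <= 1 -> hol (fun w => kap L (a * w)).
Proof.
move=> HL a1; elim: L HL => [|p L IH] HL.
  by move=> w w1; exists 0; apply: cdiff_ext ltr01 _ (cdiff_cst 0 w) => ? _; rewrite /kap big_nil.
have /andP[p0 p1] := HL p (mem_head _ _).
have HL' : unit_scales L by move=> q qL; apply: HL; rewrite inE qL orbT.
have hc : hol (fun w => p.1%:C * ck ((p.2%:C * a) * w)).
  apply: holZ; apply: hol_ck; rewrite normc_realM ger0_norm// (le_trans _ a1)//.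
  by rewrite ler_piMl ?normc_ge0.
move=> w w1; have [l hl] := hc w w1; have [m hm] := IH HL' w w1.
exists (l + m); apply: cdiff_ext ltr01 _ (cdiffD hl hm) => u _.
by rewrite /kap big_cons mulrA.
Qed.

Lemma kap_lipschitz L (r : R) : unit_scales L -> r < 1 -> exists2 C : R, 0 <= C &
  (forall u v, normc u <= r -> normc v <= r -> normc (kap L u - kap L v) <= C * normc (u - v)) /\
  (forall v, normc v <= r -> normc (kap L v) <= C).
Proof.
move=> HL r1; have q0 : 0 < 1 - r by rewrite subr_gt0.
have i0 : 0 <= (1 - r)^-1 by rewrite invr_ge0 ltW.
elim: L HL => [|p L IH] HL.
  by exists 0 => //; split => [u v _ _|v _]; rewrite /kap !big_nil ?subrr normc0 ?mul0r.
have /andP[p0 p1] := HL p (mem_head _ _).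
have HL' : unit_scales L by move=> q qL; apply: HL; rewrite inE qL orbT.
have [C C0 [C1 C2]] := IH HL'.
have pv v : normc v <= r -> normc (p.2%:C * v) <= r.
  by move=> vr; rewrite normc_realM ger0_norm// (le_trans _ vr)// ler_piMl ?normc_ge0.
exists (`|p.1| * ((1 - r)^-1 + (1 - r)^-2) + C).
  by rewrite addr_ge0// mulr_ge0// addr_ge0// invr_ge0 exprn_ge0// ltW.
split => [u v ur vr|v vr].
  rewrite /kap !big_cons -/(kap L u) -/(kap L v) opprD addrACA.
  rewrite (le_trans (normcD _ _))// mulrDl lerD ?C1//.
  rewrite -mulrBr normc_realM -mulrA ler_wpM2l//.
  rewrite (le_trans (ck_lip r1 (pv _ ur) (pv _ vr)))// -mulrBr normc_realM ger0_norm//.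
  rewrite ler_pM ?mulr_ge0 ?normc_ge0 ?invr_ge0 ?exprn_ge0 ?(ltW q0)// ?lerDr//.
  by rewrite ler_piMl ?normc_ge0.
rewrite /kap big_cons -/(kap L v) (le_trans (normcD _ _))// lerD ?C2//.
rewrite normc_realM ler_wpM2l// (le_trans (ck_bound (pv _ vr) r1))// lerDl.
by rewrite invr_ge0 exprn_ge0// ltW.
Qed.

(** Cauchy's formula term by term. One factor r is the radius of the circle, the other comes from
    the kernel evaluated at conj(zeta) w with |zeta| = r, so that a dilation p.2 in the kernel acts
    on h as the dilation r^2 p.2. *)
Lemma kap_cauchy L h (r : R) w : unit_scales L -> hol h -> 0 < r -> r < 1 -> normc w < 1 ->
  cint 0 1 (fun t => h (r%:C * cexp t) * kap L (cexp (- t) * (r%:C * w))) =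
  \sum_(p <- L) p.1%:C * h ((r * (p.2 * r))%:C * w).
Proof.
move=> HL hh r0 r1 w1.
have su p : p \in L -> normc (p.2%:C * (r%:C * w)) < 1.
  move=> /HL /andP[p0 p1]; rewrite !normc_realM ger0_norm// ger0_norm ?(ltW r0)//.
  rewrite (le_lt_trans _ w1)// mulrA ler_piMl ?normc_ge0// mulr_ile1 ?(ltW r0)//.
  exact: ltW.
have cc p : p \in L -> cont_on 0 1 (fun t => h (r%:C * cexp t) * ck (cexp (- t) * (p.2%:C * (r%:C * w)))).
  by move=> /su; exact: cauchy_integrand_cont.
suff H (L' : seq (R * R)) : {subset L' <= L} ->
    cont_on 0 1 (fun t => h (r%:C * cexp t) * kap L' (cexp (- t) * (r%:C * w))) /\
    cint 0 1 (fun t => h (r%:C * cexp t) * kap L' (cexp (- t) * (r%:C * w))) =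
    \sum_(p <- L') p.1%:C * h ((r * (p.2 * r))%:C * w).
  by have [] := H L (fun _ => id).
elim: L' => [_|p L' IH sub].
  rewrite big_nil; split.
    by apply: cont_on_ext (@cont_on_cst R 0 1 0) => t; rewrite /kap big_nil mulr0.
  rewrite (@eq_cint _ _ _ _ (fun=> 0)) ?cint_cst ?mulr0//.
  by move=> t _; rewrite /kap big_nil mulr0.
have pL : p \in L by apply: sub; exact: mem_head.
have [IH1 IH2] := IH (fun q qL => sub q (mem_behead (s := p :: L') qL)).
have cp : cont_on 0 1 (fun t => p.1%:C * (h (r%:C * cexp t) * ck (cexp (- t) * (p.2%:C * (r%:C * w))))).
  by apply: cont_onZ; exact: cc.
have E t : h (r%:C * cexp t) * kap (p :: L') (cexp (- t) * (r%:C * w)) =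
  p.1%:C * (h (r%:C * cexp t) * ck (cexp (- t) * (p.2%:C * (r%:C * w)))) +
  h (r%:C * cexp t) * kap L' (cexp (- t) * (r%:C * w)).
  rewrite /kap big_cons mulrDr; congr (_ + _).
  by rewrite mulrCA; congr (_ * (_ * ck _)); rewrite mulrCA.
split; first by apply: cont_on_ext (cont_onD cp IH1) => t; rewrite E.
rewrite (eq_cint (fun t _ => E t)) cintD// IH2 big_cons; congr (_ + _).
rewrite cintZ; last exact: cc.
rewrite cauchy_formula ?su//; congr (_ * h _).
by rewrite !mulrA !(rmorphM (real_complex R)) /=; ring.
Qed.

End SmoothingKernels.

Section LevelKernels.
Context {R : realType}.
Implicit Types (x : R) (v w : R[i]) (h : R[i] -> R[i]).

Lemma qc_bound_le p q : (p <= q)%N -> @qc_bound R p <= qc_bound q.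
Proof.
move=> /subnK <-; elim: (q - p)%N => [|n IH]; first by rewrite add0n.
rewrite addSn /= (le_trans IH)// ler_peMr ?(le_trans ler01 (qc_bound_ge1 _))//.
by rewrite lerDl exprn_ge0.
Qed.

Let rcM (a b : R) : (a * b)%:C = a%:C * b%:C.
Proof. exact: (rmorphM (real_complex R)). Qed.

Let rcN (a : R) : (- a)%:C = - a%:C.
Proof. exact: (rmorphN (real_complex R)). Qed.

Lemma sum_iota (Z : nmodType) p (F : nat -> Z) : \sum_(i <- iota 0 p) F i = \sum_(i < p) F i.
Proof. by rewrite -(big_mkord xpredT) /index_iota subn0. Qed.

Definition tau x p h w : R[i] := \sum_(i < p.+1) (qc x p i)%:C * h ((x ^+ i)%:C * w).

(* The list of the kernel of tau_x - tau_x' = (1 - tau_x') tau_x - (1 - tau_x) tau_x',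
   as an operator on the circle of radius x'^(1/2). *)
Definition level_list x p x' p' : seq (R * R) :=
  [seq (- (qc x' p' i.+1 * qc x p j), x' ^+ i * x ^+ j) | i <- iota 0 p', j <- iota 0 p.+1] ++
  [seq (qc x p i.+1 * qc x' p' j, x / x' * x ^+ i * x' ^+ j) | i <- iota 0 p, j <- iota 0 p'.+1].

Section OneLevel.
Variables (x x' : R) (p p' : nat).
Hypotheses (x0 : 0 < x) (xx' : x <= x') (x'1 : x' <= 1).

Let x'0 : 0 < x'. Proof. exact: lt_le_trans x0 xx'. Qed.
Let x1 : x <= 1. Proof. exact: le_trans xx' x'1. Qed.
Let q1 : 0 <= x / x' <= 1.
Proof. by rewrite divr_ge0 ?(ltW x0) ?(ltW x'0)//= ler_pdivrMr// mul1r. Qed.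

Lemma level_list_scales : unit_scales (level_list x p x' p').
Proof.
have e0 i : 0 <= x ^+ i <= 1 by rewrite exprn_ge0 ?(ltW x0)// exprn_ile1// ltW.
have e0' i : 0 <= x' ^+ i <= 1 by rewrite exprn_ge0 ?(ltW x'0)// exprn_ile1// ltW.
have m01 (a b : R) : 0 <= a <= 1 -> 0 <= b <= 1 -> 0 <= a * b <= 1.
  by move=> /andP[a0 a1] /andP[b0 b1]; rewrite mulr_ge0//= mulr_ile1.
move=> q; rewrite mem_cat => /orP[] /allpairsP[[i j] [_ _ ->]] /=.
  exact: m01.
by apply: (m01 _ _) => //; exact: m01.
Qed.

(** Dropping the coefficient of index 0, which is 1, and changing the sign turns [tau] into
    [1 - tau]; the other operator of each product is summed by [qc_kernel]. *)
Lemma kap_level v : normc v < 1 -> kap (level_list x p x' p') v =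
  - (\sum_(i < p') (qc x' p' i.+1)%:C * qprod x p ((x' ^+ i)%:C * v)) +
  \sum_(i < p) (qc x p i.+1)%:C * qprod x' p' ((x / x' * x ^+ i)%:C * v).
Proof.
move=> v1; rewrite /kap /level_list big_cat !big_allpairs_dep; congr (_ + _).
  rewrite sum_iota -sumrN; apply: eq_bigr => i _; rewrite sum_iota /=.
  rewrite -qc_kernel//; last by rewrite (le_lt_trans _ v1)// normc_expM ?(ltW x'0).
  rewrite mulr_sumr -sumrN; apply: eq_bigr => j _ /=.
  have key (a b c e f : R[i]) : e = f -> a = b * c -> - a * ck e = - (b * (c * ck f)).
    by move=> -> ->; rewrite mulNr mulrA.
  by rewrite rcN; apply: key; rewrite rcM// mulrA [(x' ^+ i)%:C * _]mulrC.
rewrite sum_iota; apply: eq_bigr => i _; rewrite sum_iota /=.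
have /andP[y0 y1] := q1; have e0 : 0 <= x / x' * x ^+ i by rewrite mulr_ge0// exprn_ge0// ltW.
have e1 : x / x' * x ^+ i <= 1 by rewrite mulr_ile1 ?exprn_ge0 ?exprn_ile1 ?(ltW x0).
rewrite -qc_kernel//; last first.
  by rewrite (le_lt_trans _ v1)// normc_realM ger0_norm// ler_piMl ?normc_ge0.
rewrite mulr_sumr; apply: eq_bigr => j _ /=.
rewrite mulrA rcM; congr (_ * ck _).
by rewrite mulrA; congr (_ * _); rewrite -rcM; congr (_%:C); ring.
Qed.

(** Each [tau] contains h(w) itself, which cannot be recovered through dilations by r^2 < 1. In the
    difference it cancels, and every remaining term is dilated by at least one factor x or x', hence
    by x' times a number in [0, 1]; the circle of radius r supplies this x' = r^2. *)
Lemma level_sum h w (r : R) : r ^+ 2 = x' ->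
  \sum_(q <- level_list x p x' p') q.1%:C * h ((r * (q.2 * r))%:C * w) =
  tau x p h w - tau x' p' h w.
Proof.
move=> rx.
(* The terms of the composition of the two operators; removing the row i = 0 or the column j = 0
   from their sum gives the two products with [1 - tau]. *)
pose D i j := (qc x' p' i)%:C * (qc x p j)%:C * h ((x' ^+ i * x ^+ j)%:C * w).
have S1 : \sum_(i < p'.+1) \sum_(j < p.+1) D i j =
    tau x p h w + \sum_(i < p') \sum_(j < p.+1) D i.+1 j.
  rewrite big_ord_recl; congr (_ + _); apply: eq_bigr => j _.
  by rewrite /D qc0 mul1r expr0 mul1r.
have S2 : \sum_(i < p'.+1) \sum_(j < p.+1) D i j =
    tau x' p' h w + \sum_(j < p) \sum_(i < p'.+1) D i j.+1.
  rewrite exchange_big big_ord_recl; congr (_ + _); apply: eq_bigr => j _.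
  by rewrite /D qc0 mulr1 expr0 mulr1.
rewrite /level_list big_cat !big_allpairs_dep !sum_iota.
have -> : \sum_(i < p') \sum_(j <- iota 0 p.+1)
    (- (qc x' p' i.+1 * qc x p j))%:C * h ((r * (x' ^+ i * x ^+ j * r))%:C * w) =
    - \sum_(i < p') \sum_(j < p.+1) D i.+1 j.
  rewrite -sumrN; apply: eq_bigr => i _; rewrite sum_iota -sumrN; apply: eq_bigr => j _.
  rewrite /D rcN rcM mulNr; congr (- (_ * h (_%:C * w))).
  by rewrite exprS -rx; ring.
have -> : \sum_(i < p) \sum_(j <- iota 0 p'.+1)
    (qc x p i.+1 * qc x' p' j)%:C * h ((r * (x / x' * x ^+ i * x' ^+ j * r))%:C * w) =
    \sum_(j < p) \sum_(i < p'.+1) D i j.+1.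
  apply: eq_bigr => i _; rewrite sum_iota; apply: eq_bigr => j _.
  rewrite /D rcM [(qc x p i.+1)%:C * _]mulrC; congr (_ * h (_%:C * w)).
  have -> : x ^+ i.+1 = x ^+ i * (x / x') * r ^+ 2 by rewrite rx -mulrA divfK ?gt_eqF// exprSr.
  by ring.
have e (a b c d : R[i]) : c + a = d + b -> - a + b = c - d.
  by move=> H; rewrite [LHS](_ : _ = (d + b) - a - d); [rewrite -H; ring|ring].
exact: (e _ _ _ _ (etrans (esym S1) S2)).
Qed.

Lemma level_bound v (K C : R) s : 4^-1 <= x -> normc v < 1 -> 0 <= K ->
  qc_bound p <= C -> qc_bound p' <= C ->
  (forall u, normc u < 1 -> normc (qprod x p u) <= K * normc (ck u) ^+ s) ->
  (forall u, normc u < 1 -> normc (qprod x' p' u) <= K * normc (ck u) ^+ s) ->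
  normc (kap (level_list x p x' p') v) <= 2 * (C * (K * (2 * normc (ck v)) ^+ s)).
Proof.
move=> x4 v1 K0 pC p'C H H'.
have x'4 : 4^-1 <= x' by rewrite (le_trans x4).
have T0 : 0 <= K * (2 * normc (ck v)) ^+ s by rewrite mulr_ge0// exprn_ge0// mulr_ge0 ?normc_ge0.
have half y q (F : nat -> R[i]) : 4^-1 <= y -> qc_bound q <= C ->
    (forall i, normc (F i) <= K * (2 * normc (ck v)) ^+ s) ->
    normc (\sum_(i < q) (qc y q i.+1)%:C * F i) <= C * (K * (2 * normc (ck v)) ^+ s).
  move=> y4 qC HF; rewrite (le_trans (normc_sum _ _ _))//.
  rewrite (@le_trans _ _ (\sum_(i < q) `|qc y q i.+1| * (K * (2 * normc (ck v)) ^+ s)))//.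
    by apply: ler_sum => i _; rewrite normc_realM ler_wpM2l.
  rewrite -mulr_suml ler_wpM2r// (le_trans _ qC)// (le_trans _ (qc_abs_sum q y4))//.
  by rewrite [leRHS]big_ord_recl lerDr normr_ge0.
have contr (a : R) u : 0 <= a -> a <= 1 -> normc u < 1 ->
    normc (ck (a%:C * u)) ^+ s <= (2 * normc (ck u)) ^+ s.
  by move=> a0 a1 u1; rewrite lerXn2r ?nnegrE ?mulr_ge0 ?normc_ge0// ck_contract.
have small (a : R) : 0 <= a -> a <= 1 -> normc (a%:C * v) < 1.
  by move=> a0 a1; rewrite (le_lt_trans _ v1)// normc_realM ger0_norm// ler_piMl ?normc_ge0.
rewrite kap_level// (le_trans (normcD _ _))// normcN mulr_natl mulr2n lerD//.
  apply: (half x' p' (fun i => qprod x p ((x' ^+ i)%:C * v))) => // i; have a0 : 0 <= x' ^+ i by rewrite exprn_ge0// ltW.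
  have a1 : x' ^+ i <= 1 by rewrite exprn_ile1// ltW.
  by rewrite (le_trans (H _ (small _ a0 a1)))// ler_wpM2l// contr.
apply: (half x p (fun i => qprod x' p' ((x / x' * x ^+ i)%:C * v))) => // i; have /andP[y0 y1] := q1.
have a0 : 0 <= x / x' * x ^+ i by rewrite mulr_ge0// exprn_ge0// ltW.
have a1 : x / x' * x ^+ i <= 1 by rewrite mulr_ile1 ?exprn_ge0 ?exprn_ile1 ?(ltW x0).
by rewrite (le_trans (H' _ (small _ a0 a1)))// ler_wpM2l// contr.
Qed.

End OneLevel.

(** The radius of level 0 is 0; the maximum keeps the scale at least 1/4, where the negative powers
    in [qc] are bounded. *)
Definition scale m : R := radius (maxn m 1) ^+ 2.

(* At the level 0 the operator tau is the identity. *)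
Definition order M m := if m is 0 then 0%N else M.

Definition level M m := level_list (scale m) (order M m) (scale m.+1) M.

Lemma scaleS m : scale m.+1 = radius m.+1 ^+ 2.
Proof. by rewrite /scale (maxn_idPl (ltn0Sn m)). Qed.

Lemma scale_bounds m : [/\ 4^-1 <= scale m, scale m <= scale m.+1, scale m <= 1 &
  1 - scale m <= 2 * @dyad R m].
Proof.
have d1 : @dyad R 1 = 2^-1 by rewrite dyadS dyad0 mul1r.
have dle k : (1 <= k)%N -> @dyad R k <= 2^-1.
  case: k => // k _; rewrite dyadS; have := @dyad_le1 R k; lra.
have rk k : (1 <= k)%N -> 2^-1 <= @radius R k by move=> /dle; rewrite /radius; lra.
have r1 k := @radius_lt1 R k; have r0 k := @radius_ge0 R k.
have mono : @radius R (maxn m 1) <= radius m.+1.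
  rewrite /radius lerD2l lerN2; case: m => [|m]; first by rewrite max0n.
  rewrite (maxn_idPl (ltn0Sn m)) [leLHS]dyadS; have := @dyad_gt0 R m.+1; lra.
have rm := rk (maxn m 1) (leq_maxr _ _).
rewrite scaleS /scale; split.
- rewrite (_ : 4^-1 = 2^-1 ^+ 2); last by rewrite expr2; lra.
  by rewrite lerXn2r ?nnegrE// invr_ge0.
- by rewrite lerXn2r ?nnegrE.
- by rewrite exprn_ile1// ltW.
- have -> : 1 - radius (maxn m 1) ^+ 2 = (1 - radius (maxn m 1)) * (1 + radius (maxn m 1)) :> R by ring.
  have le : 1 - radius (maxn m 1) <= @dyad R m.
    rewrite /radius opprB addrC subrK; case: m {mono rm} => [|m]; first by rewrite max0n dyad0 dyad_le1.
    by rewrite (maxn_idPl (ltn0Sn m)).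
  rewrite mulrC ler_pM//; [by rewrite addr_ge0|by rewrite subr_ge0 ltW|].
  have := r1 (maxn m 1); lra.
Qed.

Lemma level_scales M m : unit_scales (level M m).
Proof.
have [h1 h2 h3 h4] := scale_bounds m; have [h1' h2' h3' h4'] := scale_bounds m.+1.
by apply: level_list_scales => //; rewrite (lt_le_trans _ h1).
Qed.

Lemma level_kernel_bound M : exists2 K : R, 0 <= K & forall m v, normc v < 1 ->
  normc (kap (level M m) v) <= K * dyad m ^+ M * normc (ck v) ^+ M.+1.
Proof.
pose K0 : R := M%:R ^+ M * 2 ^+ M.+1 * 2 ^+ M + 2 ^+ M.
have p2 k : 0 <= 2 ^+ k :> R by rewrite exprn_ge0.
have K0ge : 0 <= K0 by rewrite addr_ge0 ?mulr_ge0 ?exprn_ge0.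
exists (2 * (qc_bound M * (K0 * 2 ^+ M.+1))).
  by rewrite !mulr_ge0// (le_trans ler01 (qc_bound_ge1 _)).
move=> m v v1.
have [h1 h2 h3 h4] := scale_bounds m; have [h1' h2' h3' h4'] := scale_bounds m.+1.
have x0 : 0 < scale m by rewrite (lt_le_trans _ h1).
have x'0 : 0 < scale m.+1 by rewrite (lt_le_trans _ h1').
have d0 k : 0 <= @dyad R k := ltW (dyad_gt0 k).
have gen k u : (m <= k)%N -> normc u < 1 -> 0 <= scale k -> scale k <= 1 -> 1 - scale k <= 2 * @dyad R k ->
    normc (qprod (scale k) M u) <= K0 * dyad m ^+ M * normc (ck u) ^+ M.+1.
  move=> mk u1 s0 s1 sd; rewrite (le_trans (qprod_bound M s0 s1 u1))//.
  rewrite ler_wpM2r ?exprn_ge0 ?normc_ge0//.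
  rewrite (@le_trans _ _ (M%:R ^+ M * 2 ^+ M.+1 * (2 ^+ M * dyad m ^+ M)))//; last first.
    by rewrite mulrA ler_wpM2r ?exprn_ge0// lerDl.
  rewrite ler_wpM2l ?mulr_ge0 ?exprn_ge0// -exprMn lerXn2r ?nnegrE ?mulr_ge0 ?subr_ge0//.
  rewrite (le_trans sd)// ler_wpM2l//.
  by rewrite /dyad lef_pV2 ?posrE ?exprn_gt0// ler_weXn2l// ler1n.
have K1 : 0 <= K0 * dyad m ^+ M by rewrite mulr_ge0 ?exprn_ge0.
have o1 : qc_bound (order M m) <= @qc_bound R M by apply: qc_bound_le; case: (m).
have o2 u : normc u < 1 -> normc (qprod (scale m) (order M m) u) <= K0 * dyad m ^+ M * normc (ck u) ^+ M.+1.
  move=> u1; case: m gen h1 h3 h4 x0 {h2 h1' h2' h3' h4' x'0 K1 o1} => [|m] gen h1 h3 h4 x0; last first.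
    by apply: gen => //; exact: ltW.
  rewrite /= dyad0 expr1n mulr1 -[normc (qprod _ _ _)](_ : normc (ck u) = _); last first.
    by rewrite -(@qc_kernel _ (scale 0))// big_ord1 expr0 !mul1r.
  (* At level 0 the kernel is a single Cauchy kernel; the M missing factors are inserted at the
     price of 2 each, which is the summand 2^M of [K0]. *)
  have c2 : 1 <= 2 * normc (ck u).
    have n0 : 0 < normc (1 - u) by rewrite normc_gt0 subr1_neq0.
    rewrite /ck normcV ler_pdivlMr// mul1r (le_trans (normcB _ _))// normc1.
    move: u1; lra.
  rewrite (@le_trans _ _ (2 ^+ M * normc (ck u) ^+ M.+1))//; last first.
    by rewrite ler_wpM2r ?exprn_ge0 ?normc_ge0// lerDr ?mulr_ge0 ?exprn_ge0.
  by rewrite exprS mulrCA ler_peMr ?normc_ge0// -exprMn exprn_ege1.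
have o3 u : normc u < 1 -> normc (qprod (scale m.+1) M u) <= K0 * dyad m ^+ M * normc (ck u) ^+ M.+1.
  by move=> u1; apply: gen => //; exact: ltW.
rewrite (le_trans (level_bound x0 h2 h3' h1 v1 K1 o1 (lexx _) o2 o3))//.
have key (a b c d e f g : R) : 2 * (a * (b * c * (d * e))) = 2 * (a * (b * d)) * c * e by ring.
by rewrite exprMn key.
Qed.

Lemma level_cauchy M m h w : hol h -> normc w < 1 ->
  cint 0 1 (fun t => h ((radius m.+1)%:C * cexp t) *
    kap (level M m) (cexp (- t) * ((radius m.+1)%:C * w))) =
  tau (scale m) (order M m) h w - tau (scale m.+1) M h w.
Proof.
move=> hh w1; have [h1 h2 h3 h4] := scale_bounds m; have [h1' h2' h3' h4'] := scale_bounds m.+1.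
have r0 : 0 < @radius R m.+1.
  by rewrite lt_neqAle radius_ge0 andbT eq_sym -sqrf_eq0 -scaleS gt_eqF// (lt_le_trans _ h1').
rewrite kap_cauchy ?radius_lt1//; last exact: level_scales.
by apply: level_sum => //; rewrite ?scaleS// (lt_le_trans _ h1).
Qed.

Lemma level_telescope M n h w : hol h -> normc w < 1 ->
  \sum_(m < n) cint 0 1 (fun t => h ((radius m.+1)%:C * cexp t) *
    kap (level M m) (cexp (- t) * ((radius m.+1)%:C * w))) =
  h w - tau (scale n) (order M n) h w.
Proof.
move=> hh w1; elim: n => [|n IH].
  by rewrite big_ord0 /tau big_ord1 qc0 expr0 !mul1r subrr.
by rewrite big_ord_recr IH level_cauchy//=; ring.
Qed.

(** The coefficients add up to 0, so [tau] is a combination of differences h(x^i w) - h(w). These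
    tend to 0 for fixed w as x tends to 1, while the sum of the moduli of the coefficients stays
    bounded. *)
Lemma tau_cvg0 M h w (e : R) : (0 < M)%N -> hol h -> normc w < 1 -> 0 < e ->
  exists n0, forall n, (n0 <= n)%N -> normc (tau (scale n) (order M n) h w) <= e.
Proof.
case: M => // M _ hh w1 e0; have [l hl] := hh w w1.
have CQ : 0 < @qc_bound R M.+1 by rewrite (lt_le_trans ltr01 (qc_bound_ge1 _)).
have [d d0 dP] : exists2 d : R, 0 < d &
    forall u, normc (u - w) < d -> normc (h u - h w) < e / qc_bound M.+1.
  have [C [d d0 dP]] := cdiff_continuous hl; have eC := divr_gt0 e0 CQ.
  have C1 : 0 < `|C| + 1 by rewrite ltr_pwDr.
  exists (Num.min d (e / qc_bound M.+1 / (`|C| + 1))); first by rewrite lt_min d0 divr_gt0.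
  move=> u; rewrite lt_min => /andP[u1 u2]; rewrite (le_lt_trans (dP u u1))//.
  rewrite ltr_pdivlMr// in u2; rewrite (le_lt_trans _ u2)// mulrC ler_wpM2l ?normc_ge0//.
  by rewrite (le_trans (ler_norm C))// lerDl.
have [n0 n0P] : exists n0, forall n, (n0 <= n)%N -> M.+1%:R * (2 * @dyad R n) < d.
  have k0 : 0 <= M.+1%:R * 2 / d by rewrite divr_ge0 ?mulr_ge0 ?(ltW d0).
  have := archi_boundP k0; set k := Num.Def.archi_bound _ => kP.
  exists k => n kn; rewrite dyad_natr mulrA ltr_pdivrMr; last by rewrite ltr0n expn_gt0.
  rewrite [ltRHS]mulrC -ltr_pdivrMr// (lt_le_trans kP)// ler_nat (leq_trans kn)// ltnW// ltn_expl//.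
exists n0.+1 => -[//|n] nn; have {}n0P := n0P n.+1 (ltnW nn).
have [h1 h2 h3 h4] := scale_bounds n.+1; have s0 : 0 <= scale n.+1 by rewrite (le_trans _ h1).
have -> : tau (scale n.+1) (order M.+1 n.+1) h w =
   \sum_(i < M.+2) (qc (scale n.+1) M.+1 i)%:C * (h ((scale n.+1 ^+ i)%:C * w) - h w).
  rewrite /tau /=; under [RHS]eq_bigr do rewrite mulrBr.
  rewrite sumrB -mulr_suml -(rmorph_sum (real_complex R)) /=.
  by rewrite (qc_sum1 (scale n.+1) M) mul0r subr0.
rewrite (le_trans (normc_sum _ _ _))//.
rewrite (@le_trans _ _ (\sum_(i < M.+2) `|qc (scale n.+1) M.+1 i| * (e / qc_bound M.+1)))//.
  apply: ler_sum => i _; rewrite normc_realM ler_wpM2l//; apply/ltW/dP.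
  have /andP[b0 b1] := one_sub_expr i s0 h3.
  rewrite (_ : _ - w = (scale n.+1 ^+ i - 1)%:C * w); last by rewrite (rmorphB (real_complex R)) /=; ring.
  rewrite normc_realM distrC ger0_norm// (le_lt_trans _ n0P)//.
  rewrite (@le_trans _ _ (1 - scale n.+1 ^+ i))//; first by rewrite ler_piMr// ltW.
  by rewrite (le_trans b1)// ler_pM ?subr_ge0// ler_nat -ltnS.
rewrite -mulr_suml (le_trans (ler_wpM2r _ (qc_abs_sum _ h1)))//; first by rewrite divr_ge0 ?ltW.
by rewrite mulrCA divff ?mulr1// gt_eqF.
Qed.

End LevelKernels.

(** * Summability over the lattice implies nuclearity *)

Section AtomicNuclear.
Context {R : realType}.
Variables (beta gamma : R) (g phi : R[i] -> R[i]).
Hypotheses (hbeta : 1 < beta) (hg : holomorphic_disk g) (hphi : holomorphic_disk phi).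
Hypothesis hphiD : forall z, normc z < 1 -> normc (phi z) < 1.
Hypothesis hS : bounded_operator (bloch beta) (bloch_norm beta)
            (bloch gamma) (bloch_norm gamma) (volterra g phi).

Local Notation T := (volterra g phi).
Local Notation W := (weight_symbol gamma g).
Local Notation N := (bloch_norm beta).

(* A rank-one operator f |-> l f * k, together with a bound for its nuclear norm. *)
Definition atom : Type := ((R[i] -> R[i]) -> R[i]) * (R[i] -> R[i]) * R.

Definition functional (a : atom) := a.1.1.
Definition kernel (a : atom) := a.1.2.
Definition cost (a : atom) : R := a.2.

(** Y bounds the Bloch norm of the primitive of (k o phi) g, the vector that the atom contributes to
    the operator. The functional is controlled on all of [bloch beta], hence on either domain. *)
Definition atom_ok (a : atom) := [/\ linear_on (bloch beta) (functional a), hol (kernel a) &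
  exists lam Y : R, [/\ 0 <= lam, 0 <= Y,
    forall f, bloch beta f -> normc (functional a f) <= lam * N f,
    forall z, normc z < 1 -> W z * normc (kernel a (phi z)) <= Y &
    lam * Y <= cost a]].

Lemma atom_cost_ge0 a : atom_ok a -> 0 <= cost a.
Proof. by move=> [_ _ [lam [Y [l0 Y0 _ _ le]]]]; rewrite (le_trans _ le)// mulr_ge0. Qed.

Lemma atom_weight a f z : atom_ok a -> bloch beta f -> normc z < 1 ->
  W z * normc (functional a f * kernel a (phi z)) <= N f * cost a.
Proof.
move=> [_ _ [lam [Y [l0 Y0 fl kY le]]]] bf z1; have Nf := bloch_norm_ge0 bf.
rewrite normcM mulrCA (le_trans (ler_pM (normc_ge0 _) _ (fl f bf) (kY z z1)))//.
  by rewrite mulr_ge0 ?weight_symbol_ge0 ?normc_ge0.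
by rewrite -mulrA mulrCA ler_wpM2l.
Qed.

Definition image (a : atom) := prim (fun z => kernel a (phi z) * g z).

Lemma image_hol a : atom_ok a -> hol (fun z => kernel a (phi z) * g z).
Proof.
move=> [_ hk _]; apply: holM; last exact: holomorphic_hol.
by apply: hol_comp => //; exact: holomorphic_hol.
Qed.

Lemma image_bloch a (Y : R) : atom_ok a ->
  (forall z, normc z < 1 -> W z * normc (kernel a (phi z)) <= Y) ->
  bloch gamma (image a) /\ bloch_norm gamma (image a) <= Y.
Proof.
move=> ok H.
have B z : normc z < 1 -> bloch_weight gamma (image a) z <= Y.
  move=> z1; rewrite /bloch_weight prim_derive1//; last exact: image_hol.
  by rewrite normcM [normc _ * _]mulrC mulrA; exact: H.
split; first split; first exact/prim_holomorphic/image_hol.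
  by exists Y => _ [z z1 <-]; exact: B.
by rewrite -[Y]add0r bloch_norm_le// /image prim_at0 normc0.
Qed.

Variable a : nat -> atom.
Hypothesis a_ok : forall k, atom_ok (a k).

Lemma atoms_remainder f n : bloch beta f ->
  let D := T f - \sum_(0 <= k < n) functional (a k) f *: image (a k) in
  [/\ holomorphic_disk D, D 0 = 0 & forall z, normc z < 1 -> derive1 D z =
   (derive1 f (phi z) - \sum_(k < n) functional (a k) f * kernel (a k) (phi z)) * g z].
Proof.
move=> bf; elim: n => [|n [IH1 IH2 IH3]].
  rewrite big_geq// subr0; split; first exact: (hS.1.1 f bf).1.
    by rewrite volterraE prim_at0.
  move=> z z1; rewrite big_ord0 subr0; apply: volterra_derive1 => //; exact: bf.1.
set D' := T f - _.
have -> : D' = (- functional (a n) f) *: image (a n) + (T f - \sum_(0 <= k < n) functional (a k) f *: image (a k)).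
  by rewrite /D' big_nat_recr//= opprD addrA scaleNr addrC.
have [H1 H2] := holomorphic_disk_comb (- functional (a n) f) (prim_holomorphic (image_hol (a_ok n))) IH1.
split => //.
  rewrite -[LHS]/(- functional (a n) f * image (a n) 0 + _) /image prim_at0 mulr0 add0r.
  exact: IH2.
move=> z z1; rewrite H2// IH3// prim_derive1//; last exact: image_hol.
rewrite big_ord_recr /=.
have key (p q r s t : R[i]) : - p * (q * r) + (s - t) * r = (s - (t + p * q)) * r by ring.
exact: key.
Qed.

Variables (C : R) (K : nat -> nat).
Hypotheses (a_cost : forall n, \sum_(k < n) cost (a k) <= C) (K_ge : forall n, (n <= K n)%N).
Hypothesis a_cvg : forall f w (e : R), bloch beta f -> normc w < 1 -> 0 < e ->
  exists n0, forall n, (n0 <= n)%N ->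
   normc (derive1 f w - \sum_(k < K n) functional (a k) f * kernel (a k) w) <= e.

Let s n := \sum_(0 <= k < n) cost (a k).

Let s_mono : nondecreasing_seq s.
Proof.
by apply/nondecreasing_seqP => n; rewrite /s big_nat_recr//= lerDl atom_cost_ge0.
Qed.

Let s_cvg : cvgn s.
Proof.
apply: nondecreasing_is_cvgn => //; exists C => _ [n _ <-].
by rewrite /s big_mkord.
Qed.

(** At a point z, the series can be continued to an index m where the derivative at phi(z) is as
    well approximated as desired; the terms from n to m are at most N f times their costs. As the
    bound does not depend on z or m, pointwise convergence becomes convergence in norm. *)
Lemma atoms_remainder_norm f n : bloch beta f ->
  bloch_norm gamma (T f - \sum_(0 <= k < n) functional (a k) f *: image (a k)) <=
  N f * (limn s - s n).
Proof.
move=> bf; have [H1 H2 H3] := atoms_remainder n bf.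
have Nf := bloch_norm_ge0 bf.
rewrite -[leRHS]add0r; apply: bloch_norm_le; first by rewrite H2 normc0.
move=> z z1; rewrite /bloch_weight H3// normcM [normc _ * _]mulrC mulrA -/(W z).
have [B WB] := weight_symbol_bounded hbeta hg hphi hphiD hS.
have B0 : 0 <= B by rewrite (le_trans _ (WB z z1))// weight_symbol_ge0.
apply/ler_addgt0Pr => e e0.
have B1 : 0 < B + 1 by rewrite ltr_wpDl.
have [n0 n0P] := a_cvg bf (hphiD z1) (divr_gt0 e0 B1).
pose m := K (maxn n0 n); have nm : (n <= m)%N by rewrite (leq_trans (leq_maxr n0 n)).
have {n0P} := n0P _ (leq_maxl n0 n); rewrite -/m => n0P.
pose F k := functional (a k) f * kernel (a k) (phi z).
have split_sum : derive1 f (phi z) - \sum_(k < n) F k =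
    (derive1 f (phi z) - \sum_(k < m) F k) + \sum_(n <= k < m) F k.
  by rewrite -!(big_mkord xpredT F) (big_cat_nat _ nm)//=; ring.
have -> : W z * normc (derive1 f (phi z) - \sum_(k < n) F k) =
   W z * normc ((derive1 f (phi z) - \sum_(k < m) F k) + \sum_(n <= k < m) F k).
  by rewrite split_sum.
rewrite (le_trans (ler_wpM2l (weight_symbol_ge0 _ _ _) (normcD _ _)))// mulrDr addrC lerD//.
  rewrite (le_trans (ler_wpM2l (weight_symbol_ge0 _ _ _) (normc_sum _ _ _)))// mulr_sumr.
  rewrite (@le_trans _ _ (\sum_(n <= k < m) N f * cost (a k)))//.
    by apply: ler_sum => k _; exact: atom_weight.
  rewrite -mulr_sumr ler_wpM2l// lerBrDl /s -(big_cat_nat _ nm)//=.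
  exact: (nondecreasing_cvgn_le s_mono s_cvg).
rewrite (le_trans (ler_pM (weight_symbol_ge0 _ _ _) (normc_ge0 _) (WB z z1) n0P))//.
by rewrite mulrA ler_pdivrMr// mulrC ler_wpM2l ?(ltW e0)// lerDl.
Qed.

Variable E : set (R[i] -> R[i]).
Hypotheses (E_bloch : forall f, E f -> bloch beta f)
  (E0 : E 0).

Lemma nuclear_of_atoms : nuclear E N (bloch gamma) (bloch_norm gamma) T.
Proof.
have [[TB Tlin] _] := hS.
split; first by split=> [x /E_bloch|c x y /E_bloch bx /E_bloch]; [exact: TB|exact: Tlin].
have N0 f : E f -> 0 <= N f by move=> /E_bloch; exact: bloch_norm_ge0.
have NZ b f : E f -> N (b *: f) = normc b * N f by move=> /E_bloch; exact: bloch_normZ.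
have dual k : continuous_dual E N (functional (a k)).
  have [lin _ [lam [Y [l0 Y0 fl _ _]]]] := a_ok k.
  split; last by exists lam => f /E_bloch; exact: fl.
  by split=> [//|c x y /E_bloch bx /E_bloch]; exact: lin.
have term k : 0 <= dual_norm E N (functional (a k)) * bloch_norm gamma (image (a k)) <= cost (a k).
  have [lin _ [lam [Y [l0 Y0 fl kY le]]]] := a_ok k.
  have [iB iY] := image_bloch (a_ok k) kY.
  have d0 := dual_norm_ge0 E0 N0 NZ (dual k).
  rewrite mulr_ge0 ?bloch_norm_ge0//= (le_trans _ le)// ler_pM ?bloch_norm_ge0//.
  apply: (dual_norm_le E0 NZ) => x /E_bloch bx Nx; rewrite (le_trans (fl x bx))//.
  by rewrite ler_piMr.
exists (fun k => functional (a k)), (fun k => image (a k)); split => //.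
- move=> k; have [lin _ [lam [Y [l0 Y0 fl kY le]]]] := a_ok k.
  by have [] := image_bloch (a_ok k) kY.
- apply: nondecreasing_is_cvgn.
    by apply/nondecreasing_seqP => n; rewrite !seriesEnat /= big_nat_recr//= lerDl; have /andP[] := term n.
  exists C => _ [n _ <-]; rewrite seriesEnat /= (le_trans _ (a_cost n))// big_mkord.
  by apply: ler_sum => k _; have /andP[] := term k.
move=> x /E_bloch bx.
have s0 : N x * (limn s - s n) @[n --> \oo] --> (0 : R).
  rewrite -[X in _ --> X](mulr0 (N x)) -(subrr (limn s)).
  by apply: cvgMr; apply: cvgB; [exact: cvg_cst|exact: s_cvg].
apply: (squeeze_cvgr _ (cvg_cst 0) s0).
apply: nearW => n; rewrite atoms_remainder_norm// andbT.
have [H1 H2 H3] := atoms_remainder n bx.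
rewrite [X in 0 <= X]/bloch_norm addr_ge0 ?normc_ge0//.
set D := T x - _; set S := [set _ | _ in _].
(* A set without supremum gets the value 0, so nonnegativity holds in that case as well. *)
have [[ne ub]|ns] := pselect (has_sup S); last by rewrite sup_out.
apply: (@le_trans _ _ (bloch_weight gamma D 0)); first exact: bloch_weight_ge0.
by apply: (ub_le_sup ub); exists 0 => //; exact: unit_disk_nonempty.
Qed.

End AtomicNuclear.

Section AtomicBlocks.
Context {R : realType}.
Variables (beta gamma : R) (g phi : R[i] -> R[i]).
Hypotheses (hbeta : 1 < beta) (hg : holomorphic_disk g) (hphi : holomorphic_disk phi).
Hypothesis hphiD : forall z, normc z < 1 -> normc (phi z) < 1.
Hypothesis hS : bounded_operator (bloch beta) (bloch_norm beta)
            (bloch gamma) (bloch_norm gamma) (volterra g phi).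

Local Notation T := (volterra g phi).
Local Notation W := (weight_symbol gamma g).
Local Notation N := (bloch_norm beta).
Local Notation ok := (atom_ok beta gamma g phi).

(** A zero atom is put in front of every block, so that n blocks contain at least n atoms even if
    some are empty, and the k-th atom of the whole sequence is found in the first k + 1 blocks. *)
Definition atom0 : @atom R := (fun=> 0, fun=> 0, 0).

Lemma atom0_ok : ok atom0.
Proof.
split; first by move=> a x y _ _; rewrite /functional /= scaler0 addr0.
  by move=> z _; exists 0; exact: cdiff_cst.
exists 0, 0; split => // [f _|z _|].
- by rewrite /functional /= normc0 mul0r.
- by rewrite /kernel /= normc0 mulr0.
- by rewrite mul0r.
Qed.

Variable B : nat -> seq (@atom R).

Let U n := flatten [seq atom0 :: B i | i <- iota 0 n].

Let US n : U n.+1 = U n ++ atom0 :: B n.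
Proof. by rewrite /U -addn1 iotaD map_cat flatten_cat /= cats0. Qed.

Let size_U n : (n <= size (U n))%N.
Proof.
elim: n => // n IH; by rewrite US size_cat /= addnS ltnS (leq_trans IH)// leq_addr.
Qed.

Let nth_U n m k : (n <= m)%N -> (k < size (U n))%N -> nth atom0 (U m) k = nth atom0 (U n) k.
Proof.
move=> /subnK <- kn; elim: (m - n)%N => [|d IH]; first by rewrite add0n.
rewrite addSn US nth_cat; case: ifP => // /negP[]; apply: (leq_trans kn).
elim: d {IH} => [|d IH]; first by rewrite add0n.
by rewrite addSn US size_cat (leq_trans IH)// leq_addr.
Qed.

Let a k := nth atom0 (U k.+1) k.

Let sum_a (Z : nmodType) (F : atom -> Z) n : F atom0 = 0 ->
  \sum_(k < size (U n)) F (a k) = \sum_(m < n) \sum_(b <- B m) F b.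
Proof.
move=> F0; transitivity (\sum_(b <- U n) F b).
  rewrite (big_nth atom0) big_mkord; apply: eq_bigr => -[k kn] _ /=; congr F.
  by rewrite /a -(nth_U (leq_maxr n k.+1) (size_U k.+1)) (nth_U (leq_maxl n k.+1)).
rewrite /U big_flatten big_map sum_iota; apply: eq_bigr => m _.
by rewrite big_cons F0; exact: add0r.
Qed.

Hypothesis B_ok : forall n b, b \in B n -> ok b.
Variable C : R.
Hypothesis B_cost : forall n, \sum_(m < n) \sum_(b <- B m) cost b <= C.
Hypothesis B_cvg : forall f w (e : R), bloch beta f -> normc w < 1 -> 0 < e ->
  exists n0, forall n, (n0 <= n)%N ->
   normc (derive1 f w - \sum_(m < n) \sum_(b <- B m) functional b f * kernel b w) <= e.

Variable E : set (R[i] -> R[i]).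
Hypotheses (E_bloch : forall f, E f -> bloch beta f)
  (E0 : E 0).

Lemma nuclear_of_blocks : nuclear E N (bloch gamma) (bloch_norm gamma) T.
Proof.
have U_ok n b : b \in U n -> ok b.
  move=> /flattenP[s /mapP[i _ ->]]; rewrite inE => /orP[/eqP ->|/B_ok//].
  exact: atom0_ok.
have a_ok k : ok (a k) by apply: (@U_ok k.+1); rewrite mem_nth// size_U.
apply: (@nuclear_of_atoms _ beta gamma g phi hbeta hg hphi hphiD hS a a_ok C (fun n => size (U n))) => //.
- move=> n; rewrite (@le_trans _ _ (\sum_(k < size (U n)) cost (a k)))//; last by rewrite sum_a.
  rewrite -!(big_mkord xpredT (fun k => cost (a k))) (@big_cat_nat _ _ _ n 0 (size (U n)))//= lerDl.
  by apply: sumr_ge0 => k _; exact: atom_cost_ge0 (a_ok k).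
- move=> f w e bf w1 e0; have [n0 n0P] := B_cvg bf w1 e0; exists n0 => n nn.
  rewrite (sum_a (F := fun b => functional b f * kernel b w)) ?n0P//.
  by rewrite /functional /= mul0r.
Qed.

End AtomicBlocks.

(** * Quadrature of the levels over roots of unity *)

Section Discretization.
Context {R : realType}.
Variables (beta gamma : R) (g phi : R[i] -> R[i]).
Hypotheses (hbeta : 1 < beta) (hg : holomorphic_disk g) (hphi : holomorphic_disk phi).
Hypothesis hphiD : forall z, normc z < 1 -> normc (phi z) < 1.
Hypothesis hS : bounded_operator (bloch beta) (bloch_norm beta)
            (bloch gamma) (bloch_norm gamma) (volterra g phi).

Local Notation W := (weight_symbol gamma g).
Local Notation N := (bloch_norm beta).
Local Notation ok := (atom_ok beta gamma g phi).

Let b0 : 0 < beta. Proof. exact: lt_trans ltr01 hbeta. Qed.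

Lemma bloch_node m n j f : bloch beta f ->
  normc (derive1 f (node m n j)) <= dyad m `^ (- beta) * N f.
Proof.
move=> bf; have := bloch_weight_le_norm bf (normc_node_lt1 m n j).
rewrite /bloch_weight normc_node powRN => H.
have d0 := @dyad_gt0 R m.
rewrite ler_pdivlMl ?powR_gt0// (le_trans _ H)// ler_wpM2r ?normc_ge0//.
apply: powR_le; rewrite ?(ltW b0) ?(ltW d0)//.
have r0 := @radius_ge0 R m; have r1 := @radius_lt1 R m.
have -> : dyad m = 1 - radius m :> R by rewrite /radius opprB addrC subrK.
by rewrite lerD2l lerN2 expr2 ler_piMl// ltW.
Qed.

(** The norm bounds f' on a circle of radius s between r and 1, and Cauchy's formula carries the
    bound inside. Since lam depends on r alone, values of f' and their differences at neighbouring
    nodes are functionals of controlled norm. *)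
Lemma bloch_compact (r : R) : 0 <= r -> r < 1 -> exists2 lam : R, 0 <= lam &
  forall f, bloch beta f ->
   (forall u, normc u <= r -> normc (derive1 f u) <= lam * N f) /\
   (forall u v, normc u <= r -> normc v <= r ->
     normc (derive1 f u - derive1 f v) <= lam * N f * normc (u - v)).
Proof.
move=> r0 r1; pose s := (1 + r) / 2.
have rs : r < s by rewrite /s; move: r1; lra.
have s1 : s < 1 by rewrite /s; move: r1; lra.
have s0 : 0 < s := le_lt_trans r0 rs.
have q1 : r / s < 1 by rewrite ltr_pdivrMr// mul1r.
have q2 : 0 < 1 - r / s by rewrite subr_gt0.
pose c := (1 - s ^+ 2) `^ beta.
have c0 : 0 < c by rewrite /c powR_gt0// subr_gt0 expr2 mulr_ilt1 ?(ltW s0).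
have sc : s%:C != 0 :> R[i] by rewrite -normc_gt0 normc_real normr_gt0 gt_eqF.
pose k := 2 * (c^-1 / (1 - r / s)); pose k' := 2 * (c^-1 / (1 - r / s) ^+ 2) / s.
have k0 : 0 <= k by rewrite mulr_ge0// divr_ge0 ?invr_ge0 ?(ltW c0) ?(ltW q2).
have k'0 : 0 <= k' by rewrite divr_ge0 ?(ltW s0)// mulr_ge0// divr_ge0 ?invr_ge0 ?(ltW c0)// exprn_ge0// ltW.
exists (k + k'); first by rewrite addr_ge0.
move=> f bf; have Nf := bloch_norm_ge0 bf.
have hh := hol_derive1_hol (holomorphic_hol bf.1).
have hB t : normc (derive1 f (s%:C * cexp t)) <= c^-1 * N f.
  have ns : normc (s%:C * cexp t) = s by rewrite normc_realM normc_cexp mulr1 gtr0_norm.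
  rewrite ler_pdivlMl//; have := @bloch_weight_le_norm _ beta f (s%:C * cexp t) bf.
  by rewrite /bloch_weight ns; apply.
have uE u : u = s%:C * (u / s%:C) by rewrite mulrC divfK.
have uq u : normc u <= r -> normc (u / s%:C) <= r / s.
  by move=> ur; rewrite normcM normcV normc_real gtr0_norm// ler_wpM2r// invr_ge0 ltW.
split => [u ur|u v ur vr].
  have := circle_bound hh s0 s1 q1 hB (uq u ur); rewrite -uE => H; rewrite (le_trans H)//.
  have -> : 2 * (c^-1 * N f / (1 - r / s)) = k * N f by rewrite /k; ring.
  by rewrite ler_wpM2r// lerDl.
have := circle_lip hh s0 s1 q1 hB (uq u ur) (uq v vr); rewrite -!uE => H; rewrite (le_trans H)//.
rewrite -mulrBl normcM normcV normc_real gtr0_norm//.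
have key (a b d e p : R) : 2 * (a * b / d) * (e / p) = 2 * (a / d) / p * b * e by ring.
rewrite key -/k' ler_wpM2r ?normc_ge0// ler_wpM2r// lerDr//.
Qed.

Lemma derive1_linear_on (c : R[i]) u : normc u < 1 ->
  linear_on (bloch beta) (fun f => c * derive1 f u).
Proof.
move=> u1 x f h bf bh; have [_ ->//] := holomorphic_disk_comb x bf.1 bh.1.
have key (p q r s : R[i]) : p * (q * r + s) = q * (p * r) + p * s by ring.
exact: key.
Qed.

Section OneLevel.
Variables (m : nat) (L : seq (R * R)).
Hypothesis HL : unit_scales L.

Definition quadrature (n : nat) (h : R[i] -> R[i]) (w : R[i]) : R[i] :=
  ((n%:R : R)^-1)%:C * \sum_(j < n) h (node m n j) * kap L ((node m n j)^*%C * w).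

(* The difference of the averages over 2n and over n roots of unity is the sum of
   h(v) k(v) - h(u) k(u) = (h(v) - h(u)) k(v) + h(u) (k(v) - k(u)),
   over 2n, for u an even node and v the next one. *)
Definition refine_left (D : R) (n j : nat) : @atom R :=
  let u := node m n.*2 j.*2 in let v := node m n.*2 j.*2.+1 in
  (fun f : R[i] -> R[i] => ((n.*2%:R : R)^-1)%:C * (derive1 f v - derive1 f u), fun w : R[i] => kap L (v^*%C * w), D / n%:R ^+ 2).

Definition refine_right (D : R) (n j : nat) : @atom R :=
  let u := node m n.*2 j.*2 in let v := node m n.*2 j.*2.+1 in
  (fun f : R[i] -> R[i] => ((n.*2%:R : R)^-1)%:C * derive1 f u, fun w : R[i] => kap L (v^*%C * w) - kap L (u^*%C * w), D / n%:R ^+ 2).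

Definition refinement (D : R) n : seq (@atom R) :=
  [seq refine_left D n j | j <- iota 0 n] ++ [seq refine_right D n j | j <- iota 0 n].

Lemma node_double n j : (0 < n)%N -> node m n.*2 j.*2 = node m n j :> R[i].
Proof.
move=> n0; rewrite /node; congr (_ * cexp _).
by rewrite -!muln2 !natrM invfM mulrACA divff ?mulr1.
Qed.

Lemma sum_double (Z : nmodType) n (F : nat -> Z) :
  \sum_(j < n.*2) F j = \sum_(j < n) (F j.*2 + F j.*2.+1).
Proof.
elim: n => [|n IH]; first by rewrite !big_ord0.
by rewrite doubleS !big_ord_recr /= IH addrA.
Qed.

Lemma refinement_sum D n f w : (0 < n)%N ->
  \sum_(b <- refinement D n) functional b f * kernel b w =
  quadrature n.*2 (derive1 f) w - quadrature n (derive1 f) w.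
Proof.
move=> n0; have -> : \sum_(b <- refinement D n) functional b f * kernel b w =
  \sum_(j < n) (functional (refine_left D n j) f * kernel (refine_left D n j) w +
    functional (refine_right D n j) f * kernel (refine_right D n j) w).
  by rewrite [RHS]big_split /refinement big_cat !big_map !sum_iota.
pose h j := derive1 f (node m n.*2 j); pose k j := kap L ((node m n.*2 j)^*%C * w).
have e : n%:R^-1 = n.*2%:R^-1 * 2 :> R.
  by rewrite -muln2 natrM invfM -mulrA mulVf ?mulr1.
have e' : (n%:R^-1 : R)%:C = (n.*2%:R^-1 : R)%:C * (1 + 1).
  by rewrite e (rmorphM (real_complex R)) -[2]/(1 + 1) (rmorphD (real_complex R)).
rewrite /quadrature (sum_double n (fun j => h j * k j)) e' -mulrA -mulrBr mulr_sumr -sumrB mulr_sumr.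
apply: eq_bigr => j _; rewrite -(node_double j n0).
have key (c p q r s : R[i]) : c * (q - p) * s + c * p * (s - r) = c * (p * r + q * s - (1 + 1) * (p * r)) by ring.
exact: (key _ (h j.*2) (h j.*2.+1) (k j.*2) (k j.*2.+1)).
Qed.

(** Each correction atom has a factor 1 / (2n) and a difference over neighbouring nodes, of size
    O(1/n), hence a cost O(n^-2). The constant depends on the circle and on the kernel in an
    uncontrolled way. *)
Lemma quadrature_level : exists2 D : R, 0 <= D &
  (forall f w n, bloch beta f -> normc w < 1 -> (0 < n)%N ->
    normc (quadrature n (derive1 f) w -
      cint 0 1 (fun t => derive1 f ((radius m)%:C * cexp t) *
        kap L (cexp (- t) * ((radius m)%:C * w)))) <= D * N f / n%:R) /\
  forall n b, (0 < n)%N -> b \in refinement D n -> ok b.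
Proof.
have r0 := @radius_ge0 R m; have r1 := @radius_lt1 R m.
have [lam lam0 lamP] := bloch_compact r0 r1.
have [C C0 [Clip Cbd]] := kap_lipschitz HL r1.
have [BW WB] := weight_symbol_bounded hbeta hg hphi hphiD hS.
have BW0 : 0 <= BW.
  by rewrite (le_trans _ (WB 0 unit_disk_nonempty))// weight_symbol_ge0.
have pi0 : 0 <= pi :> R := pi_ge0 R.
(* [D1] comes from the error of the Riemann sum, [D2] from the product of 1 / (2n), the distance 4
   pi / (2n) of neighbouring nodes and the bounds for f', the kernel and W. *)
pose D1 := 16 * pi * lam * C; pose D2 := pi * lam * C * BW.
have D10 : 0 <= D1 by rewrite !mulr_ge0.
have D20 : 0 <= D2 by rewrite !mulr_ge0.
exists (D1 + D2); first by rewrite addr_ge0.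
split=> [f w n bf w1 n0|n b n0].
  have Nf := bloch_norm_ge0 bf; have [fb fl] := lamP f bf.
  pose G (t : R) : R[i] := derive1 f ((radius m)%:C * cexp t) * kap L (cexp (- t) * ((radius m)%:C * w)).
  have nr (t : R) : normc ((radius m)%:C * cexp t) <= radius m.
    by rewrite normc_realM normc_cexp mulr1 ger0_norm.
  have nw (t : R) : normc (cexp (- t) * ((radius m)%:C * w)) <= radius m.
    by rewrite normc_rotate normc_realM ger0_norm// ler_piMr// ltW.
  have Glip s t : normc (G s - G t) <= (8 * pi * lam * C * N f) * `|s - t|.
    have -> : G s - G t = (derive1 f ((radius m)%:C * cexp s) - derive1 f ((radius m)%:C * cexp t)) *
       kap L (cexp (- s) * ((radius m)%:C * w)) + derive1 f ((radius m)%:C * cexp t) *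
       (kap L (cexp (- s) * ((radius m)%:C * w)) - kap L (cexp (- t) * ((radius m)%:C * w))).
      have key (p q r u : R[i]) : p * q - r * u = (p - r) * q + r * (q - u) by ring.
      exact: key.
    rewrite (le_trans (normcD _ _))// !normcM.
    have h1 : normc (derive1 f ((radius m)%:C * cexp s) - derive1 f ((radius m)%:C * cexp t)) <=
        lam * N f * (4 * pi * `|s - t|).
      rewrite (le_trans (fl _ _ (nr s) (nr t)))// ler_wpM2l ?mulr_ge0//.
      rewrite -mulrBr normc_realM ger0_norm// (le_trans _ (cexp_lipschitz s t))//.
      by rewrite ler_piMl ?normc_ge0// ltW.
    have h2 : normc (kap L (cexp (- s) * ((radius m)%:C * w)) - kap L (cexp (- t) * ((radius m)%:C * w))) <=
        C * (4 * pi * `|s - t|).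
      rewrite (le_trans (Clip _ _ (nw s) (nw t)))// ler_wpM2l// (le_trans (rotate_lip _ _ _))//.
      rewrite ler_wpM2r// ler_piMr ?mulr_ge0// normc_realM ger0_norm// mulr_ile1 ?normc_ge0 ?(ltW w1)//.
      exact: ltW.
    rewrite (le_trans (lerD (ler_pM (normc_ge0 _) (normc_ge0 _) h1 (Cbd _ (nw s)))
      (ler_pM (normc_ge0 _) (normc_ge0 _) (fb _ (nr t)) h2)))//.
    have key (a c d e p : R) : a * d * (4 * p * e) * c + a * d * (c * (4 * p * e)) = 8 * p * a * c * d * e by ring.
    by rewrite key.
  have := riemann_sum01 n0 Glip; rewrite normc_distC.
  have -> : (n%:R^-1)%:C * \sum_(j < n) G (j%:R / n%:R) = quadrature n (derive1 f) w.
    congr (_ * _); apply: eq_bigr => j _; rewrite /G conj_node /node; congr (_ * kap L _).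
    by rewrite mulrCA mulrA.
  move=> H; rewrite (le_trans H)// ler_wpM2r ?invr_ge0//.
  have -> : 2 * (8 * pi * lam * C * N f) = D1 * N f.
    have key (p q r u : R) : 2 * (8 * p * q * r * u) = 16 * p * q * r * u by ring.
    exact: key.
  by rewrite ler_wpM2r// lerDl.
have nn0 : 0 < n%:R :> R by rewrite ltr0n.
have nn2 : n.*2%:R = 2 * n%:R :> R by rewrite -muln2 natrM mulrC.
have nd j : normc (node m n.*2 j.*2.+1 - node m n.*2 j.*2 : R[i]) <= 4 * pi * n.*2%:R^-1.
  rewrite /node -mulrBr normc_realM ger0_norm//.
  rewrite (@le_trans _ _ (normc (cexp (j.*2.+1%:R / n.*2%:R) - cexp (j.*2%:R / n.*2%:R) : R[i])))//.
    by rewrite ler_piMl ?normc_ge0// ltW.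
  rewrite (le_trans (cexp_lipschitz _ _))// ler_wpM2l ?mulr_ge0//.
  by rewrite -mulrBl -natr1 addrAC subrr add0r mul1r ger0_norm// invr_ge0.
have nw j (z : R[i]) : normc z < 1 -> normc ((node m n.*2 j)^*%C * z) <= radius m.
  by move=> z1; rewrite normcM normcJ normc_node ler_piMr// ltW.
have c0 : 0 <= n.*2%:R^-1 :> R by rewrite invr_ge0.
have nj j : normc (node m n.*2 j : R[i]) <= radius m by rewrite normc_node.
have hk j : hol (fun w : R[i] => kap L ((node m n.*2 j)^*%C * w)).
  by apply: hol_kap => //; rewrite normcJ normc_node ltW.
have cost_le : n.*2%:R^-1 * (lam * (4 * pi * n.*2%:R^-1)) * (BW * C) <= (D1 + D2) / n%:R ^+ 2.
  rewrite nn2 invfM.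
  have -> : 2^-1 * n%:R^-1 * (lam * (4 * pi * (2^-1 * n%:R^-1))) * (BW * C) = D2 / n%:R ^+ 2.
    by rewrite /D2; field; rewrite pnatr_eq0 -lt0n.
  by rewrite ler_wpM2r ?invr_ge0 ?exprn_ge0// lerDr.
rewrite mem_cat => /orP[] /mapP[j _ ->]; split.
- move=> x f h bf bh; rewrite /functional /=.
  have [_ H] := holomorphic_disk_comb x bf.1 bh.1; rewrite !H ?normc_node_lt1//.
  have key (c p q r s t : R[i]) : c * (p * q + r - (p * s + t)) = p * (c * (q - s)) + c * (r - t) by ring.
  exact: key.
- exact: hk.
- exists (n.*2%:R^-1 * (lam * (4 * pi * n.*2%:R^-1))), (BW * C); split => //.
  + by rewrite !mulr_ge0.
  + by rewrite !mulr_ge0.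
  + move=> f bf; have [_ fl] := lamP f bf; have Nf := bloch_norm_ge0 bf.
    rewrite /functional /= normc_realM ger0_norm// -[leRHS]mulrA ler_wpM2l//.
    rewrite (le_trans (fl _ _ (nj _) (nj _)))// mulrAC ler_wpM2r//.
    by rewrite ler_wpM2l.
  + move=> z z1; rewrite ler_pM ?weight_symbol_ge0 ?normc_ge0 ?WB//.
    by apply: Cbd; apply: nw; exact: hphiD.
- exact: derive1_linear_on (normc_node_lt1 _ _ _).
- move=> z z1; have [l1 H1] := hk j.*2.+1 z z1; have [l2 H2] := hk j.*2 z z1.
  by exists (l1 - l2); exact: cdiffB.
- exists (n.*2%:R^-1 * lam), (BW * (C * (4 * pi * n.*2%:R^-1))); split => //.
  + by rewrite !mulr_ge0.
  + by rewrite !mulr_ge0.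
  + move=> f bf; have [fb _] := lamP f bf.
    by rewrite /functional /= normc_realM ger0_norm// -[leRHS]mulrA ler_wpM2l// fb.
  + move=> z z1; rewrite ler_pM ?weight_symbol_ge0 ?normc_ge0 ?WB//.
    rewrite (le_trans (Clip _ _ (nw _ _ (hphiD z1)) (nw _ _ (hphiD z1))))// ler_wpM2l//.
    rewrite -mulrBl -conjcB normcM normcJ.
    by rewrite (le_trans _ (nd j))// ler_piMr ?normc_ge0// ltW// hphiD.
  + rewrite (le_trans _ cost_le)// le_eqVlt; apply/orP; left; apply/eqP.
    have key (p q r u v : R) : p * q * (u * (v * r)) = p * (q * r) * (u * v) by ring.
    exact: key.
Qed.

End OneLevel.

Definition main_atoms (M : nat) (c : R -> R) (G : R[i] -> R) (m n : nat) : seq (@atom R) :=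
  [seq (fun f : R[i] -> R[i] => ((n%:R : R)^-1)%:C * derive1 f (node m.+1 n j),
        fun w : R[i] => kap (level M m) ((node m.+1 n j)^*%C * w),
        n%:R^-1 * (c (dyad m.+1) * G (node m.+1 n j))) | j <- iota 0 n].

(** The value of f' at a node costs d_(m+1)^-beta, the kernel is at most K d_m^M |1 - conj(zeta)
    w|^-(M+1), and G absorbs the latter together with W; the factor 2^M comes from d_m = 2
    d_(m+1). *)
Lemma main_atoms_ok M (K : R) G m n b : (0 < M)%N -> 0 <= K ->
  (forall m v, normc v < 1 -> normc (kap (@level R M m) v) <= K * dyad m ^+ M * normc (ck v) ^+ M.+1) ->
  (forall zeta, normc zeta < 1 -> 0 <= G zeta) ->
  (forall zeta z, normc zeta < 1 -> normc z < 1 -> W z * cker M.+1%:R zeta (phi z) <= G zeta) ->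
  b \in main_atoms M (fun d => K * 2 ^+ M * d `^ (M%:R - beta)) G m n -> ok b.
Proof.
move=> M0 K0 HK G0 GW /mapP[j _ ->]; split.
- exact: derive1_linear_on (normc_node_lt1 _ _ _).
- by apply: hol_kap; [exact: level_scales|rewrite normcJ normc_node ltW// radius_lt1].
have d0 := @dyad_gt0 R m.+1; have d0' := @dyad_gt0 R m.
have u1 := @normc_node_lt1 R m.+1 n j; set u := node m.+1 n j.
exists (n%:R^-1 * dyad m.+1 `^ (- beta)), (K * dyad m ^+ M * G u); split.
- by rewrite mulr_ge0 ?invr_ge0 ?powR_ge0.
- by rewrite !mulr_ge0 ?exprn_ge0 ?(ltW d0')// G0.
- move=> f bf; rewrite /functional /= normc_realM ger0_norm ?invr_ge0// -[leRHS]mulrA.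
  by rewrite ler_wpM2l ?invr_ge0// bloch_node.
- move=> z z1; have p1 := hphiD z1.
  have uz : normc (u^*%C * phi z) < 1.
    by rewrite normcM normcJ mulr_ilt1 ?normc_ge0.
  rewrite /kernel (le_trans (ler_wpM2l (weight_symbol_ge0 _ _ _) (HK m _ uz)))//.
  rewrite mulrCA ler_wpM2l ?mulr_ge0 ?exprn_ge0 ?(ltW d0')//.
  rewrite (le_trans _ (GW u z u1 z1))// ler_wpM2l ?weight_symbol_ge0//.
  by rewrite /cker powR_mulrn ?normc_ge0// /ck normcV exprVn.
- rewrite /cost /= -!mulrA ler_wpM2l ?invr_ge0//.
  have -> : dyad m.+1 `^ (M%:R - beta) = dyad m.+1 `^ (- beta) * (dyad m ^+ M / 2 ^+ M) :> R.
    rewrite addrC powRDp//; congr (_ * _).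
    by rewrite powR_mulrn ?(ltW d0)// dyadS exprMn [2^-1 ^+ M]exprVn.
  have p2 : 2 ^+ M != 0 :> R by rewrite expf_neq0.
  have key (p q r s t : R) : s != 0 -> p * (q * (r * t)) = q * (s * (p * (r / s) * t)).
    by move=> s0; field.
  by rewrite (key _ _ _ _ _ p2).
Qed.

Variable E : set (R[i] -> R[i]).
Hypotheses (E_bloch : forall f, E f -> bloch beta f)
  (E0 : E 0).

Lemma cell_summable_nuclear : cell_summable W phi beta ->
  nuclear E N (bloch gamma) (bloch_norm gamma) (volterra g phi).
Proof.
move=> hc; have := archi_boundP (ltW b0); set M := Num.Def.archi_bound _ => bM.
have M1 : (1 < M)%N by rewrite -(ltr_nat R) (lt_trans hbeta).
have M0 : (0 < M)%N := ltnW M1.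
have [BW WB] := weight_symbol_bounded hbeta hg hphi hphiD hS.
have s2 : 2 <= M.+1%:R :> R by rewrite ler_nat ltnW.
have sb : 0 < M.+1%:R - 1 - beta by rewrite -natr1 addrK subr_gt0.
have [G [G0 GW [CG GC]]] := majorant (fun z _ => weight_symbol_ge0 gamma g z) WB hphiD s2 b0 sb hc.
have [K K0 HK] := @level_kernel_bound R M.
pose P m (d : R) := [/\ 0 <= d,
    forall f w n, bloch beta f -> normc w < 1 -> (0 < n)%N ->
      normc (quadrature m.+1 (level M m) n (derive1 f) w -
        cint 0 1 (fun t => derive1 f ((radius m.+1)%:C * cexp t) *
          kap (level M m) (cexp (- t) * ((radius m.+1)%:C * w)))) <= d * N f / n%:R &
    forall n b, (0 < n)%N -> b \in refinement m.+1 (level M m) d n -> ok b].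
have [D DP] : {D : nat -> R & forall m, P m (D m)}.
  apply: choice => m; have [d d0 [H1 H2]] := quadrature_level m.+1 (@level_scales R M m).
  by exists d; split.
have D0 m : 0 <= D m by have [] := DP m.
have Dq m := let: And3 _ H _ := DP m in H.
have Dr m := let: And3 _ _ H := DP m in H.
(* Level m starts with 2^(q m) times as many nodes as the lattice has, to absorb its uncontrolled
   constant [D m]. *)
have [q qP] : {q : nat -> nat & forall m, D m <= dyad m * (2 ^ q m)%:R}.
  apply: (@choice _ _ (fun m k => D m <= dyad m * (2 ^ k)%:R)) => m; have k0 : 0 <= D m / dyad m by rewrite divr_ge0// ltW// dyad_gt0.
  exists (Num.Def.archi_bound (D m / dyad m)).
  rewrite -ler_pdivrMl ?dyad_gt0// mulrC (le_trans (ltW (archi_boundP k0)))//.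
  by rewrite ler_nat ltnW// ltn_expl.
have p2 k : (0 < 2 ^ k)%N by rewrite expn_gt0.
have Dsmall m n : D m / (2 ^ (q m + n))%:R <= dyad m * dyad n.
  rewrite expnD natrM invfM mulrA -dyad_natr [dyad n]dyad_natr ler_wpM2r ?invr_ge0//.
  by rewrite [dyad (q m)]dyad_natr ler_pdivrMr ?ltr0n.
have dsum n : \sum_(m < n) @dyad R m <= 2.
  suff -> : \sum_(m < n) @dyad R m = 2 - 2 * dyad n by rewrite gerBl mulr_ge0// ltW// dyad_gt0.
  elim: n => [|n IH]; first by rewrite big_ord0 dyad0 mulr1 subrr.
  by rewrite big_ord_recr /= IH dyadS; field.
pose c (d : R) := K * 2 ^+ M * d `^ (M%:R - beta).
(* A diagonal enumeration: block n opens level n and doubles the nodes of every earlier level once,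
   so that after n blocks each level m < n is represented by its quadrature with 2^(q m + n)
   nodes. *)
pose B n : seq (@atom R) := main_atoms M c G n (2 ^ (q n + n).+1) ++
  flatten [seq refinement m.+1 (level M m) (D m) (2 ^ (q m + n)) | m <- iota 0 n].
have B_ok n b : b \in B n -> ok b.
  rewrite mem_cat => /orP[|/flattenP[s /mapP[m _ ->]]]; last exact: Dr.
  exact: main_atoms_ok.
pose Rq m n (f : R[i] -> R[i]) w := quadrature m.+1 (level M m) (2 ^ (q m + n)) (derive1 f) w.
have block_sum n f w : \sum_(m < n) \sum_(b <- B m) functional b f * kernel b w =
    \sum_(m < n) Rq m n f w.
  elim: n => [|n IH]; first by rewrite !big_ord0.
  rewrite big_ord_recr IH big_cat big_flatten big_map sum_iota.
  rewrite [RHS]big_ord_recr.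
  have -> : \sum_(b <- main_atoms M c G n (2 ^ (q n + n).+1)) functional b f * kernel b w = Rq n n.+1 f w.
    rewrite big_map sum_iota /Rq /quadrature addnS mulr_sumr; apply: eq_bigr => j _.
    by rewrite /functional /kernel mulrA.
  have -> : \sum_(m < n) \sum_(b <- refinement m.+1 (level M m) (D m) (2 ^ (q m + n)))
      functional b f * kernel b w = \sum_(m < n) (Rq m n.+1 f w - Rq m n f w).
    apply: eq_bigr => m _; rewrite refinement_sum// /Rq addnS expnS mul2n//.
  rewrite sumrB.
  have key (p r s : R[i]) : p + (r + (s - p)) = s + r by ring.
  exact: key.
(* The first summand pays for the opening quadratures, through the majorant; the second for the
   refinements, of total cost at most 2 d_m d_k for level m in block k. *)
pose Ctot := K * 2 ^+ M * CG + 4 * 2.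
apply: (@nuclear_of_blocks _ beta gamma g phi hbeta hg hphi hphiD hS B B_ok Ctot) => //.
- move=> n.
  have -> : \sum_(m < n) \sum_(b <- B m) cost b =
    \sum_(m < n) \sum_(b <- main_atoms M c G m (2 ^ (q m + m).+1)) cost b +
    \sum_(k < n) \sum_(m < k) \sum_(b <- refinement m.+1 (level M m) (D m) (2 ^ (q m + k))) cost b.
    rewrite -big_split; apply: eq_bigr => m _.
    by rewrite big_cat big_flatten big_map sum_iota.
  rewrite /Ctot lerD//.
    (* Level m lives on the circle of radius 1 - d_(m+1), whence the shift of index; the term k = 0
       of the majorant bound is dropped. *)
    pose Nn k := (2 ^ (q k.-1 + k))%N.
    have Nn2 m : (2 ^ m <= Nn m)%N by rewrite leq_exp2l// leq_addl.
    have := GC Nn n.+1 Nn2; rewrite -natr1 addrK.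
    rewrite big_ord_recl => H.
    rewrite (@le_trans _ _ (K * 2 ^+ M * \sum_(m < n) dyad m.+1 `^ (M%:R - beta) *
       ((Nn m.+1)%:R^-1 * \sum_(j < Nn m.+1) G (node m.+1 (Nn m.+1) j))))//.
      rewrite mulr_sumr le_eqVlt; apply/orP; left; apply/eqP; apply: eq_bigr => m _.
      rewrite big_map sum_iota /cost /c /= /Nn addnS -mulr_sumr -mulr_sumr.
      have key (r s t u v : R) : t * (r * s * u * v) = r * s * (u * (t * v)) by ring.
      exact: key.
    rewrite ler_wpM2l ?mulr_ge0 ?exprn_ge0// (le_trans _ H)// lerDr.
    rewrite mulr_ge0 ?powR_ge0// mulr_ge0 ?invr_ge0//; apply: sumr_ge0 => j _.
    by apply: G0; exact: normc_node_lt1.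
  rewrite (@le_trans _ _ (\sum_(k < n) 4 * dyad k))//; last by rewrite -mulr_sumr ler_wpM2l.
  apply: ler_sum => k _.
  rewrite (@le_trans _ _ (\sum_(m < k) 2 * (dyad m * dyad k)))//; last first.
    rewrite -mulr_sumr -mulr_suml mulrA ler_wpM2r// ?(ltW (dyad_gt0 _))//.
    by have := dsum k; lra.
  apply: ler_sum => m _.
  rewrite /refinement big_cat !big_map !sum_iota /cost /= !sumr_const card_ord.
  rewrite (le_trans _ (ler_wpM2l _ (Dsmall m k)))// le_eqVlt; apply/orP; left; apply/eqP.
  have n0 : (2 ^ (q m + k))%:R != 0 :> R by rewrite pnatr_eq0 -lt0n.
  by rewrite -mulr_natr; move: n0; set x := (2 ^ _)%:R; move=> n0; field.
- move=> f w e bf w1 e0; have Nf := bloch_norm_ge0 bf.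
  have hf := hol_derive1_hol (holomorphic_hol bf.1).
  have e2 : 0 < e / 2 by rewrite divr_gt0.
  have [n0 n0P] := tau_cvg0 M0 hf w1 e2.
  have k0 : 0 <= 4 * N f / e by rewrite divr_ge0 ?mulr_ge0 ?(ltW e0).
  exists (maxn n0 (Num.Def.archi_bound (4 * N f / e))) => n; rewrite geq_max => /andP[n1 n2].
  rewrite block_sum.
  pose J m := cint 0 1 (fun t => derive1 f ((radius m.+1)%:C * cexp t) *
        kap (level M m) (cexp (- t) * ((radius m.+1)%:C * w))).
  (* By telescoping of the exact circle means, what remains is a [tau] term that tends to 0 at w and
     quadrature errors of at most N f d_m d_n, hence at most 2 N f d_n in all. *)
  have -> : derive1 f w - \sum_(m < n) Rq m n f w =
     tau (scale n) (order M n) (derive1 f) w - \sum_(m < n) (Rq m n f w - J m).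
    rewrite sumrB (level_telescope M n hf w1).
    have key (p r s : R[i]) : p - r = s - (r - (p - s)) by ring.
    exact: key.
  rewrite (le_trans (normcB _ _))// (splitr e) lerD ?n0P//.
  rewrite (le_trans (normc_sum _ _ _))//.
  rewrite (@le_trans _ _ (\sum_(m < n) N f * (dyad m * dyad n)))//.
    apply: ler_sum => m _; rewrite (le_trans (Dq m f w _ bf w1 (p2 _)))//.
    by rewrite [D m * _]mulrC -mulrA ler_wpM2l.
  rewrite -mulr_sumr -mulr_suml (@le_trans _ _ (N f * (2 * dyad n)))//.
    by rewrite ler_wpM2l// ler_wpM2r// ltW// dyad_gt0.
  have : 4 * N f / e <= 2 ^+ n.
    rewrite (le_trans (ltW (archi_boundP k0)))// -natrX ler_nat (leq_trans n2)// ltnW// ltn_expl//.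
  rewrite ler_pdivrMr// => H.
  have z0 : 0 < 2 ^+ n :> R by rewrite exprn_gt0.
  rewrite /dyad mulrA ler_pdivrMr//; move: H; set z := 2 ^+ n; move=> H; nra.
Qed.

End Discretization.

(** * The little Bloch space and the equivalence of the three statements *)

Section LittleBloch.
Context {R : realType}.
Implicit Types (f h : R[i] -> R[i]) (beta : R).

Lemma little_bloch_comb beta (a : R[i]) f h : little_bloch beta f -> little_bloch beta h ->
  little_bloch beta (a *: f + h).
Proof.
move=> [hf Hf] [hh Hh]; have [hc dc] := holomorphic_disk_comb a hf hh; split; first exact: hc.
move=> e e0.
have a1 : 0 < normc a + 1 by rewrite ltr_wpDl ?normc_ge0.
have e1 : 0 < e / 2 / (normc a + 1) by rewrite !divr_gt0.
have e2 : 0 < e / 2 by rewrite divr_gt0.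
near=> r => z zr.
have r1 : r < 1 by near: r; exact: nbhs_left_lt.
have z1 : normc z < 1 by rewrite zr.
have F : forall z, normc z = r -> bloch_weight beta f z < e / 2 / (normc a + 1).
  by near: r; exact: Hf.
have G : forall z, normc z = r -> bloch_weight beta h z < e / 2 by near: r; exact: Hh.
rewrite /bloch_weight dc// (splitr e).
rewrite (le_lt_trans (ler_wpM2l (powR_ge0 _ _) (normcD _ _)))// mulrDr.
apply: ler_ltD; last exact: G.
rewrite normcM mulrCA (@le_trans _ _ ((normc a + 1) * (e / 2 / (normc a + 1))))//.
  by rewrite ler_pM ?normc_ge0 ?bloch_weight_ge0 ?lerDl// ltW// F.
by rewrite mulrC divfK// gt_eqF.
Unshelve. all: by end_near. Qed.

Lemma little_bloch0 beta : 0 < beta -> little_bloch beta (0 : R[i] -> R[i]).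
Proof.
move=> b0; apply: (@tame_little_bloch _ _ _ 0 b0 (@holomorphic_disk0 R)) => z _.
by rewrite derive1_zero normc0.
Qed.

End LittleBloch.

(** With s = alpha + 3 and b = beta, the condition s - 1 - b > 0 is alpha > beta - 2, and s - 2 - b
    is the exponent of the weight in (c). *)
Lemma kernel_sup_integral_iff (R : realType) (alpha beta gamma : R) (g phi : R[i] -> R[i]) (BW : R) :
  0 < beta -> 1 <= alpha + 2 -> beta - 2 < alpha ->
  (forall z, normc z < 1 -> weight_symbol gamma g z <= BW) ->
  (forall z, normc z < 1 -> normc (phi z) < 1) ->
  (disk_integral (fun zeta => kernel_sup alpha gamma g phi zeta *
      ((1 - normc zeta ^+ 2) `^ (alpha - beta + 1))%:E) < +oo)%E <->
  cell_summable (weight_symbol gamma g) phi beta.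
Proof.
move=> b0 a1 ab WB phi1.
have W0 z : normc z < 1 -> 0 <= weight_symbol gamma g z by move=> _; exact: weight_symbol_ge0.
have s2 : 2 <= alpha + 3 by move: a1; lra.
have a0 : 0 < alpha + 3 - 1 - beta by move: ab; lra.
have K_lower zeta z : normc zeta < 1 -> normc z < 1 ->
    ((weight_symbol gamma g z * cker (alpha + 3) zeta (phi z))%:E <= kernel_sup alpha gamma g phi zeta)%E.
  by move=> _ z1; apply: ereal_sup_ubound; exists z.
have K_upper zeta (x : R) : normc zeta < 1 ->
    (forall z, normc z < 1 -> weight_symbol gamma g z * cker (alpha + 3) zeta (phi z) <= x) ->
    (kernel_sup alpha gamma g phi zeta <= x%:E)%E.
  by move=> _ H; apply: ge_ereal_sup => _ [z z1 <-]; rewrite lee_fin; exact: H.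
have e : alpha - beta + 1 = alpha + 3 - 2 - beta by ring.
have pi1 : 0 < pi^-1 :> R by rewrite invr_gt0 pi_gt0.
rewrite /disk_integral e; set I := (\int[_]_(p in _) _)%E.
have -> : ((pi^-1 : R)%:E * I < +oo)%E <-> (I < +oo)%E.
  split => H; last by apply: lte_mul_pinfty => //; rewrite ?lee_fin ?(ltW pi1).
  have : I != +oo%E; last by rewrite ltey.
  by apply/eqP => II; move: H; rewrite II gt0_muley ?lte_fin.
split => H.
- exact: (integral_cell_summable W0 WB phi1 K_lower s2 H).
- exact: (cell_summable_integral W0 WB phi1 K_lower K_upper s2 b0 a0 H).
Qed.

Theorem corollary15 (R : realType) (alpha beta gamma : R) (g phi : R[i] -> R[i])
    (hbeta : 1 < beta) (hgamma : 0 < gamma) (halpha : beta - 2 < alpha)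
    (hg : holomorphic_disk g) (hphi : holomorphic_disk phi)
    (hphiD : forall z, unit_disk z -> unit_disk (phi z))
    (hS : bounded_operator (bloch beta) (bloch_norm beta)
            (bloch gamma) (bloch_norm gamma) (volterra g phi)) :
  [<-> nuclear (little_bloch beta) (bloch_norm beta)
         (bloch gamma) (bloch_norm gamma) (volterra g phi);
       nuclear (bloch beta) (bloch_norm beta)
         (bloch gamma) (bloch_norm gamma) (volterra g phi);
       (disk_integral (fun zeta => kernel_sup alpha gamma g phi zeta *
          ((1 - normc zeta ^+ 2) `^ (alpha - beta + 1))%:E)
        < +oo)%E ].
Proof.
have b0 : 0 < beta := lt_trans ltr01 hbeta.
have [BW WB] := weight_symbol_bounded hbeta hg hphi hphiD hS.
(* Here beta > 1 gives alpha > -1, so that the exponent alpha + 3 is at least 2, as the estimate of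
   the means over roots of unity requires. *)
have a1 : 1 <= alpha + 2 by move: hbeta halpha; lra.
have sub f : little_bloch beta f -> bloch beta f by exact: little_bloch_bloch.
have l0 := little_bloch0 b0.
have lZ (a : R[i]) (x : R[i] -> R[i]) : little_bloch beta x -> little_bloch beta (a *: x).
  by move=> lx; have := little_bloch_comb a lx l0; rewrite addr0.
have lD (x y : R[i] -> R[i]) : little_bloch beta x -> little_bloch beta y -> little_bloch beta (x + y).
  by move=> lx ly; have := little_bloch_comb 1 lx ly; rewrite scale1r.
have iffI := kernel_sup_integral_iff b0 a1 halpha WB hphiD.
have A : nuclear (little_bloch beta) (bloch_norm beta) (bloch gamma) (bloch_norm gamma)
    (volterra g phi) -> cell_summable (weight_symbol gamma g) phi beta.
  apply: (nuclear_cell_summable hbeta hg hphi hphiD hS sub l0 lZ lD) => f B.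
  exact: tame_little_bloch.
have B : nuclear (bloch beta) (bloch_norm beta) (bloch gamma) (bloch_norm gamma)
    (volterra g phi) -> cell_summable (weight_symbol gamma g) phi beta.
  apply: (nuclear_cell_summable hbeta hg hphi hphiD hS (fun _ => id) (bloch0 beta)
    (fun a f => @blochZ _ beta a f) (@blochD _ beta)) => f C.
  exact: tame_bloch.
tfae.
- by move=> /A; exact: (cell_summable_nuclear hbeta hg hphi hphiD hS (fun _ => id) (bloch0 beta)).
- by move=> /B /iffI.
- by move=> /iffI; exact: (cell_summable_nuclear hbeta hg hphi hphiD hS sub l0).
Qed.
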